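(* Let $(M,g)$ and $(M,g')$ be space-times (on the same manifold $M$) with Levi-Civita connections $\nabla$ and $\nabla'$ respectively, with $(M,g)$ non-flat and of holonomy type $R_7$. Suppose that $\nabla$ and $\nabla'$ are projectively related. Then $\nabla=\nabla'$ on $M$.
   Context: A space-time $(M,g)$ is a 4-dimensional, Hausdorff, connected, smooth manifold $M$ with a smooth metric $g$ of Lorentz signature $(-,+,+,+)$. It is non-flat if its curvature tensor $\mathrm{Riem}$ does not vanish identically on any non-empty open subset of $M$. Projectively related: $\nabla$ and $\nabla'$ (or $g$ and $g'$) are projectively related if their sets of unparametrised geodesics (geodesic paths) coincide; equivalently there is a global smooth 1-form $\psi$ on $M$ with $\Gamma'^a_{bc}-\Gamma^a_{bc}=\delta^a_b\psi_c+\delta^a_c\psi_b$ in every coordinate domain. Bivectors: for $m\in M$ and $p,q\in T_mM$, $p\wedge q$ denotes the bivector $F^{ab}=p^aq^b-q^ap^b$, identified (using $g(m)$) with the skew-self-adjoint endomorphism $F^a{}_b=F^{ac}g_{cb}$ of $T_mM$. A null tetrad at $m$ is a basis $l,n,x,y$ of $T_mM$ whose only non-vanishing inner products are $g(l,n)=g(x,x)=g(y,y)=1$. Holonomy type: let $\phi$ be the Lie algebra of the holonomy group of $\nabla$ at a point $m\in M$, regarded as a Lie algebra of skew-self-adjoint endomorphisms (bivectors) of $T_mM$. $(M,g)$ is of holonomy type $R_7$ if, for some null tetrad $l,n,x,y$ at $m$, $\phi$ is the 2-dimensional algebra spanned by $l\wedge n$ and $x\wedge y$. (The type does not depend on the choice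 of $m$.) *)

(* Defs.v *)
(* Smooth 4-manifolds, Lorentz metrics, geodesics and holonomy over an arbitrary
   [R : realType], in MathComp-Analysis.  Tensor fields are given by their
   components in the charts of a fixed atlas, together with the transformation
   law on overlaps. *)
From HB Require Import structures.
From mathcomp Require Import all_boot all_order all_algebra.
From mathcomp Require Import all_classical all_reals all_analysis.

Set Implicit Arguments.
Unset Strict Implicit.
Unset Printing Implicit Defensive.

Import Order.TTheory GRing.Theory Num.Theory.
Import numFieldNormedType.Exports.

Local Open Scope classical_set_scope.
Local Open Scope ring_scope.

Section Smoothness.
Context {R : realType} {V W : normedModType R}.

(* C^k on an open set [U] of a finite-dimensional space, through iterated
   directional derivatives in all directions.  Only the values of [f] near [U]
   matter. *)
Fixpoint Ck (k : nat) (U : set V) (f : V -> W) : Prop :=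
  (forall x, U x -> {for x, continuous f}) /\
  match k with
  | 0%N => True
  | k'.+1 => forall v : V, (forall x, U x -> derivable f x v) /\
                           Ck k' U (fun x => 'D_v f x)
  end.

Definition smooth (U : set V) (f : V -> W) : Prop := forall k, Ck k U f.

End Smoothness.

Section Manifold.
Context (R : realType) (M : topologicalType).

(* [cmap] and [cinv] are total functions; outside [cdom] and its image their
   values are irrelevant. *)
Record chart : Type := Chart {
  cdom : set M;
  cmap : M -> 'cV[R]_4;
  cinv : 'cV[R]_4 -> M;
  cdom_open : open cdom;
  cimg_open : open (cmap @` cdom);
  cmapK : forall p, cdom p -> cinv (cmap p) = p;
  cmap_continuous : forall p, cdom p -> {for p, continuous cmap};
  cinv_continuous : forall x, (cmap @` cdom) x -> {for x, continuous cinv}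
}.

Definition cimg (c : chart) : set 'cV[R]_4 := cmap c @` cdom c.

Definition transition (c c' : chart) : 'cV[R]_4 -> 'cV[R]_4 :=
  cmap c' \o cinv c.

Record manifold4 : Type := Manifold4 {
  atlas : set chart;
  atlas_cover : forall p, exists2 c, atlas c & cdom c p;
  atlas_compatible : forall c c', atlas c -> atlas c' ->
    smooth (cmap c @` (cdom c `&` cdom c')) (transition c c');
  manifold_hausdorff : hausdorff_space M;
  manifold_connected : connected [set: M]
}.

(* [chart_at X c p]: [c] is a coordinate chart of [X] around [p]. *)
Definition chart_at (X : manifold4) (c : chart) (p : M) : Prop :=
  atlas X c /\ cdom c p.

(* A tangent vector at [p] is the family of its components in the charts around
   [p]; components in other charts are unconstrained. *)
Definition tangent (X : manifold4) (p : M) (v : chart -> 'cV[R]_4) : Prop :=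
  forall c c', chart_at X c p -> chart_at X c' p ->
    v c' = 'D_(v c) (transition c c') (cmap c p).

End Manifold.

Section Metric.
Context {R : realType}.

Definition inner (G : 'M[R]_4) (u v : 'cV[R]_4) : R := (u^T *m G *m v) 0 0.

Definition minkowski : 'M[R]_4 :=
  diag_mx (\row_(i < 4) if i == 0 then -1 else 1).

Definition lorentz_signature (G : 'M[R]_4) : Prop :=
  exists2 P : 'M[R]_4, P \in unitmx & P^T *m G *m P = minkowski.

Record lorentz_metric (M : topologicalType) (X : manifold4 R M) : Type :=
  LorentzMetric {
  gcomp : chart R M -> 'cV[R]_4 -> 'M[R]_4;
  gcomp_smooth : forall c, atlas X c -> smooth (cimg c) (gcomp c);
  gcomp_sym : forall c x, atlas X c -> cimg c x -> (gcomp c x)^T = gcomp c x;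
  gcomp_signature : forall c x, atlas X c -> cimg c x ->
    lorentz_signature (gcomp c x);
  gcomp_tensor : forall c c' p, chart_at X c p -> chart_at X c' p ->
    forall u v : 'cV[R]_4,
      inner (gcomp c (cmap c p)) u v =
      inner (gcomp c' (cmap c' p))
            ('D_u (transition c c') (cmap c p))
            ('D_v (transition c c') (cmap c p))
}.

Definition partial (b : 'I_4) (f : 'cV[R]_4 -> R) (x : 'cV[R]_4) : R :=
  'D_(delta_mx b 0) f x.

(* [christoffel G x a b c] is Gamma^a_{bc} at [x], where [G] is the matrix of
   metric components as a function of the coordinates. *)
Definition christoffel (G : 'cV[R]_4 -> 'M[R]_4) (x : 'cV[R]_4)
    (a b c : 'I_4) : R :=
  2^-1 * \sum_(d < 4) invmx (G x) a d *
    (partial b (fun y => G y d c) x + partial c (fun y => G y b d) x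
     - partial d (fun y => G y b c) x).

(* R^a_{bcd} = d_c Gamma^a_{db} - d_d Gamma^a_{cb}
               + Gamma^a_{ce} Gamma^e_{db} - Gamma^a_{de} Gamma^e_{cb} *)
Definition riemann (G : 'cV[R]_4 -> 'M[R]_4) (x : 'cV[R]_4)
    (a b c d : 'I_4) : R :=
  partial c (fun y => christoffel G y a d b) x
  - partial d (fun y => christoffel G y a c b) x
  + \sum_(e < 4) (christoffel G x a c e * christoffel G x e d b
                  - christoffel G x a d e * christoffel G x e c b).

(* Gamma^a_{bc} u^b v^c *)
Definition christoffel_app (G : 'cV[R]_4 -> 'M[R]_4) (x u v : 'cV[R]_4) :
    'cV[R]_4 :=
  \col_(a < 4) \sum_(b < 4) \sum_(c < 4) christoffel G x a b c * u b 0 * v c 0.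

End Metric.

Section Geometry.
Context {R : realType} {M : topologicalType} {X : manifold4 R M}.
Implicit Types (g : lorentz_metric X) (gam : R -> M) (J : set R).

Definition nonflat g : Prop :=
  forall U : set M, open U -> U !=set0 ->
    exists p, exists c, [/\ U p, chart_at X c p &
      exists i j k l : 'I_4, riemann (gcomp g c) (cmap c p) i j k l != 0].

Definition same_connection g g' : Prop :=
  forall c x, atlas X c -> cimg c x ->
    forall i j k : 'I_4,
      christoffel (gcomp g c) x i j k = christoffel (gcomp g' c) x i j k.

Definition smooth_curve J gam : Prop :=
  (forall t, J t -> {for t, continuous gam}) /\
  (forall c, atlas X c ->
     smooth (J `&` gam @^-1` cdom c) (cmap c \o gam)).

(* Affinely parametrised geodesics on an open interval. *)
Definition geodesic g J gam : Prop :=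
  [/\ open J, is_interval J, smooth_curve J gam &
      forall t c, J t -> chart_at X c (gam t) ->
        let u := cmap c \o gam in
        derive1 (derive1 u) t +
        christoffel_app (gcomp g c) (u t) (derive1 u t) (derive1 u t) = 0].

(* [h] is a change of parameter from the open interval [J'] onto [J]. *)
Definition reparametrisation J' J (h : R -> R) : Prop :=
  [/\ open J', is_interval J', smooth J' h,
      (forall t, J' t -> derive1 h t != 0) & h @` J' = J].

(* The curve [gam] on [J] represents a geodesic path: it becomes an affinely
   parametrised geodesic after a change of parameter. *)
Definition geodesic_path g J gam : Prop :=
  exists J' h, reparametrisation J' J h /\ geodesic g J' (gam \o h).

Definition projectively_related g g' : Prop :=
  forall J gam, geodesic_path g J gam <-> geodesic_path g' J gam.

(* [Y] is a parallel vector field along the smooth curve [gam]: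
   dY^a/dt + Gamma^a_{bc} (du^b/dt) Y^c = 0. *)
Definition parallel_along g gam (Y : R -> chart R M -> 'cV[R]_4) : Prop :=
  forall t, tangent X (gam t) (Y t) /\
    forall c, chart_at X c (gam t) ->
      let u := cmap c \o gam in
      is_derive t 1 (fun s => Y s c)
        (- christoffel_app (gcomp g c) (u t) (derive1 u t) (Y t c)).

(* A piecewise smooth path from [p] to [q] is a finite concatenation of smooth
   curves, each restricted to [0, 1]; a smooth curve on [0, 1] is one that
   extends smoothly to the line. *)
Fixpoint piecewise_smooth_path (p : M) (s : seq (R -> M)) (q : M) : Prop :=
  match s with
  | [::] => p = q
  | gam :: s' => [/\ smooth_curve setT gam, gam 0 = p &
                     piecewise_smooth_path (gam 1) s' q]
  end.

Fixpoint parallel_transport g (s : seq (R -> M))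
    (v w : chart R M -> 'cV[R]_4) : Prop :=
  match s with
  | [::] => v = w
  | gam :: s' => exists Y, [/\ parallel_along g gam Y, Y 0 = v &
                               parallel_transport g s' (Y 1) w]
  end.

(* The holonomy group at [p], as a set of matrices with respect to the
   coordinate basis of [c] at [p]. *)
Definition holonomy_group g (p : M) (c : chart R M) : set 'M[R]_4 :=
  [set H | exists2 s, piecewise_smooth_path p s p &
     forall x : 'cV[R]_4, exists v w,
       [/\ tangent X p v, parallel_transport g s v w, v c = x & w c = H *m x]].

End Geometry.

Section HolonomyType.
Context {R : realType}.

(* Tangent space at the identity of a Lie subgroup of GL(4, R) (not necessarily
   closed): the velocities at the identity of the C^1 curves in the group. *)
Definition lie_algebra (Phi : set 'M[R]_4) : set 'M[R]_4 :=
  [set A | exists C : R -> 'M[R]_4,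
     [/\ Ck 1 setT C, C 0 = 1%:M, (forall t, Phi (C t)) & derive1 C 0 = A]].

(* F^a_b = F^{ac} g_{cb} for F^{ac} = p^a q^c - q^a p^c. *)
Definition wedge (G : 'M[R]_4) (p q : 'cV[R]_4) : 'M[R]_4 :=
  (p *m q^T - q *m p^T) *m G.

Definition null_tetrad (G : 'M[R]_4) (l n x y : 'cV[R]_4) : Prop :=
  [/\ (\matrix_(i < 4, j < 4) [:: l; n; x; y]`_j i 0) \in unitmx,
      [/\ inner G l n = 1, inner G x x = 1 & inner G y y = 1],
      [/\ inner G l l = 0 & inner G n n = 0] &
      [/\ inner G l x = 0, inner G l y = 0, inner G n x = 0,
          inner G n y = 0 & inner G x y = 0]].

Definition holonomy_type_R7 (M : topologicalType) (X : manifold4 R M)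
    (g : lorentz_metric X) : Prop :=
  exists p c, chart_at X c p /\
    let G := gcomp g c (cmap c p) in
    exists l n x y, null_tetrad G l n x y /\
      lie_algebra (holonomy_group g p c) =
      [set A | exists a b : R, A = a *: wedge G l n + b *: wedge G x y].

End HolonomyType.

(* Main.v *)
(* Parallel transport carries the tetrad [l, n, x, y] given at one point to every point,
   along every path.  The holonomies of the thin triangles [y], [y + s v], [y + s (v + b w)]
   form a C^1 family in [b], so their velocities lie in the holonomy algebra; differentiating
   in [s] shows that the curvature R(v, w) lies in the span of [l /\ n] and [x /\ y] at
   every point.  By the first Bianchi identity only R(l, n) = alpha (l /\ n) and
   R(x, y) = beta (x /\ y) survive.

   Equality of geodesic paths means Gamma' - Gamma = delta psi + psi delta.  Skewness of
   Riem' with respect to g' then says that R_cd acts on A = g'^-1 by terms linear in delta,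
   and the vanishing components of R force these to vanish: R annihilates A.  If, say,
   beta <> 0 at a point, then [x /\ y] annihilates A along all lines through it, read in
   transported tetrads.  Differentiating, [x /\ y] annihilates the symmetric product of v
   and A psi for all v, hence psi = 0 there.  Such points are dense as g is nonflat, and the
   difference of the two connections is continuous. *)

(* No Lie group structure is used on the holonomy group: [lie_algebra] only sees C^1 curves inside
   it, so curvature must be reached through an explicit family of loops. Triangles suit this. In the
   parameter [b] a single vertex moves, and at [b = 0] the loop retraces itself, so the curve starts
   at the identity. The price is differentiable dependence of linear equations on a parameter,
   obtained by comparison with the variational equation. All differential equations are solved on
   the fixed interval [-2, 2] under a smallness condition with constant 1/4; geodesics and segments
   are rescaled to meet it. Connections are given chart by chart, so their transformation law has to
   be derived; it follows from the uniqueness of the Levi-Civita connection. The covariant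
   derivative of [A] along v is [-(v (A psi)^T + (A psi) v^T + 2 psi(v) A)]. Its last term is a
   multiple of [A], which the mode already annihilates; this is why only a symmetric product
   remains. A mode has a nonzero kernel and a nonzero image, which is what turns that remainder into
   [psi = 0]. *)
Require Import Defs.
From HB Require Import structures.
From mathcomp Require Import all_boot all_order all_algebra.
From mathcomp Require Import all_classical all_reals all_analysis.
From mathcomp Require Import ring lra.

Set Implicit Arguments.
Unset Strict Implicit.
Unset Printing Implicit Defensive.

Import Order.TTheory GRing.Theory Num.Theory.
Import numFieldNormedType.Exports.

Local Open Scope classical_set_scope.
Local Open Scope ring_scope.

(** * Norms and directional derivatives of matrix-valued maps *)

Section MatrixCalculus.
Context {R : realType}.

Lemma mx_norm_entry m n (A : 'M[R]_(m, n)) i j : `|A i j| <= `|A|.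
Proof.
rewrite [leRHS]/Num.Def.normr/= mx_normrE.
exact: (le_bigmax _ (fun k : 'I_m * 'I_n => `|A k.1 k.2|) (i, j)).
Qed.

Lemma mx_norm_le m n (A : 'M[R]_(m, n)) (e : R) : 0 <= e ->
  (forall i j, `|A i j| <= e) -> `|A| <= e.
Proof.
move=> e0 Ae; rewrite [leLHS]/Num.Def.normr/= mx_normrE.
by apply: bigmax_le => // -[i j] _; exact: Ae.
Qed.

Lemma mulmx_norm m n p (A : 'M[R]_(m, n)) (B : 'M[R]_(n, p)) :
  `|A *m B| <= n%:R * `|A| * `|B|.
Proof.
apply: mx_norm_le => [|i j]; first by rewrite !mulr_ge0.
rewrite mxE (le_trans (ler_norm_sum _ _ _))//.
apply: (@le_trans _ _ (\sum_(k < n) `|A| * `|B|)); last first.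
  by rewrite sumr_const card_ord -[leLHS]mulr_natl mulrA.
by apply: ler_sum => k _; rewrite normrM ler_pM ?mx_norm_entry.
Qed.

Lemma invmx_mulmx n (A B : 'M[R]_n) : A \in unitmx -> B \in unitmx ->
  invmx (A *m B) = invmx B *m invmx A.
Proof.
move=> Au Bu; have ABu : A *m B \in unitmx by rewrite unitmx_mul Au.
apply: (can_inj (mulKmx ABu)); rewrite mulmxV// mulmxA -[A *m B *m _]mulmxA.
by rewrite mulmxV// mulmx1 mulmxV.
Qed.

Section Pointwise.
Context {V : normedModType R}.

Lemma cvg_mxP m n (T : Type) (F : set_system T) {FF : Filter F}
    (f : T -> 'M[R]_(m, n)) (l : 'M[R]_(m, n)) :
  f @ F --> l <-> forall i j, (fun x => f x i j) @ F --> l i j.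
Proof.
split=> [fl i j|fl].
  apply/cvgrPdist_le => /= e e0; move/cvgrPdist_le : fl => /(_ _ e0).
  apply: filterS => x; apply: le_trans.
  by have := mx_norm_entry (l - f x) i j; rewrite !mxE.
apply/cvgrPdist_le => /= e e0; near=> x.
apply: mx_norm_le => [|i j]; first exact: ltW.
move: i j; near: x.
suff : \forall x \near F, forall ij : 'I_m * 'I_n,
    `|(l - f x) ij.1 ij.2| <= e.
  by apply: filterS => x H i j; exact: (H (i, j)).
apply: filter_forall => -[i j]; have /cvgrPdist_le/(_ _ e0) := fl i j.
by apply: filterS => x; rewrite !mxE.
Unshelve. all: by end_near. Qed.

Lemma continuous_mxP (T : topologicalType) m n (f : T -> 'M[R]_(m, n)) x :
  {for x, continuous f} <-> forall i j, {for x, continuous (fun y => f y i j)}.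
Proof. exact: cvg_mxP. Qed.

Lemma is_derive_mxP m n (f : V -> 'M[R]_(m, n)) x v (df : 'M[R]_(m, n)) :
  is_derive x v f df <-> forall i j, is_derive x v (fun y => f y i j) (df i j).
Proof.
split=> [[fx <-] i j|fx].
  split; last by rewrite derive_mx// mxE.
  by have /derivable_mxP/(_ i j) := fx.
have dfx : derivable f x v by apply/derivable_mxP => i j; case: (fx i j).
split=> //; rewrite derive_mx//; apply/matrixP => i j; rewrite mxE.
exact: derive_val.
Qed.

Lemma is_derive_mulmx m n p (f : V -> 'M[R]_(m, n)) (g : V -> 'M[R]_(n, p))
    x v df dg :
  is_derive x v f df -> is_derive x v g dg ->
  is_derive x v (fun y => f y *m g y) (df *m g x + f x *m dg).
Proof.
move=> /is_derive_mxP fx /is_derive_mxP gx; apply/is_derive_mxP => i j.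
have -> : (fun y => (f y *m g y) i j) =
    \sum_k (fun y => f y i k * g y k j).
  by apply/funext => y; rewrite mxE fct_sumE.
rewrite !mxE -big_split /=; apply: is_derive_sum => k.
apply: (is_derive_eq (is_deriveM (fx i k) (gx k j))).
by rewrite /GRing.scale /=; ring.
Qed.

Lemma is_derive_trmx m n (f : V -> 'M[R]_(m, n)) x v df :
  is_derive x v f df -> is_derive x v (fun y => (f y)^T) df^T.
Proof.
move=> /is_derive_mxP fx; apply/is_derive_mxP => i j.
rewrite mxE; have -> // : (fun y => (f y)^T i j) = (fun y => f y j i).
by apply/funext => y; rewrite mxE.
Qed.

Lemma is_derive_mulmxl m n p (A : 'M[R]_(m, n)) (g : V -> 'M[R]_(n, p))
    x v dg :
  is_derive x v g dg -> is_derive x v (fun y => A *m g y) (A *m dg).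
Proof.
move=> gx; apply: (is_derive_eq (is_derive_mulmx (is_derive_cst A x v) gx)).
by rewrite mul0mx add0r.
Qed.

Lemma is_derive_mulmxr m n p (A : 'M[R]_(n, p)) (g : V -> 'M[R]_(m, n))
    x v dg :
  is_derive x v g dg -> is_derive x v (fun y => g y *m A) (dg *m A).
Proof.
move=> gx; apply: (is_derive_eq (is_derive_mulmx gx (is_derive_cst A x v))).
by rewrite mulmx0 addr0.
Qed.

Lemma is_derive_scale m n (a : V -> R) (f : V -> 'M[R]_(m, n)) x v da df :
  is_derive x v a da -> is_derive x v f df ->
  is_derive x v (fun y => a y *: f y) (da *: f x + a x *: df).
Proof.
move=> ax /is_derive_mxP fx; apply/is_derive_mxP => i j.
have -> : (fun y => (a y *: f y) i j) = (fun y => a y * f y i j).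
  by apply/funext => y; rewrite mxE.
apply: (is_derive_eq (is_deriveM ax (fx i j))).
by rewrite !mxE /GRing.scale /=; ring.
Qed.

Lemma is_derive_line (W : normedModType R) (f : V -> W) x v t :
  derivable f (x + t *: v) v ->
  is_derive t 1 (fun s => f (x + s *: v)) ('D_v f (x + t *: v)).
Proof.
have E : (fun h : R => h^-1 *: (((fun s => f (x + s *: v)) \o shift t) (h *: 1)
             - f (x + t *: v))) =
         (fun h => h^-1 *: ((f \o shift (x + t *: v)) (h *: v)
             - f (x + t *: v))).
  apply/funext => h /=; congr (_ *: (f _ - _)).
  by rewrite [h *: 1]mulr1 scalerDl addrCA.
by move=> fx; split; rewrite /derivable /derive E.
Qed.

End Pointwise.

Lemma is_derive_comp1 (W : normedModType R) (f : R -> W) (h : R -> R) t df dh :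
  is_derive (h t) 1 f df -> is_derive t 1 h dh ->
  is_derive t 1 (f \o h) (dh *: df).
Proof.
move=> [fd fE] [hd hE].
have /derivable1_diffP df' := fd; have /derivable1_diffP dh' := hd.
have dc : differentiable (f \o h) t by exact: differentiable_comp.
split; first exact/derivable1_diffP.
rewrite deriveE// diff_comp//= -!deriveE// hE.
by rewrite -[dh]mulr1 [in LHS]deriveE// [LHS]linearZ /= -deriveE// fE mulr1.
Qed.

Lemma is_derive_mull (k t : R) : is_derive t 1 (fun s : R => k * s) k.
Proof.
apply: (is_derive_eq (is_deriveM (is_derive_cst k t 1) (is_derive_id t 1))).
by rewrite scaler0 addr0 /GRing.scale /= mulr1.
Qed.

Lemma is_derive_continuous (W : normedModType R) (f : R -> W) (t : R) df :
  is_derive t 1 f df -> {for t, continuous f}.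
Proof.
by case=> /derivable1_diffP fd _; exact: differentiable_continuous.
Qed.

(** Taken between [Num.min a b] and [Num.max a b], so that estimates started at time 0 run in both
    directions. *)
Lemma MVT_between (f df : R -> R) (a b : R) :
  (forall s, Num.min a b <= s <= Num.max a b -> is_derive s 1 f (df s)) ->
  exists2 c, Num.min a b <= c <= Num.max a b & f b - f a = df c * (b - a).
Proof.
wlog ab : a b / a <= b => [H fd|fd].
  have /orP[ab|ba] := le_total a b; first exact: H.
  have [|c cab E] := H b a ba; first by move=> s; rewrite minC maxC; exact: fd.
  by exists c; [rewrite minC maxC|rewrite -opprB E -mulrN opprB].
have fd' s : s \in `[a, b] -> is_derive s 1 f (df s).
  by rewrite in_itv/= => sab; apply: fd; rewrite min_l ?max_r.
have fc : {within `[a, b], continuous f}.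
  by apply: derivable_within_continuous => x /fd'[].
have fdo x : x \in `]a, b[ -> is_derive x 1 f (df x).
  by move=> xab; apply: fd'; apply: subset_itv_oo_cc.
have [c cab E] := MVT_segment ab fdo fc.
by exists c => //; rewrite min_l ?max_r//; move: cab; rewrite in_itv.
Qed.


(** The norm is the largest entry, so the scalar theorem applied entry by entry loses no constant,
    although the intermediate point depends on the entry. *)
Lemma mx_MVT_le m n (f df : R -> 'M[R]_(m, n)) (a b K : R) :
  (forall s, Num.min a b <= s <= Num.max a b -> is_derive s 1 f (df s)) ->
  (forall s, Num.min a b <= s <= Num.max a b -> `|df s| <= K) ->
  `|f b - f a| <= K * `|b - a|.
Proof.
move=> fd dfK; have K0 : 0 <= K.
  apply: le_trans (dfK a _) => //.
  by rewrite le_max ge_min !lexx.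
apply: mx_norm_le => [|i j]; first by rewrite mulr_ge0.
have [|c cab] := @MVT_between (fun s => f s i j) (fun s => df s i j) a b.
  by move=> s /fd /is_derive_mxP.
rewrite !mxE => ->; rewrite normrM ler_wpM2r//.
exact: le_trans (mx_norm_entry _ _ _) (dfK _ cab).
Qed.

Lemma mx_is_derive0_cst m n (f : R -> 'M[R]_(m, n)) (a b : R) :
  (forall s, Num.min a b <= s <= Num.max a b -> is_derive s 1 f 0) ->
  f b = f a.
Proof.
move=> fd; apply/eqP; rewrite -subr_eq0 -normr_le0.
rewrite (le_trans (@mx_MVT_le _ _ f (fun=> 0) a b 0 fd _)) ?mul0r//.
by move=> s _; rewrite normr0.
Qed.

End MatrixCalculus.

(** * Closure properties of C^k functions *)

Section CkTheory.
Context {R : realType} {V : normedModType R}.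
Implicit Types (U : set V) (k : nat).

Lemma open_near U x : open U -> U x -> \forall y \near x, U y.
Proof. by move=> Uo Ux; exact: open_nbhs_nbhs. Qed.

Lemma Ck_ext (W : normedModType R) k U (f g : V -> W) : open U ->
  (forall x, U x -> f x = g x) -> Ck k U f -> Ck k U g.
Proof.
move=> Uo; elim: k f g => [|k IH] f g fg /= [fc fd].
  split=> // x Ux; have fgx : \forall y \near x, f y = g y.
    by apply: filterS (open_near Uo Ux) => y /fg.
  have := fc _ Ux; rewrite /continuous_at/prop_for -(fg x Ux).
  exact: cvg_trans (near_eq_cvg fgx).
have nfg x : U x -> \forall y \near x, f y = g y.
  by move=> Ux; apply: filterS (open_near Uo Ux) => y /fg.
split=> [x Ux|v].
  have := fc _ Ux; rewrite /continuous_at/prop_for -(fg x Ux).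
  exact: cvg_trans (near_eq_cvg (nfg x Ux)).
have [fdv fCk] := fd v; split=> [x Ux|].
  exact: near_eq_derivable (nfg x Ux) (fdv x Ux).
apply: IH fCk => x Ux; exact: near_eq_derive (nfg x Ux).
Qed.

Lemma Ck_subset (W : normedModType R) k U U' (f : V -> W) :
  U' `<=` U -> Ck k U f -> Ck k U' f.
Proof.
move=> UU'; elim: k f => [|k IH] f /= [fc fd].
  by split=> // x /UU'; exact: fc.
split=> [x /UU'|v]; first exact: fc.
by have [fdv fCk] := fd v; split=> [x /UU'|]; [exact: fdv|exact: IH].
Qed.

Lemma Ck_succ (W : normedModType R) k U (f : V -> W) :
  Ck k.+1 U f -> Ck k U f.
Proof.
elim: k f => [|k IH] f /= [fc fd]; first by split.
by split=> // v; have [fdv fCk] := fd v; split=> //; exact: IH.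
Qed.

Lemma Ck_continuous (W : normedModType R) k U (f : V -> W) x :
  Ck k U f -> U x -> {for x, continuous f}.
Proof. by case: k => [|k] /= [fc _]; exact: fc. Qed.

Lemma Ck_derivable (W : normedModType R) k U (f : V -> W) x v :
  Ck k.+1 U f -> U x -> derivable f x v.
Proof. by move=> /= [_ /(_ v)[]] fd _; exact: fd. Qed.

Lemma Ck_derive (W : normedModType R) k U (f : V -> W) v :
  Ck k.+1 U f -> Ck k U (fun x => 'D_v f x).
Proof. by move=> /= [_ /(_ v)[]]. Qed.

Lemma smooth_derive (W : normedModType R) U (f : V -> W) v :
  smooth U f -> smooth U (fun x => 'D_v f x).
Proof. by move=> fs k; apply: Ck_derive. Qed.

Lemma smooth_derivable (W : normedModType R) U (f : V -> W) x v :
  smooth U f -> U x -> derivable f x v.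
Proof. by move=> /(_ 1%N); exact: Ck_derivable. Qed.

Lemma smooth_continuous (W : normedModType R) U (f : V -> W) x :
  smooth U f -> U x -> {for x, continuous f}.
Proof. by move=> /(_ 0%N); exact: Ck_continuous. Qed.

Lemma Ck_mxP m n k U (f : V -> 'M[R]_(m, n)) : open U ->
  Ck k U f <-> forall i j, Ck k U (fun x => f x i j).
Proof.
move=> Uo; elim: k f => [|k IH] f.
  split=> /= [[fc _] i j|fc].
    by split=> // x /fc /continuous_mxP.
  by split=> // x Ux; apply/continuous_mxP => i j; exact: (fc i j).1.
split=> [[fc fd] i j|fC].
  split=> [x /fc /continuous_mxP//|v].
  have [fdv /IH/(_ i j) fCk] := fd v; split=> [x /fdv /derivable_mxP//|].
  apply: Ck_ext fCk => // x Ux; rewrite derive_mx ?mxE//; exact: fdv.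
split=> [x Ux|v].
  by apply/continuous_mxP => i j; case: (fC i j) => + _; exact.
have fdv x : U x -> derivable f x v.
  move=> Ux; apply/derivable_mxP => i j.
  by case: (fC i j) => _ /(_ v)[+ _]; exact.
split=> //; apply/IH => i j; case: (fC i j) => _ /(_ v)[_].
by apply: Ck_ext => // x Ux; rewrite derive_mx ?mxE//; exact: fdv.
Qed.

Lemma smooth_mxP m n U (f : V -> 'M[R]_(m, n)) : open U ->
  smooth U f <-> forall i j, smooth U (fun x => f x i j).
Proof.
move=> Uo; split=> [fs i j k|fs k]; first by have /Ck_mxP := fs k; exact.
by apply/Ck_mxP => // i j; exact: fs.
Qed.

Lemma Ck_cst (W : normedModType R) k U (a : W) : Ck k U (fun=> a).
Proof.
elim: k a => [|k IH] a /=; (split=> [x _|]; first exact: cst_continuous); first by [].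
move=> v.
split=> [x _|]; first exact: derivable_cst.
by under eq_fun do rewrite derive_cst; exact: IH.
Qed.

Lemma CkD (W : normedModType R) k U (f g : V -> W) : open U ->
  Ck k U f -> Ck k U g -> Ck k U (fun x => f x + g x).
Proof.
move=> Uo; elim: k f g => [|k IH] f g /= [fc fd] [gc gd].
  by split=> // x Ux; apply: continuousD; [exact: fc|exact: gc].
split=> [x Ux|v]; first by apply: continuousD; [exact: fc|exact: gc].
have [fdv fC] := fd v; have [gdv gC] := gd v; split=> [x Ux|].
  by apply: derivableD; [exact: fdv|exact: gdv].
apply: Ck_ext (IH _ _ fC gC) => // x Ux.
by rewrite -(deriveD (fdv x Ux) (gdv x Ux)).
Qed.

Lemma CkM k U (f g : V -> R) : open U ->
  Ck k U f -> Ck k U g -> Ck k U (fun x => f x * g x).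
Proof.
move=> Uo; elim: k f g => [|k IH] f g fC gC.
  split=> // x Ux; have fc := Ck_continuous fC Ux.
  by have gc := Ck_continuous gC Ux; exact: continuousM.
split=> [x Ux|v].
  have fc := Ck_continuous fC Ux.
  by have gc := Ck_continuous gC Ux; exact: continuousM.
split=> [x Ux|].
  have fd := Ck_derivable (v := v) fC Ux.
  by have gd := Ck_derivable (v := v) gC Ux; exact: derivableM.
have fgC : Ck k U (fun x => f x * 'D_v g x + g x * 'D_v f x).
  by apply: CkD => //; apply: IH; try exact: Ck_derive; exact: Ck_succ.
apply: Ck_ext fgC => // x Ux.
by rewrite -(deriveM (Ck_derivable (v := v) fC Ux) (Ck_derivable (v := v) gC Ux)).
Qed.

Lemma CkN k U (f : V -> R) : open U ->
  Ck k U f -> Ck k U (fun x => - f x).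
Proof.
move=> Uo fC; under eq_fun do rewrite -mulN1r; apply: CkM => //.
exact: Ck_cst.
Qed.

Lemma Ck_sum k U (I : Type) (r : seq I) (P : pred I) (f : I -> V -> R) :
  open U -> (forall i, Ck k U (f i)) ->
  Ck k U (fun x => \sum_(i <- r | P i) f i x).
Proof.
move=> Uo fC; elim: r => [|i r IH].
  by under eq_fun do rewrite big_nil; exact: Ck_cst.
under eq_fun do rewrite big_cons.
by case: (P i) => //; exact: CkD.
Qed.

Lemma Ck_prod k U (I : Type) (r : seq I) (P : pred I) (f : I -> V -> R) :
  open U -> (forall i, Ck k U (f i)) ->
  Ck k U (fun x => \prod_(i <- r | P i) f i x).
Proof.
move=> Uo fC; elim: r => [|i r IH].
  by under eq_fun do rewrite big_nil; exact: Ck_cst.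
under eq_fun do rewrite big_cons.
by case: (P i) => //; exact: CkM.
Qed.

Lemma CkV k U (f : V -> R) : open U -> (forall x, U x -> f x != 0) ->
  Ck k U f -> Ck k U (fun x => (f x)^-1).
Proof.
move=> Uo f0; elim: k => [|k IH] fC.
  by split=> // x Ux; apply: continuousV; [exact: f0|exact: Ck_continuous fC _].
split=> [x Ux|v].
  by apply: continuousV; [exact: f0|exact: Ck_continuous fC _].
split=> [x Ux|].
  by apply: derivableV; [exact: f0|exact: Ck_derivable fC _].
have VC : Ck k U (fun x => - ((f x)^-1 * (f x)^-1 * 'D_v f x)).
  have IC := IH (Ck_succ fC).
  by apply: CkN => //; apply: CkM => //; [exact: CkM|exact: Ck_derive].
apply: Ck_ext VC => // x Ux.
have := deriveV (f0 x Ux) (Ck_derivable (v := v) fC Ux) => ->.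
by rewrite /GRing.scale/= mulNr expr2 invfM.
Qed.

Lemma Ck_det n k U (f : V -> 'M[R]_n) : open U ->
  (forall i j, Ck k U (fun x => f x i j)) -> Ck k U (fun x => \det (f x)).
Proof.
move=> Uo fC; apply: Ck_sum => // s; apply: CkM => //; first exact: Ck_cst.
by apply: Ck_prod => // i.
Qed.

Lemma Ck_invmx n k U (f : V -> 'M[R]_n) i j : open U ->
  (forall x, U x -> f x \in unitmx) ->
  (forall i j, Ck k U (fun x => f x i j)) ->
  Ck k U (fun x => invmx (f x) i j).
Proof.
move=> Uo fu fC; apply: (@Ck_ext _ _ _
  (fun x => (\det (f x))^-1 * cofactor (f x) j i)) => //.
  by move=> x Ux; rewrite /invmx (fu x Ux) !mxE.
apply: CkM => //.
  apply: CkV => // [x Ux|]; last exact: Ck_det.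
  by have := fu x Ux; rewrite unitmxE unitfE.
apply: CkM => //; first exact: Ck_cst.
apply: Ck_det => // a b; under eq_fun do rewrite !mxE; exact: fC.
Qed.

End CkTheory.

(** * From continuous partial derivatives to differentiability *)

Section Multivariate.
Context {R : realType} {n : nat}.
Notation E := 'cV[R]_n.
Implicit Types (U : set E) (x v : E).

Lemma col_delta_sum (v : E) : v = \sum_i v i 0 *: (delta_mx i 0 : E).
Proof. by rewrite {1}[v]matrix_sum_delta; apply: eq_bigr => i _; rewrite big_ord1. Qed.

(** [diff_locallyP] speaks of the differential itself; by uniqueness any continuous linear
    first-order approximation may take its place. *)
Lemma differentiable_locally (V W : normedModType R) (f : V -> W) (x : V)
    (df : {linear V -> W}) :
  continuous df -> f \o shift x = cst (f x) + df +o_ 0 id ->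
  differentiable f x.
Proof.
by move=> dfc fE; apply/diff_locallyP; rewrite (diff_unique dfc fE).
Qed.

(** The vertices of the staircase from [x] to [x + h]. *)
Let upto (x h : E) (k : nat) : E :=
  \col_j (x j 0 + (if (j < k)%N then h j 0 else 0)).

(* The increment is split along the coordinate axes, and the mean value theorem
   is applied on each edge. *)
Lemma C1_increment U (f : E -> R) x (e : R) : open U -> Ck 1 U f -> U x ->
  0 < e -> \forall h \near (0 : E),
    `|f (h + x) - f x - \sum_i h i 0 * 'D_(delta_mx i 0) f x| <= e * `|h|.
Proof.
move=> Uo fC Ux e0; set d := fun i : 'I_n => 'D_(delta_mx i 0 : E) f.
(* Each of the [n] edges may cost [e / n.+1]; the successor avoids a division by zero when [n] is
   0. *)
have dn : \forall y \near x, U y /\ forall i, `|d i y - d i x| <= e / n.+1%:R.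
  near=> y; split; first by near: y; exact: (open_near Uo Ux).
  near: y; apply: filter_forall => i.
  have := Ck_continuous (Ck_derive (delta_mx i 0) fC) Ux.
  move/cvgrPdist_le => /(_ (e / n.+1%:R)); rewrite divr_gt0// => /(_ isT).
  by apply: filterS => y; rewrite distrC.
move/nbhs_ballP : dn => [r /= r0 xr].
apply/nbhs_ballP; exists r => //= h; rewrite -ball_normE /= sub0r normrN => hr.
have xE : upto x h 0 = x by apply/matrixP => i j; rewrite !mxE ord1 addr0.
have hE : upto x h n = h + x.
  by apply/matrixP => i j; rewrite !mxE ord1 ltn_ord addrC.
have stepE (k : 'I_n) : upto x h k.+1 = upto x h k + h k 0 *: (delta_mx k 0 : E).
  apply/matrixP => i j; rewrite !mxE ord1 eqxx andbT ltnS leq_eqVlt -addrA.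
  congr (_ + _).
  have [->|ik] := eqVneq i k; first by rewrite ltnn eqxx mulr1 add0r.
  by rewrite -[X in X || _]/(i == k) (negbTE ik) /= mulr0 addr0.
have step (k : 'I_n) :
  `|f (upto x h k.+1) - f (upto x h k) - h k 0 * d k x| <= e / n.+1%:R * `|h|.
  have near_x s : Num.min 0 (h k 0) <= s <= Num.max 0 (h k 0) ->
      ball x r (upto x h k + s *: (delta_mx k 0 : E)).
    move=> sh; have {sh} sh : `|s| <= `|h|.
      apply: (@le_trans _ _ `|h k 0|); last exact: mx_norm_entry.
      move: sh; have [h0|h0] := leP 0 (h k 0) => /andP[s1 s2].
        by rewrite ger0_norm// ger0_norm.
      by rewrite ler0_norm// ltr0_norm// lerN2.
    rewrite -ball_normE /= (le_lt_trans _ hr)//.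
    apply: mx_norm_le => // i j; rewrite !mxE ord1 eqxx andbT.
    rewrite -addrA opprD addNKr normrN.
    have [->|ik] := eqVneq i k; first by rewrite ltnn add0r mulr1.
    rewrite mulr0 addr0; case: ifP => _; last by rewrite normr0.
    exact: mx_norm_entry.
  have [|c cab] := @MVT_between R
      (fun s => f (upto x h k + s *: (delta_mx k 0 : E)))
      (fun s => d k (upto x h k + s *: (delta_mx k 0 : E))) 0 (h k 0).
    move=> s /near_x/xr[Us _]; apply: is_derive_line.
    exact: Ck_derivable fC Us.
  rewrite subr0 scale0r addr0 -stepE => ->.
  rewrite [h k 0 * _]mulrC -mulrBl normrM ler_pM//; last exact: mx_norm_entry.
  exact: (xr _ (near_x _ cab)).2.
have -> : f (h + x) - f x - \sum_i h i 0 * d i x =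
    \sum_(k < n) (f (upto x h k.+1) - f (upto x h k) - h k 0 * d k x).
  rewrite sumrB; congr (_ - _).
  rewrite -(big_mkord xpredT (fun k => f (upto x h k.+1) - f (upto x h k))).
  by rewrite telescope_sumr// xE hE.
apply: (le_trans (ler_norm_sum _ _ _)).
apply: (@le_trans _ _ (\sum_(k < n) e / n.+1%:R * `|h|)).
  by apply: ler_sum => k _; exact: step.
rewrite sumr_const card_ord -[leLHS]mulr_natl mulrA ler_wpM2r//.
rewrite mulrCA ler_piMr//; first exact: ltW.
by rewrite ler_pdivrMr// mul1r ler_nat.
Unshelve. all: by end_near. Qed.

Lemma C1_differentiable U (f : E -> R) x : open U -> Ck 1 U f -> U x ->
  differentiable f x.
Proof.
move=> Uo fC Ux.
pose L (h : E) : R := \sum_i h i 0 * 'D_(delta_mx i 0) f x.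
have Llin : linear L.
  move=> a u v; rewrite /L /GRing.scale/= mulr_sumr -big_split /=.
  by apply: eq_bigr => i _; rewrite !mxE mulrDl mulrA.
pose LM := GRing.isLinear.Build _ _ _ _ _ Llin.
pose LL : {linear E -> R} := HB.pack L LM.
apply: (@differentiable_locally _ _ f x LL).
  move=> h; apply: (@Ck_continuous _ _ _ 0 setT) => //.
  apply: Ck_sum => [|i]; first exact: openT.
  apply: CkM; [exact: openT| |exact: Ck_cst].
  by split=> // y _; exact: coord_continuous.
apply/eqaddoP => _/posnumP[e].
near=> h; rewrite -[X in `|X|]/(f (h + x) - (f x + L h)) opprD addrA.
by near: h; apply: C1_increment Uo fC Ux _.
Unshelve. all: by end_near. Qed.

Lemma C1_mx_differentiable U p q (f : E -> 'M[R]_(p, q)) x :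
  open U -> Ck 1 U f -> U x -> differentiable f x.
Proof.
move=> Uo /(Ck_mxP _ _ Uo) fC Ux.
have -> : f = \sum_i \sum_j (fun y => f y i j *: delta_mx i j).
  apply/funext => y; rewrite [LHS]matrix_sum_delta fct_sumE.
  by apply: eq_bigr => i _; rewrite fct_sumE.
apply: differentiable_sum => i; apply: differentiable_sum => j.
by apply: differentiableZl; exact: C1_differentiable (fC i j) Ux.
Qed.

Lemma differentiable_deriveE (W : normedModType R) (f : E -> W) x v :
  differentiable f x ->
  'D_v f x = \sum_i v i 0 *: 'D_(delta_mx i 0) f x.
Proof.
move=> fd; rewrite deriveE// {1}[v]col_delta_sum linear_sum.
by apply: eq_bigr => i _; rewrite linearZ -deriveE.
Qed.

Lemma is_derive_chain (W : normedModType R) (f : E -> W) (u : R -> E) t du :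
  differentiable f (u t) -> is_derive t 1 u du ->
  is_derive t 1 (f \o u) ('D_du f (u t)).
Proof.
move=> fd [/derivable1_diffP ud uE].
have dc : differentiable (f \o u) t by exact: differentiable_comp.
split; first exact/derivable1_diffP.
by rewrite deriveE// diff_comp//= -!deriveE// uE.
Qed.

Lemma derive_chain (V W : normedModType R) (f : E -> W) (u : V -> E) y w :
  differentiable f (u y) -> differentiable u y ->
  'D_w (f \o u) y = 'D_('D_w u y) f (u y).
Proof.
move=> fd ud; have dc : differentiable (f \o u) y by exact: differentiable_comp.
by rewrite deriveE// diff_comp//= -!deriveE.
Qed.

End Multivariate.

(** * Regularity of curves *)

Section CurveRegularity.
Context {R : realType}.
Implicit Types (J : set R).

Lemma derive1_derive (W : normedModType R) (u : R -> W) t (v : R) :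
  derivable u t 1 -> derivable u t v /\ 'D_v u t = v *: 'D_1 u t.
Proof.
move=> /derivable1_diffP ud; split; first exact: diff_derivable.
by rewrite !deriveE// -{1}[v]mulr1 [LHS]linearZ.
Qed.

(** On the line every directional derivative is a multiple of the one along 1, so [derive1] alone
    decides the class. *)
Lemma Ck_curveP k J m n (u : R -> 'M[R]_(m, n)) : open J ->
  Ck k.+1 J u <-> (forall t, J t -> derivable u t 1) /\ Ck k J (derive1 u).
Proof.
move=> Jo; have E : derive1 u = (fun t => 'D_1 u t).
  by apply/funext => t; rewrite derive1E.
split=> [uC|[ud uC]].
  by rewrite E; split=> [t Jt|]; [exact: Ck_derivable uC Jt|exact: Ck_derive].
split=> [t Jt|v].
  by apply: differentiable_continuous; apply/derivable1_diffP; exact: ud.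
split=> [t Jt|]; first by have [] := derive1_derive v (ud t Jt).
apply/Ck_mxP => // i j; apply: (@Ck_ext _ _ _ _ _ (fun t => v * derive1 u t i j)) => //.
  move=> t Jt; have [_ ->] := derive1_derive v (ud t Jt).
  by rewrite mxE derive1E.
by apply: CkM => //; [exact: Ck_cst|move/(Ck_mxP _ _ Jo) : uC].
Qed.

(** The chain rule expresses the derivative through the partial derivatives of [f] along [u], which
    are again smooth; hence the induction runs over all [f] at once. *)
Lemma Ck_comp_curve k J n (U : set 'cV[R]_n) (f : 'cV[R]_n -> R)
    (u : R -> 'cV[R]_n) :
  open J -> open U -> smooth U f -> (forall t, J t -> U (u t)) ->
  Ck k J u -> Ck k J (f \o u).
Proof.
move=> Jo Uo; elim: k f => [|k IH] f fs JU uC.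
  split=> // t Jt; apply: continuous_comp; first exact: Ck_continuous uC Jt.
  exact: smooth_continuous fs (JU _ Jt).
have ud t (v : R) : J t -> derivable u t v by move=> Jt; exact: Ck_derivable uC Jt.
have chain t : J t -> is_derive t 1 (f \o u)
    (\sum_i 'D_1 u t i 0 * 'D_(delta_mx i 0) f (u t)).
  move=> Jt; have fd := C1_differentiable Uo (fs 1%N) (JU _ Jt).
  apply: (is_derive_eq (is_derive_chain fd (derivableP (ud t 1 Jt)))).
  by rewrite differentiable_deriveE.
have fud t v : J t -> derivable (f \o u) t v /\
    'D_v (f \o u) t = v * \sum_i 'D_1 u t i 0 * 'D_(delta_mx i 0) f (u t).
  move=> /chain[cd cE]; have [? ->] := derive1_derive v cd.
  by split=> //; rewrite cE.
split=> [t Jt|v].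
  by apply: differentiable_continuous; apply/derivable1_diffP; exact: (fud t 1 Jt).1.
split=> [t Jt|]; first exact: (fud t v Jt).1.
apply: (@Ck_ext _ _ _ _ _ (fun t =>
   v * \sum_i 'D_1 u t i 0 * 'D_(delta_mx i 0) f (u t))) => //.
  by move=> t Jt; rewrite (fud t v Jt).2.
apply: CkM => //; first exact: Ck_cst.
apply: Ck_sum => // i; apply: CkM => //.
  by have /(Ck_mxP _ _ Jo) := Ck_derive (1 : R) uC; exact.
by apply: (IH (fun y => 'D_(delta_mx i 0) f y)) => //; [exact: smooth_derive|exact: Ck_succ].
Qed.

Lemma smooth_comp_curve J n m p (U : set 'cV[R]_n) (f : 'cV[R]_n -> 'M[R]_(m, p))
    (u : R -> 'cV[R]_n) :
  open J -> open U -> smooth U f -> (forall t, J t -> U (u t)) ->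
  smooth J u -> smooth J (f \o u).
Proof.
move=> Jo Uo /(smooth_mxP _ Uo) fs JU us k; apply/Ck_mxP => // i j.
exact: (Ck_comp_curve (f := fun y => f y i j) Jo Uo (fs i j) JU (us k)).
Qed.

End CurveRegularity.

(** * Symmetry of second derivatives *)

Section Schwarz.
Context {R : realType} {V : normedModType R}.
Implicit Types (U : set V).

(** The mean value theorem is applied once per side of the parallelogram. The second difference is
    symmetric in [v] and [w], so exchanging them compares the two mixed derivatives. *)
Lemma second_difference U (f : V -> R) x v w (h : R) : 0 <= h ->
  Ck 2 U f ->
  (forall a b, 0 <= a <= h -> 0 <= b <= h -> U (x + a *: v + b *: w)) ->
  exists a b, [/\ 0 <= a <= h, 0 <= b <= h &
    f (x + h *: v + h *: w) - f (x + h *: v) - (f (x + h *: w) - f x) =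
    h * h * 'D_w (fun y => 'D_v f y) (x + a *: v + b *: w)].
Proof.
move=> h0 fC Uh.
have hh : 0 <= h <= h by rewrite h0 lexx.
have h00 : 0 <= (0 : R) <= h by rewrite lexx h0.
have [fv fvE] : exists fv : V -> R, fv = (fun y => 'D_v f y).
  by exists (fun y => 'D_v f y).
have fvC : Ck 1 U fv by rewrite fvE; exact: Ck_derive v fC.
have fd y : U y -> is_derive y v f (fv y).
  by move=> Uy; rewrite fvE; apply: derivableP; exact: Ck_derivable fC Uy.
rewrite -fvE; clear fvE.
have fline y s : U (y + s *: v) ->
    is_derive s 1 (fun s => f (y + s *: v)) (fv (y + s *: v)).
  by move=> /fd[fyd <-]; exact: is_derive_line.
have [|a] := @MVT_between R
    (fun s => f (x + h *: w + s *: v) - f (x + s *: v))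
    (fun s => fv (x + h *: w + s *: v) - fv (x + s *: v)) 0 h.
  rewrite min_l// max_r// => s sh; apply: is_deriveB; apply: fline.
    by rewrite addrAC; exact: Uh.
  by have := Uh s 0 sh h00; rewrite scale0r addr0.
rewrite min_l// max_r// => ah; rewrite !scale0r !addr0 subr0 => E1.
have [|b] := @MVT_between R (fun s => fv (x + a *: v + s *: w))
    (fun s => 'D_w fv (x + a *: v + s *: w)) 0 h.
  rewrite min_l// max_r// => s sh.
  by apply: is_derive_line; apply: Ck_derivable fvC _; exact: Uh.
rewrite min_l// max_r// => bh; rewrite !scale0r !addr0 subr0 => E2.
exists a, b; split=> //.
rewrite [x + h *: v + _]addrAC E1 [x + h *: w + _]addrAC E2.
by rewrite -mulrA mulrC.
Qed.

Lemma schwarz U (f : V -> R) x v w : open U -> Ck 2 U f -> U x ->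
  'D_w (fun y => 'D_v f y) x = 'D_v (fun y => 'D_w f y) x.
Proof.
move=> Uo fC Ux; apply/eqP; rewrite -subr_eq0 -normr_le0.
apply/ler_addgt0Pr => e e0; rewrite add0r.
have e20 : 0 < e / 2 by rewrite divr_gt0.
have [F FE] : exists F : V -> R, F = (fun y => 'D_w (fun y => 'D_v f y) y).
  by eexists; reflexivity.
have [G GE] : exists G : V -> R, G = (fun y => 'D_v (fun y => 'D_w f y) y).
  by eexists; reflexivity.
have Fc : {for x, continuous F}.
  by rewrite FE; exact: Ck_continuous (Ck_derive w (Ck_derive v fC)) Ux.
have Gc : {for x, continuous G}.
  by rewrite GE; exact: Ck_continuous (Ck_derive v (Ck_derive w fC)) Ux.
have {FE} FE y : 'D_w (fun y => 'D_v f y) y = F y by rewrite FE.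
have {GE} GE y : 'D_v (fun y => 'D_w f y) y = G y by rewrite GE.
have nx : \forall y \near x, [/\ U y, `|F x - F y| <= e / 2 & `|G x - G y| <= e / 2].
  move/cvgrPdist_le : Fc => /(_ _ e20) Fn; move/cvgrPdist_le : Gc => /(_ _ e20) Gn.
  have Un := open_near Uo Ux.
  by apply: filterS3 Un Fn Gn => y ? ? ?; split.
move/nbhs_ballP : nx => [r /= r0 xr].
(* So small that the parallelogram stays in the ball of radius [r]; the summand 1 covers vanishing
   [v] and [w]. *)
pose h : R := r / (`|v| + `|w| + 1) / 2.
have N0 : 0 < `|v| + `|w| + 1 by rewrite ltr_wpDl// addr_ge0.
have h0 : 0 < h by rewrite !divr_gt0.
have hN : h * (`|v| + `|w|) < r.
  have : h * (`|v| + `|w| + 1) = r / 2.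
    by rewrite /h mulrAC divfK// gt_eqF.
  by rewrite [h * (_ + 1)]mulrDr mulr1; lra.
have near_x a b : 0 <= a <= h -> 0 <= b <= h -> ball x r (x + a *: v + b *: w).
  move=> /andP[a0 ah] /andP[b0 bh]; rewrite -ball_normE/= -addrA opprD addNKr normrN.
  apply: le_lt_trans hN; rewrite (le_trans (ler_normD _ _))// mulrDr.
  by rewrite !normrZ !ger0_norm// lerD// ler_wpM2r.
have [|a [b [ah bh E1]]] := @second_difference U f x v w h (ltW h0) fC.
  by move=> a b ah bh; have [] := xr _ (near_x a b ah bh).
have [|b' [a' [bh' ah' E2]]] := @second_difference U f x w v h (ltW h0) fC.
  move=> b' a' bh' ah'; rewrite addrAC.
  by have [] := xr _ (near_x a' b' ah' bh').
rewrite FE in E1; rewrite GE in E2; rewrite FE GE.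
have FG : F (x + a *: v + b *: w) = G (x + a' *: v + b' *: w).
  apply: (mulfI (x := h * h)); first by rewrite mulf_neq0 ?gt_eqF.
  rewrite -E1 [x + a' *: v + _]addrAC -E2 [x + h *: v + h *: w]addrAC.
  by ring.
have [_ F1 _] := xr _ (near_x a b ah bh).
have [_ _ G1] := xr _ (near_x a' b' ah' bh').
rewrite -(subrKA (F (x + a *: v + b *: w))) {2}FG.
by rewrite [e]splitr (le_trans (ler_normD _ _))// lerD// distrC.
Qed.

End Schwarz.

(** * Picard iteration on a fixed interval *)

Section Picard.
Context {R : realType} {m n : nat}.
Notation W := 'M[R]_(m, n).

Lemma antiderivative (f : R -> R) : continuous f ->
  exists F : R -> R, F 0 = 0 /\
    forall x : R, - 3 < x -> x < 3 -> is_derive x 1 F (f x).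
Proof.
(* Integration starts at -3, so that a two-sided derivative is available at the ends of [-2, 2] as
   well. *)
move=> fc; pose F0 (x : R) := (\int[lebesgue_measure]_(t in `[(-3 : R), x]) (f t))%R.
have fi : lebesgue_measure.-integrable `[(-3 : R), 3] (EFin \o f).
  apply: continuous_compact_integrable; first exact: segment_compact.
  exact: continuous_subspaceT.
have Fd (x : R) : - 3 < x -> x < 3 -> is_derive x 1 F0 (f x).
  move=> x1 x2; have [Fx FE] := continuous_FTC1_closed x2 fi x1 (fc x).
  by split; [exact: Fx|rewrite -FE derive1E].
exists (fun x => F0 x - F0 0); split; first by rewrite subrr.
move=> x x1 x2; rewrite -[f x]subr0.
by apply: is_deriveB; exact: Fd.
Qed.

Lemma antiderivative_mx (f : R -> W) : continuous f ->
  exists F : R -> W, F 0 = 0 /\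
    forall x : R, - 3 < x -> x < 3 -> is_derive x 1 F (f x).
Proof.
move=> fc.
have /choice[F FE] : forall ij : 'I_m * 'I_n, exists F : R -> R, F 0 = 0 /\
    forall x : R, - 3 < x -> x < 3 -> is_derive x 1 F (f x ij.1 ij.2).
  by move=> ij; apply: antiderivative => x; have /continuous_mxP := fc x; exact.
exists (fun x => \matrix_(i, j) F (i, j) x); split.
  by apply/matrixP => i j; rewrite !mxE (FE (i, j)).1.
move=> x x1 x2; apply/is_derive_mxP => i j; under eq_fun do rewrite mxE.
exact: (FE (i, j)).2.
Qed.

Definition clamp (a b t : R) : R := Num.max a (Num.min b t).

Lemma clamp_in a b t : a <= b -> a <= clamp a b t <= b.
Proof. by move=> ab; rewrite /clamp le_max ge_max lexx ab ge_min lexx. Qed.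

Lemma clamp_id a b t : a <= t <= b -> clamp a b t = t.
Proof. by move=> /andP[at_ tb]; rewrite /clamp min_r// max_r. Qed.

Lemma clamp_lipschitz a b s t : `|clamp a b s - clamp a b t| <= `|s - t|.
Proof.
rewrite /clamp; have [] := leP b s; have [] := leP b t => bt bs.
- by rewrite subrr normr0.
- have [] := leP a b; have [] := leP a t => at_ ab; rewrite ?subrr ?normr0//;
  rewrite !ger0_norm; lra.
- have [] := leP a s; have [] := leP a b => as_ ab; rewrite ?subrr ?normr0//.
  + by rewrite distrC [leRHS]distrC !ger0_norm; lra.
  + by rewrite distrC [leRHS]distrC !ger0_norm; lra.
  + by rewrite distrC [leRHS]distrC !ger0_norm; lra.
- have [] := leP a s; have [] := leP a t => as_ ab; rewrite ?subrr ?normr0//.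
  + by rewrite ger0_norm ?[leRHS]ger0_norm; lra.
  + by rewrite distrC [leRHS]distrC !ger0_norm; lra.
Qed.

Lemma clamp_continuous a b : continuous (clamp a b).
Proof.
move=> t; apply/cvgrPdist_le => e e0; apply/nbhs_ballP; exists e => //= s ts.
exact: le_trans (clamp_lipschitz _ _ _ _) (ltW ts).
Qed.

Variable (phi : R -> W -> W).
Hypothesis phi_lip : forall s y z, `|phi s y - phi s z| <= 4^-1 * `|y - z|.
Hypothesis phi_cont : forall y : R -> W, continuous y ->
  continuous (fun s => phi s (y s)).
Variable y0 : W.

(** On [-2, 2] integration from 0 multiplies a bound by at most 2, so the Lipschitz constant 1/4
    makes the Picard map a contraction by 1/2, and the whole interval is reached at once. *)
Lemma picard : exists y : R -> W, y 0 = y0 /\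
  forall t : R, -2 <= t <= 2 -> is_derive t 1 y (phi t (y t)).
Proof.
have cl2 (t : R) : -2 <= clamp (-2) 2 t <= 2 by apply: clamp_in; lra.
have /choice[G GE] : forall z : R -> W, exists G : R -> W, continuous z ->
    G 0 = 0 /\ forall x : R, - 3 < x -> x < 3 -> is_derive x 1 G (phi x (z x)).
  move=> z; have [zc|] := pselect (continuous z); last by exists z.
  by have [G GE] := antiderivative_mx (phi_cont zc); exists G.
(* Time is clamped because [phi_cont] asks for continuity on the whole line, while the
   antiderivative is controlled only on (-3, 3). *)
pose Z (z : R -> W) (t : R) : W := y0 + G z (clamp (-2) 2 t).
have Gd (z : R -> W) (t : R) : continuous z -> -2 <= t <= 2 -> is_derive t 1 (G z) (phi t (z t)).
  by move=> zc t2; apply: (GE z zc).2; lra.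
have Zc (z : R -> W) : continuous z -> continuous (Z z).
  move=> zc t; apply: continuousD; first exact: cst_continuous.
  apply: continuous_comp; first exact: clamp_continuous.
  exact: is_derive_continuous (Gd z _ zc (cl2 t)).
have Zd (z z' : R -> W) (D : R) : continuous z -> continuous z' ->
    (forall t, `|z t - z' t| <= D) -> forall t, `|Z z t - Z z' t| <= D / 2.
  move=> zc zc' zD t; pose c := clamp (-2) 2 t; have c2 : -2 <= c <= 2 := cl2 t.
  have -> : Z z t - Z z' t = G z c - G z' c.
    by rewrite /Z [y0 + G z _]addrC addrKA.
  have between s : Num.min 0 c <= s <= Num.max 0 c -> -2 <= s <= 2.
    by have [] := leP 0 c => ? ?; lra.
  have := @mx_MVT_le R m n (fun t => G z t - G z' t)
      (fun t => phi t (z t) - phi t (z' t)) 0 c (D / 4).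
  rewrite (GE z zc).1 (GE z' zc').1 !subr0 => H.
  have D0 : 0 <= D := le_trans (normr_ge0 _) (zD 0).
  apply: le_trans (H _ _) _.
  - by move=> s /between s2; apply: is_deriveB; exact: Gd.
  - move=> s _; apply: le_trans (phi_lip _ _ _) _.
    by have := zD s; lra.
  - have : `|c| <= 2 by rewrite ler_norml.
    by move: (normr_ge0 c) => ? ?; nra.
pose z k : R -> W := iter k Z (fun=> y0).
have zc k : continuous (z k).
  by elim: k => [|k IH]; [move=> t; exact: cst_continuous|exact: Zc].
have [K zK] : exists K, forall t, `|z 1%N t - z 0%N t| <= K.
  have Gc : {within `[(-2 : R), 2], continuous (fun t => `|G (z 0%N) t|)}.
    apply/continuous_in_subspaceT => t; rewrite inE /= in_itv /= => t2.
    apply: (@continuous_comp _ _ _ (G (z 0%N)) (fun y : W => `|y|)).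
      exact: is_derive_continuous (Gd _ _ (zc 0%N) t2).
    exact: norm_continuous.
  have [|c _ cM] := EVT_max _ Gc; first by lra.
  exists `|G (z 0%N) c| => t; rewrite /z /= /Z addrC addKr.
  by apply: cM; rewrite in_itv /=; exact: cl2.
have K0 : 0 <= K := le_trans (normr_ge0 _) (zK 0).
have zS k t : `|z k.+1 t - z k t| <= K / 2 ^+ k.
  elim: k t => [|k IH] t; first by rewrite expr0 divr1.
  rewrite exprSr invfM mulrA; exact: (Zd _ _ _ (zc _) (zc _) IH).
(* The geometric tail is kept as a difference, which makes the induction on [j] telescope. *)
have zD k j t : `|z (k + j)%N t - z k t| <= 2 * K / 2 ^+ k - 2 * K / 2 ^+ (k + j).
  elim: j => [|j IH]; first by rewrite addn0 !subrr normr0.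
  rewrite addnS -(subrKA (z (k + j)%N t)) (le_trans (ler_normD _ _))//.
  have := zS (k + j)%N t; set p := 2 ^+ (k + j) in IH *.
  have -> : (2 : R) ^+ (k + j).+1 = 2 * p by rewrite exprS.
  have -> : 2 * K / (2 * p) = K / p by rewrite -mulf_div divff// mul1r.
  by move: IH; rewrite -[2 * K / p]mulrA; lra.
have zB k j t : (k <= j)%N -> `|z j t - z k t| <= 2 * K / 2 ^+ k.
  move=> kj; rewrite -(subnKC kj) (le_trans (zD _ _ _))// gerBl.
  by rewrite divr_ge0 ?mulr_ge0// exprn_ge0.
have small (e : R) : 0 < e -> exists k, 2 * K / 2 ^+ k <= e.
  move=> e0; have : (fun k => (2 * K) * (2^-1 : R) ^+ k) @ \oo --> 2 * K * 0.
    apply: cvgM; first exact: cvg_cst.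
    by apply: cvg_expr; rewrite ger0_norm ?invr_ge0// invf_lt1// ltr1n.
  rewrite mulr0 => /cvgrPdist_le/(_ _ e0)[k _ /(_ k (leqnn k))] /=.
  rewrite sub0r normrN exprVn ger0_norm => [?|]; first by exists k.
  by rewrite !mulr_ge0// invr_ge0 exprn_ge0.
have zcvg t : cvg ((z ^~ t) @ \oo).
  apply/cauchy_cvgP/cauchy_exP => e e0.
  have [|k kE] := small (e / 2); first by rewrite divr_gt0.
  exists (z k t); exists k => //= j kj; rewrite -ball_normE/= distrC.
  by rewrite (le_lt_trans (zB _ _ _ kj))// (le_lt_trans kE)//; lra.
pose y t := lim ((z ^~ t) @ \oo).
have yB k t : `|y t - z k t| <= 2 * K / 2 ^+ k.
  have : (fun j => `|z j t - z k t|) @ \oo --> `|y t - z k t|.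
    by apply: cvg_norm; apply: cvgB; [exact: zcvg|exact: cvg_cst].
  move=> /cvgr_to_le; apply; exists k => // j /= kj; exact: zB.
have yc : continuous y.
  move=> t; apply/cvgrPdist_le => e e0.
  have [|k kE] := small (e / 3); first by rewrite divr_gt0.
  have e30 : 0 < e / 3 by rewrite divr_gt0.
  have /cvgrPdist_le/(_ _ e30) := zc k t; apply: filterS => s zs.
  rewrite -(subrKA (z k t)) (le_trans (ler_normD _ _))//.
  have := ler_normD (z k t - z k s) (z k s - y s); rewrite subrKA.
  by have := yB k t; have := yB k s; rewrite [`|y s - _|]distrC; lra.
have yZ t : Z y t = y t.
  apply/eqP; rewrite -subr_eq0 -normr_le0; apply/ler_addgt0Pr => e e0.
  rewrite add0r; have [|k kE] := small (e / 2); first by rewrite divr_gt0.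
  have H1 := Zd _ _ _ yc (zc k) (yB k) t.
  have H2 := yB k.+1 t; rewrite distrC in H2.
  have H3 : 2 * K / 2 ^+ k.+1 <= 2 * K / 2 ^+ k.
    rewrite ler_wpM2l ?mulr_ge0// lef_pV2 ?posrE ?exprn_gt0//.
    by rewrite ler_eXn2l// ltr1n.
  have := ler_normD (Z y t - z k.+1 t) (z k.+1 t - y t).
  rewrite subrKA; have : 0 <= 2 * K / 2 ^+ k := le_trans (normr_ge0 _) (yB k t).
  by move: H1 H2 H3 kE; rewrite -[Z (z k) t]/(z k.+1 t); lra.
(* [y] itself is constant beyond the ends of [-2, 2]; the unclamped antiderivative agrees with it
   inside and is differentiable at the ends too. *)
exists (fun t => y0 + G y t); split; first by rewrite (GE y yc).1 addr0.
move=> t t2; have -> : y0 + G y t = y t by rewrite -yZ /Z clamp_id.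
rewrite -[phi t (y t)]add0r; apply: is_deriveD.
exact: Gd.
Qed.

End Picard.

(** * Linear equations and their dependence on a parameter *)

Section LinearODE.
Context {R : realType}.

Lemma trmx_norm m n (A : 'M[R]_(m, n)) : `|A^T| <= `|A|.
Proof. by apply: mx_norm_le => // i j; rewrite mxE mx_norm_entry. Qed.

Lemma scalar_mx1_norm n : `|1%:M : 'M[R]_n| <= 1.
Proof.
apply: mx_norm_le => // i j; rewrite mxE; case: (i == j); rewrite ?normr1//.
by rewrite normr0 ler01.
Qed.

Lemma continuous_sumr (T : topologicalType) (I : Type) (r : seq I)
    (f : I -> T -> R) x :
  (forall i, {for x, continuous (f i)}) ->
  {for x, continuous (fun y => \sum_(i <- r) f i y)}.
Proof.
move=> fc; elim: r => [|i r IH].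
  rewrite (_ : (fun y => _) = fun=> 0); first exact: cst_continuous.
  by apply/funext => y; rewrite big_nil.
rewrite (_ : (fun y => _) = fun y => f i y + \sum_(i <- r) f i y).
  exact: continuousD.
by apply/funext => y; rewrite big_cons.
Qed.

Lemma continuous_mulmx (T : topologicalType) m n p (f : T -> 'M[R]_(m, n))
    (g : T -> 'M[R]_(n, p)) x :
  {for x, continuous f} -> {for x, continuous g} ->
  {for x, continuous (fun y => f y *m g y)}.
Proof.
move=> /continuous_mxP fc /continuous_mxP gc; apply/continuous_mxP => i j.
rewrite (_ : (fun y => _) = fun y => \sum_k f y i k * g y k j); last first.
  by apply/funext => y; rewrite mxE.
by apply: continuous_sumr => k; apply: continuousM; [exact: fc|exact: gc].
Qed.

(** A quadratic remainder is what the comparison of linear equations delivers; divided by [h] it is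
    of order [|h|]. *)
Lemma is_derive_quadratic m n (f : R -> 'M[R]_(m, n)) (t r C : R) D : 0 < r ->
  (forall h, `|h| < r -> `|f (t + h) - f t - h *: D| <= C * (h * h)) ->
  is_derive t 1 f D.
Proof.
move=> r0 fC; have C0 : 0 <= C.
  have r2 : 0 < r / 2 by rewrite divr_gt0.
  have := fC (r / 2); rewrite gtr0_norm// => /(_ _)/(le_trans (normr_ge0 _)).
  rewrite pmulr_lge0 ?mulr_gt0//; apply; lra.
have fcvg : (fun h => h^-1 *: ((f \o shift t) (h *: 1) - f t)) @ 0^' --> D.
  apply/cvgrPdist_le => e e0; apply/nbhs_ballP.
  exists (Num.min r (e / (C + 1))) => /=; first by rewrite lt_min r0 divr_gt0// ltr_wpDl.
  move=> h /=; rewrite -ball_normE/= sub0r normrN lt_min => /andP[hr he] h0.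
  rewrite [h *: 1]mulr1 [h + t]addrC distrC.
  have -> : h^-1 *: (f (t + h) - f t) - D = h^-1 *: (f (t + h) - f t - h *: D).
    by rewrite [RHS]scalerBr scalerA mulVf// scale1r.
  rewrite normrZ normfV ler_pdivrMl ?normr_gt0//.
  apply: le_trans (fC _ hr) _.
  have -> : h * h = `|h| * `|h| by rewrite -normrM ger0_norm// -expr2 sqr_ge0.
  rewrite mulrCA ler_wpM2l//.
  have := normr_ge0 h; move: he; rewrite ltr_pdivlMr ?ltr_wpDl// => he h1.
  by nra.
split; first by apply/cvg_ex; exists D.
exact: cvg_lim fcvg.
Qed.

Section Fixed.
Context {n p : nat}.
Variables (A : R -> 'M[R]_n) (B : R -> 'M[R]_(n, p)).
Hypothesis Ac : forall t : R, -2 <= t <= 2 -> {for t, continuous A}.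
Hypothesis Bc : forall t : R, -2 <= t <= 2 -> {for t, continuous B}.
Hypothesis Asmall : forall t : R, -2 <= t <= 2 -> n%:R * `|A t| <= 4^-1.

Lemma linear_ode (y0 : 'M[R]_(n, p)) :
  exists y : R -> 'M[R]_(n, p), y 0 = y0 /\
    forall t : R, -2 <= t <= 2 -> is_derive t 1 y (A t *m y t + B t).
Proof.
pose cl := clamp (-2 : R) 2.
have cl2 (t : R) : -2 <= cl t <= 2 by apply: clamp_in; lra.
have [|y yc|y [y00 yd]] := @picard R n p (fun s y => A (cl s) *m y + B (cl s)) _ _ y0.
- move=> s y z; rewrite opprD addrACA subrr addr0 -mulmxBr.
  by rewrite (le_trans (mulmx_norm _ _))// ler_wpM2r// Asmall.
- move=> t; apply: cvgD; first apply: continuous_mulmx.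
  + by apply: continuous_comp; [exact: clamp_continuous|exact: Ac].
  + exact: yc.
  + by apply: continuous_comp; [exact: clamp_continuous|exact: Bc].
- exists y; split=> // t t2; have := yd t t2; rewrite /cl clamp_id//.
Qed.

Lemma linear_ode_bound (y : R -> 'M[R]_(n, p)) (rho : R) :
  (forall t : R, -2 <= t <= 2 -> is_derive t 1 y (A t *m y t + B t)) ->
  (forall t : R, -2 <= t <= 2 -> `|B t| <= rho) ->
  forall t : R, -2 <= t <= 2 -> `|y t| <= 2 * `|y 0| + 4 * rho.
Proof.
move=> yd Brho.
have yc : {within `[(-2 : R), 2], continuous (fun t => `|y t|)}.
  apply/continuous_in_subspaceT => t; rewrite inE /= in_itv /= => t2.
  apply: (@continuous_comp _ _ _ y (fun y : 'M[R]_(n, p) => `|y|)).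
    exact: is_derive_continuous (yd t t2).
  exact: norm_continuous.
have [|c c2 cM] := EVT_max _ yc; first by lra.
have {}cM (t : R) : -2 <= t <= 2 -> `|y t| <= `|y c|.
  by move=> t2; apply: cM; rewrite in_itv.
rewrite in_itv /= in c2.
have between s : Num.min 0 c <= s <= Num.max 0 c -> -2 <= s <= 2.
  by have [] := leP 0 c => ? ?; lra.
have dB (s : R) : -2 <= s <= 2 -> `|A s *m y s + B s| <= 4^-1 * `|y c| + rho.
  move=> s2; rewrite (le_trans (ler_normD _ _))// lerD ?Brho//.
  by rewrite (le_trans (mulmx_norm _ _))// ler_pM ?mulr_ge0// ?Asmall ?cM.
have H := @mx_MVT_le R n p y (fun t => A t *m y t + B t) 0 c (4^-1 * `|y c| + rho).
have {}H : `|y c - y 0| <= (4^-1 * `|y c| + rho) * `|c - 0|.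
  by apply: H => s /between s2; [exact: yd|exact: dB].
have c20 : `|c - 0| <= 2 by rewrite subr0 ler_norml.
have rho0 : 0 <= rho by apply: le_trans (Brho 0 _) => //; lra.
have : `|y c| <= `|y 0| + `|y c - y 0| by rewrite -{1}(subrKC (y 0) (y c)) ler_normD.
move=> H1 t /cM; have := normr_ge0 (y c); have := normr_ge0 (c - 0).
move: H c20 H1; set a := `|c - 0|; set b := `|y c|; set d := `|y c - y 0|.
set f := `|y 0|; set g := `|y t|.
by move=> *; nra.
Qed.

End Fixed.

Section Family.
Context {n : nat}.
Variables (A DA : R -> R -> 'M[R]_n) (K : R).

(* [b] is the parameter; [DA] plays the role of the [b]-derivative of [A]. *)
Definition C2_family : Prop := forall s b : R, -2 <= s <= 2 -> -1 <= b <= 1 ->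
  [/\ {for s, continuous (A ^~ b)}, {for s, continuous (DA ^~ b)},
      n%:R * `|A s b| <= 4^-1, `|DA s b| <= K &
      forall b', -1 <= b' <= 1 ->
      [/\ `|A s b' - A s b| <= K * `|b' - b|,
          `|DA s b' - DA s b| <= K * `|b' - b| &
          `|A s b' - A s b - (b' - b) *: DA s b| <= K * (`|b' - b| * `|b' - b|)]].

Hypothesis HA : C2_family.

(** [S] solves the variational equation. The differences of [T] and of [S] in [b], and the
    first-order remainder of [T], solve equations with the same [A] and zero initial value, so
    [linear_ode_bound] estimates them by their sources, which are of order [|b' - b|] or its
    square. *)
Lemma linear_ode_family : exists T S : R -> R -> 'M[R]_n,
  [/\ forall b, T 0 b = 1%:M /\ S 0 b = 0,
      forall s b : R, -2 <= s <= 2 -> -1 <= b <= 1 ->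
        is_derive s 1 (T ^~ b) (A s b *m T s b),
      forall s b : R, -2 <= s <= 2 -> -1 <= b <= 1 ->
        is_derive s 1 (S ^~ b) (A s b *m S s b + DA s b *m T s b),
      forall s b : R, -2 <= s <= 2 -> -1 < b < 1 -> is_derive b 1 (T s) (S s b) &
      forall s b : R, -2 <= s <= 2 -> -1 < b < 1 -> {for b, continuous (S s)}].
Proof.
have Ac (b : R) : -1 <= b <= 1 -> forall s : R, -2 <= s <= 2 ->
    {for s, continuous (A ^~ b)}.
  by move=> b1 s s2; have [] := HA s2 b1.
have As (b : R) : -1 <= b <= 1 -> forall s : R, -2 <= s <= 2 ->
    n%:R * `|A s b| <= 4^-1.
  by move=> b1 s s2; have [] := HA s2 b1.
have /choice[T TE] : forall b : R, exists T : R -> 'M[R]_n, T 0 = 1%:M /\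
    (-1 <= b <= 1 -> forall s : R, -2 <= s <= 2 ->
      is_derive s 1 T (A s b *m T s + (fun=> 0) s)).
  move=> b; have [b1|] := boolP (-1 <= b <= 1); last by exists (fun=> 1%:M).
  have [|T [T0 Td]] := @linear_ode n n (A ^~ b) (fun=> 0) (Ac b b1) _ (As b b1) 1%:M.
  - by move=> t _; exact: cst_continuous.
  - by exists T.
have Td (b : R) : -1 <= b <= 1 -> forall s : R, -2 <= s <= 2 ->
      is_derive s 1 (T b) (A s b *m T b s).
  by move=> b1 s s2; have := (TE b).2 b1 s s2; rewrite addr0.
have TB (s b : R) : -2 <= s <= 2 -> -1 <= b <= 1 -> `|T b s| <= 2.
  move=> s2 b1; have := linear_ode_bound (As b b1) ((TE b).2 b1) (rho := 0).
  rewrite (TE b).1 => H; apply: le_trans (H _ s s2) _.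
    by move=> *; rewrite normr0.
  by have := scalar_mx1_norm n; lra.
have DTc (b : R) : -1 <= b <= 1 -> forall s : R, -2 <= s <= 2 ->
    {for s, continuous (fun s => DA s b *m T b s)}.
  move=> b1 s s2; have [_ Dc _ _ _] := HA s2 b1.
  by apply: continuous_mulmx => //; exact: is_derive_continuous (Td b b1 s s2).
have /choice[S SE] : forall b : R, exists S : R -> 'M[R]_n, S 0 = 0 /\
    (-1 <= b <= 1 -> forall s : R, -2 <= s <= 2 ->
      is_derive s 1 S (A s b *m S s + (fun s => DA s b *m T b s) s)).
  move=> b; have [b1|] := boolP (-1 <= b <= 1); last by exists (fun=> 0).
  by have [S [S0 Sd]] := linear_ode (Ac b b1) (DTc b b1) (As b b1) 0; exists S.
have K0 : 0 <= K.
  have [||_ _ _ H _] := @HA 0 0; rewrite ?lexx//; try lra.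
  exact: le_trans (normr_ge0 _) H.
pose N : R := n%:R; have N0 : 0 <= N by rewrite /N.
have mul_le (X Y : 'M[R]_n) (a b : R) : `|X| <= a -> `|Y| <= b ->
    `|X *m Y| <= N * a * b.
  move=> Xa Yb; apply: le_trans (mulmx_norm _ _) _.
  by rewrite ler_pM ?mulr_ge0// ler_wpM2l.
have DTB (s b : R) : -2 <= s <= 2 -> -1 <= b <= 1 -> `|DA s b *m T b s| <= N * K * 2.
  by move=> s2 b1; have [_ _ _ H _] := HA s2 b1; apply: mul_le => //; exact: TB.
(* Four times the bound on the source [DA T], as in [linear_ode_bound]; [C1] and [C2] arise in the
   same way. *)
pose C0 := 4 * (N * K * 2).
have SB (s b : R) : -2 <= s <= 2 -> -1 <= b <= 1 -> `|S b s| <= C0.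
  move=> s2 b1.
  have := linear_ode_bound (As b b1) ((SE b).2 b1) (rho := N * K * 2).
  rewrite (SE b).1 normr0 mulr0 add0r; apply=> // t t2; exact: DTB.
have TL (s b b' : R) : -2 <= s <= 2 -> -1 <= b <= 1 -> -1 <= b' <= 1 ->
    `|T b' s - T b s| <= C0 * `|b' - b|.
  move=> s2 b1 b1'; have := @linear_ode_bound _ _ (A ^~ b)
    (fun s => (A s b' - A s b) *m T b' s) (As b b1) (fun s => T b' s - T b s)
    (N * (K * `|b' - b|) * 2).
  rewrite (TE b).1 (TE b').1 subrr normr0 mulr0 add0r => H.
  apply: le_trans (H _ _ s s2) _.
  - move=> t t2; apply: (is_derive_eq (is_deriveB (Td b' b1' t t2) (Td b b1 t t2))).
    by rewrite mulmxBr mulmxBl [RHS]addrC subrKA.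
  - move=> t t2; apply: mul_le; last exact: TB.
    by have [_ _ _ _ /(_ b' b1')[]] := HA t2 b1.
  - by rewrite /C0; rewrite le_eqVlt; apply/orP; left; apply/eqP; ring.
pose C1 := 4 * (N * K * 2 + N * K * C0).
have TQ (s b b' : R) : -2 <= s <= 2 -> -1 <= b <= 1 -> -1 <= b' <= 1 ->
    `|T b' s - T b s - (b' - b) *: S b s| <= C1 * ((b' - b) * (b' - b)).
  move=> s2 b1 b1'; have := @linear_ode_bound _ _ (A ^~ b)
    (fun s => (A s b' - A s b - (b' - b) *: DA s b) *m T b' s +
       (b' - b) *: (DA s b *m (T b' s - T b s))) (As b b1)
    (fun s => T b' s - T b s - (b' - b) *: S b s)
    (N * (K * (`|b' - b| * `|b' - b|)) * 2 + `|b' - b| * (N * K * (C0 * `|b' - b|))).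
  rewrite (TE b).1 (TE b').1 (SE b).1 scaler0 !subrr normr0 mulr0 add0r => H.
  apply: le_trans (H _ _ s s2) _.
  - move=> t t2; apply: (is_derive_eq (is_deriveB (is_deriveB (Td b' b1' t t2)
      (Td b b1 t t2)) (is_deriveZ (b' - b) ((SE b).2 b1 t t2)))).
    rewrite !mulmxBr !mulmxBl -!scalemxAl -!scalemxAr.
    rewrite scalerDr scalerBr; set a1 := A t b' *m _; set a2 := A t b *m T b t.
    set a3 := A t b *m T b' t; set a4 := _ *: (A t b *m _); set a5 := _ *: (DA t b *m T b t).
    set a6 := _ *: (DA t b *m T b' t).
    by apply/matrixP => i j; rewrite !mxE; ring.
  - move=> t t2; have [_ _ _ DK /(_ b' b1')[_ _ H2]] := HA t2 b1.
    apply: le_trans (ler_normD _ _) _; apply: lerD.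
      by apply: mul_le => //; exact: TB.
    rewrite normrZ ler_wpM2l//; apply: mul_le => //; exact: TL.
  - have -> : (b' - b) * (b' - b) = `|b' - b| * `|b' - b|.
      by rewrite -normrM ger0_norm// -expr2 sqr_ge0.
    by rewrite /C1 /C0; rewrite le_eqVlt; apply/orP; left; apply/eqP; ring.
pose C2 := 4 * (N * K * C0 + N * K * 2 + N * K * C0).
have SL (s b b' : R) : -2 <= s <= 2 -> -1 <= b <= 1 -> -1 <= b' <= 1 ->
    `|S b' s - S b s| <= C2 * `|b' - b|.
  move=> s2 b1 b1'; have := @linear_ode_bound _ _ (A ^~ b)
    (fun s => (A s b' - A s b) *m S b' s + (DA s b' - DA s b) *m T b' s +
       DA s b *m (T b' s - T b s)) (As b b1) (fun s => S b' s - S b s)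
    (N * (K * `|b' - b|) * C0 + N * (K * `|b' - b|) * 2 + N * K * (C0 * `|b' - b|)).
  rewrite (SE b).1 (SE b').1 subrr normr0 mulr0 add0r => H.
  apply: le_trans (H _ _ s s2) _.
  - move=> t t2; apply: (is_derive_eq (is_deriveB ((SE b').2 b1' t t2) ((SE b).2 b1 t t2))).
    rewrite !mulmxBr !mulmxBl; set a1 := A t b' *m _; set a2 := A t b *m S b t.
    set a3 := A t b *m S b' t; set a4 := DA t b' *m _; set a5 := DA t b *m T b' t.
    set a6 := DA t b *m T b t.
    by apply/matrixP => i j; rewrite !mxE; ring.
  - move=> t t2; have [_ _ _ DK /(_ b' b1')[H1 H2 _]] := HA t2 b1.
    apply: le_trans (ler_normD _ _) _; apply: lerD; last first.
      by apply: mul_le => //; exact: TL.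
    apply: le_trans (ler_normD _ _) _; apply: lerD.
      by apply: mul_le => //; exact: SB.
    by apply: mul_le => //; exact: TB.
  - by rewrite /C2 /C0; rewrite le_eqVlt; apply/orP; left; apply/eqP; ring.
exists (fun s b => T b s), (fun s b => S b s); split=> //.
- by move=> b; rewrite (TE b).1 (SE b).1.
- by move=> s b s2 b1; exact: Td.
- by move=> s b s2 b1; exact: ((SE b).2 b1 s s2).
- move=> s b s2 b1; apply: (@is_derive_quadratic _ _ _ b (Num.min (1 - b) (b + 1)) C1).
    by rewrite lt_min; lra.
  move=> h; rewrite lt_min ltr_norml ltr_norml => h1.
  have := @TQ s b (b + h) s2; rewrite [b + h - b]addrC addKr; apply; lra.
- move=> s b s2 b1; apply/cvgrPdist_le => e e0; apply/nbhs_ballP.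
  exists (Num.min (Num.min (1 - b) (b + 1)) (e / (C2 + 1))) => /=.
    rewrite !lt_min divr_gt0//; first by lra.
    by rewrite ltr_wpDl// !mulr_ge0// !addr_ge0// !mulr_ge0.
  move=> b' /=; rewrite !lt_min !ltr_norml => b2.
  rewrite distrC (le_trans (SL _ _ _ s2 _ _))//; try lra.
  have C20 : 0 < C2 + 1 by rewrite ltr_wpDl// !mulr_ge0// !addr_ge0// !mulr_ge0.
  have : `|b' - b| <= e / (C2 + 1) by rewrite ler_norml; lra.
  rewrite ler_pdivlMr//; have := normr_ge0 (b' - b); nra.
Qed.

End Family.

End LinearODE.

(** * Levi-Civita connection and curvature in one chart *)

Section LocalGeometry.
#[local] Opaque derive.
Context {R : realType}.
Notation E := 'cV[R]_4.
Notation e_ c := (delta_mx c 0 : E).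

(* [(Gam G x c) a b] is Gamma^a_{cb} and [(Riem G x c d) a b] is R^a_{bcd}. *)
Definition Gam (G : E -> 'M[R]_4) (x : E) (c : 'I_4) : 'M[R]_4 :=
  \matrix_(a, b) christoffel G x a c b.

Definition GamV (G : E -> 'M[R]_4) (x v : E) : 'M[R]_4 :=
  \sum_c v c 0 *: Gam G x c.

Definition Riem (G : E -> 'M[R]_4) (x : E) (c d : 'I_4) : 'M[R]_4 :=
  \matrix_(a, b) riemann G x a b c d.

Lemma GamV_delta G x c : GamV G x (e_ c) = Gam G x c.
Proof.
rewrite /GamV (bigD1 c)//= mxE !eqxx scale1r big1 ?addr0// => i ic.
by rewrite mxE (negbTE ic) scale0r.
Qed.

Lemma GamVD G x u v : GamV G x (u + v) = GamV G x u + GamV G x v.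
Proof.
by rewrite /GamV -big_split; apply: eq_bigr => c _; rewrite mxE scalerDl.
Qed.

Lemma GamVZ G x (a : R) v : GamV G x (a *: v) = a *: GamV G x v.
Proof.
by rewrite /GamV scaler_sumr; apply: eq_bigr => c _; rewrite mxE scalerA.
Qed.

Lemma christoffel_appE G x u v : christoffel_app G x u v = GamV G x u *m v.
Proof.
apply/matrixP => a j; rewrite ord1 !mxE.
transitivity (\sum_c (\sum_b u b 0 * christoffel G x a b c) * v c 0).
  rewrite exchange_big; apply: eq_bigr => c _; rewrite mulr_suml.
  by apply: eq_bigr => b _; rewrite [u b 0 * _]mulrC.
apply: eq_bigr => c _; rewrite /GamV summxE; congr (_ * _).
by apply: eq_bigr => b _; rewrite !mxE.
Qed.

Lemma schwarz_mx (V : normedModType R) (U : set V) p q (f : V -> 'M[R]_(p, q)) x v w :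
  open U -> smooth U f -> U x ->
  'D_w (fun y => 'D_v f y) x = 'D_v (fun y => 'D_w f y) x.
Proof.
move=> Uo fs Ux; have fs' := (smooth_mxP _ Uo).1 fs.
have D2 a b : 'D_a (fun y => 'D_b f y) x =
    \matrix_(i, j) 'D_a (fun y => 'D_b (fun z => f z i j) y) x.
  rewrite (@near_eq_derive _ _ _ _
      (fun y => \matrix_(i, j) 'D_b (fun z => f z i j) y)); last first.
    apply: filterS (open_near Uo Ux) => y Uy.
    by rewrite derive_mx//; exact: smooth_derivable fs Uy.
  have E2 i j : (fun y => (\matrix_(i, j) 'D_b (fun z => f z i j) y) i j) =
      (fun y => 'D_b (fun z => f z i j) y).
    by apply/funext => y; rewrite mxE.
  rewrite derive_mx; last first.
    apply/derivable_mxP => i j; rewrite E2.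
    exact: smooth_derivable (smooth_derive b (fs' i j)) Ux.
  by apply/matrixP => i j; rewrite [LHS]mxE [RHS]mxE E2.
rewrite !D2; apply/matrixP => i j; rewrite [LHS]mxE [RHS]mxE.
exact: schwarz Uo (fs' i j 2%N) Ux.
Qed.

(** The algebra behind the skewness of the curvature: [X] is the metric, [C] and [D] are the
    Christoffel matrices in directions c and d, [P] is the c-derivative of [D] and [Q] the
    d-derivative of [C]. The hypothesis equates the two mixed second derivatives of the metric. *)
Lemma skew_of_symmetric_hessian n (X C D P Q : 'M[R]_n) :
  ((X *m C + C^T *m X) *m D + X *m P) + P^T *m X +
    D^T *m (X *m C + C^T *m X) =
  ((X *m D + D^T *m X) *m C + X *m Q) + Q^T *m X +
    C^T *m (X *m D + D^T *m X) ->
  X *m (P - Q + C *m D - D *m C) + (P - Q + C *m D - D *m C)^T *m X = 0.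
Proof.
move/eqP; rewrite -subr_eq0 => /eqP <-.
rewrite [(_ - D *m C)^T]linearB /= [(_ + C *m D)^T]linearD /=.
rewrite [(P - Q)^T]linearB /= !trmx_mul.
rewrite !mulmxDl !mulmxDr !mulmxA !mulNmx !mulmxN.
rewrite !mulmxA; move: (X *m P) (X *m Q) (X *m C *m D) (X *m D *m C)
  (P^T *m X) (Q^T *m X) (D^T *m C^T *m X) (C^T *m D^T *m X)
  (C^T *m X *m D) (D^T *m X *m C) => *.
by apply/matrixP => i j; rewrite !mxE; ring.
Qed.

Section OneMetric.
Variables (U : set E) (G : E -> 'M[R]_4).
Hypotheses (Uo : open U) (Gs : smooth U G).
Hypothesis Gsym : forall x, U x -> (G x)^T = G x.
Hypothesis Gunit : forall x, U x -> G x \in unitmx.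

Lemma metric_entry_smooth i j : smooth U (fun y => G y i j).
Proof. by move/(smooth_mxP _ Uo) : Gs; exact. Qed.

Lemma metric_partial_sym x b i j : U x ->
  partial b (fun y => G y i j) x = partial b (fun y => G y j i) x.
Proof.
move=> Ux; apply: near_eq_derive; apply: filterS (open_near Uo Ux) => y Uy.
by rewrite -{1}(Gsym Uy) mxE.
Qed.

Lemma christoffel_sym x a b c : U x -> christoffel G x a b c = christoffel G x a c b.
Proof.
move=> Ux; rewrite /christoffel; congr (_ * _); apply: eq_bigr => d _.
congr (_ * _); rewrite (metric_partial_sym b d c)// (metric_partial_sym c b d)//.
by rewrite (metric_partial_sym d b c)// [X in X - _]addrC.
Qed.

Lemma Gam_sym x c d : U x -> Gam G x c *m e_ d = Gam G x d *m e_ c.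
Proof.
move=> Ux; rewrite -!colE; apply/matrixP => a j.
by rewrite !mxE christoffel_sym.
Qed.

Lemma christoffel_smooth a b c : smooth U (fun x => christoffel G x a b c).
Proof.
move=> k; apply: CkM => //; first exact: Ck_cst.
apply: Ck_sum => // d; apply: CkM => //.
  by apply: Ck_invmx => // i j; exact: metric_entry_smooth.
have ps e i j : Ck k U (partial e (fun y => G y i j)).
  exact: (smooth_derive (e_ e) (metric_entry_smooth i j)).
by apply: CkD => //; [exact: CkD|exact: CkN].
Qed.

Lemma Gam_smooth c : smooth U (fun x => Gam G x c).
Proof.
apply/smooth_mxP => // i j.
rewrite (_ : (fun x => _) = (fun x => christoffel G x i c j)).
  exact: christoffel_smooth.
by apply/funext => x; rewrite mxE.
Qed.

Lemma GamV_smooth v : smooth U (fun x => GamV G x v).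
Proof.
apply/smooth_mxP => // i j k.
rewrite (_ : (fun x => _) = (fun x => \sum_c v c 0 * Gam G x c i j)).
  apply: Ck_sum => // c; apply: CkM => //; first exact: Ck_cst.
  by move: (Gam_smooth c) => /(smooth_mxP _ Uo); exact.
by apply/funext => x; rewrite /GamV summxE; apply: eq_bigr => c _; rewrite mxE.
Qed.

(** Lowering the index leaves the Christoffel symbols of the first kind, in which no inverse matrix
    occurs. *)
Lemma lower_Gam x c : U x -> G x *m Gam G x c =
  \matrix_(a, b) (2^-1 * (partial c (fun y => G y a b) x +
     partial b (fun y => G y c a) x - partial a (fun y => G y c b) x)).
Proof.
move=> Ux; set K := (X in _ = X).
suff -> : Gam G x c = invmx (G x) *m K by rewrite mulKVmx// Gunit.
apply/matrixP => a b; rewrite !mxE /christoffel mulr_sumr.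
by apply: eq_bigr => d _; rewrite !mxE mulrCA.
Qed.

Lemma metric_compat x c : U x ->
  'D_(e_ c) G x = G x *m Gam G x c + (Gam G x c)^T *m G x.
Proof.
move=> Ux; have -> : (Gam G x c)^T *m G x = (G x *m Gam G x c)^T.
  by rewrite trmx_mul Gsym.
rewrite lower_Gam//; rewrite derive_mx; last exact: smooth_derivable Gs Ux.
apply/matrixP => a b; rewrite !mxE.
rewrite -[LHS]/(partial c (fun y => G y a b) x).
rewrite (metric_partial_sym c b a)// (metric_partial_sym a c b)//.
rewrite (metric_partial_sym b c a)//; by field.
Qed.

Lemma metric_compatV x v : U x ->
  'D_v G x = G x *m GamV G x v + (GamV G x v)^T *m G x.
Proof.
move=> Ux; rewrite differentiable_deriveE; last first.
  exact: C1_mx_differentiable (Gs 1%N) Ux.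
rewrite /GamV mulmx_sumr linear_sum /= mulmx_suml -big_split /=.
apply: eq_bigr => c _; rewrite metric_compat// scalerDr.
by rewrite [(_ *: _)^T]linearZ /= -scalemxAr -scalemxAl.
Qed.

Lemma invmx_metric_smooth : smooth U (fun x => invmx (G x)).
Proof.
apply/smooth_mxP => // i j k; apply: Ck_invmx => // a b.
exact: metric_entry_smooth.
Qed.

(** Differentiate [G G^-1 = 1] and insert metric compatibility. *)
Lemma derive_inv_metric x v : U x ->
  'D_v (fun y => invmx (G y)) x =
  - (GamV G x v *m invmx (G x) + invmx (G x) *m (GamV G x v)^T).
Proof.
move=> Ux; set A := fun y => invmx (G y).
have Ad : is_derive x v A ('D_v A x).
  by apply: derivableP; exact: smooth_derivable invmx_metric_smooth Ux.
have Gd : is_derive x v G ('D_v G x).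
  by apply: derivableP; exact: smooth_derivable Gs Ux.
have [_] := is_derive_mulmx Gd Ad.
rewrite (@near_eq_derive _ _ _ _ (fun=> 1%:M)); last first.
  by apply: filterS (open_near Uo Ux) => y Uy; rewrite mulmxV// Gunit.
rewrite derive_cst => /esym/eqP; rewrite addrC addr_eq0 => /eqP E1.
rewrite -[LHS]mul1mx -(mulVmx (Gunit Ux)) -mulmxA E1 mulmxN metric_compatV//.
rewrite mulmxDl mulmxDr !mulmxA mulVmx ?Gunit// mul1mx -mulmxA mulmxV ?Gunit//.
by rewrite mulmx1.
Qed.

Lemma derive_Gam x c d : U x -> 'D_(e_ c) (fun y => Gam G y d) x =
  \matrix_(a, b) partial c (fun y => christoffel G y a d b) x.
Proof.
move=> Ux; rewrite derive_mx; last exact: smooth_derivable (Gam_smooth d) Ux.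
apply/matrixP => a b; rewrite [LHS]mxE [RHS]mxE.
rewrite /partial; have -> // : (fun y => Gam G y d a b) =
  (fun y => christoffel G y a d b) by apply/funext => y; rewrite mxE.
Qed.

Lemma RiemE x c d : U x -> Riem G x c d =
  'D_(e_ c) (fun y => Gam G y d) x - 'D_(e_ d) (fun y => Gam G y c) x +
  Gam G x c *m Gam G x d - Gam G x d *m Gam G x c.
Proof.
move=> Ux; rewrite !derive_Gam//; apply/matrixP => a b; rewrite !mxE /riemann.
by rewrite sumrB addrA; congr (_ + _ - _); apply: eq_bigr => e _; rewrite !mxE.
Qed.

Lemma Riem_antisym x c d : U x -> Riem G x d c = - Riem G x c d.
Proof.
move=> Ux; rewrite !RiemE//.
have H (A B C D : 'M[R]_4) : A - B + C - D = - (B - A + D - C).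
  by apply/matrixP => i j; rewrite !mxE; ring.
exact: H.
Qed.

(** Torsion-freeness: once [christoffel_sym] has aligned the lower indices, the twelve terms cancel
    in pairs. *)
Lemma bianchi x a b c d : U x ->
  Riem G x c d a b + Riem G x d b a c + Riem G x b c a d = 0.
Proof.
move=> Ux; rewrite !mxE /riemann.
have pS p q r : partial p (fun y => christoffel G y a q r) x =
                partial p (fun y => christoffel G y a r q) x.
  apply: near_eq_derive; apply: filterS (open_near Uo Ux) => y Uy.
  exact: christoffel_sym.
rewrite (pS c d b) (pS d c b) (pS b c d) !sumrB.
have S' p q r : \sum_e christoffel G x a p e * christoffel G x e q r =
   \sum_e christoffel G x a p e * christoffel G x e r q.
  by apply: eq_bigr => e _; rewrite (christoffel_sym e q r).
rewrite (S' c d b) (S' d b c) (S' b c d).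
have H (p1 p2 p3 q1 q2 q3 : R) :
  p1 - p2 + (q1 - q2) + (p2 - p3 + (q2 - q3)) + (p3 - p1 + (q3 - q1)) = 0 by ring.
exact: H.
Qed.

(** Mixed second derivatives of [G] commute; expanding both by [metric_compat] turns this into
    skewness. *)
Lemma metric_riem_skew x c d : U x ->
  G x *m Riem G x c d + (Riem G x c d)^T *m G x = 0.
Proof.
move=> Ux.
have D2 p q : 'D_(e_ p) (fun y => 'D_(e_ q) G y) x =
   ((G x *m Gam G x p + (Gam G x p)^T *m G x) *m Gam G x q +
     G x *m 'D_(e_ p) (fun y => Gam G y q) x) +
   ('D_(e_ p) (fun y => Gam G y q) x)^T *m G x +
   (Gam G x q)^T *m (G x *m Gam G x p + (Gam G x p)^T *m G x).
  have Gd : is_derive x (e_ p) G ('D_(e_ p) G x).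
    by apply: derivableP; exact: smooth_derivable Gs Ux.
  have Dd : is_derive x (e_ p) (fun y => Gam G y q) ('D_(e_ p) (fun y => Gam G y q) x).
    by apply: derivableP; exact: smooth_derivable (Gam_smooth q) Ux.
  rewrite (@near_eq_derive _ _ _ _ (fun y =>
      G y *m Gam G y q + (Gam G y q)^T *m G y)); last first.
    by apply: filterS (open_near Uo Ux) => y; exact: metric_compat.
  have H := is_deriveD (is_derive_mulmx Gd Dd) (is_derive_mulmx (is_derive_trmx Dd) Gd).
  by have [_ ->] := H; rewrite metric_compat// !addrA.
have sw : 'D_(e_ c) (fun y => 'D_(e_ d) G y) x = 'D_(e_ d) (fun y => 'D_(e_ c) G y) x.
  exact: schwarz_mx Uo Gs Ux.
rewrite (D2 c d) (D2 d c) in sw; rewrite (RiemE c d Ux).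
move: sw.
set Dc := 'D_(e_ c) _ x; set Dd := 'D_(e_ d) _ x.
exact: skew_of_symmetric_hessian.
Qed.

End OneMetric.
End LocalGeometry.

(** * Algebra of R7 curvature in a tetrad *)

Section FrameAlgebra.
Context {R : realType}.
Notation E := 'cV[R]_4.
Notation e_ c := (delta_mx c 0 : E).

Definition i0 : 'I_4 := @Ordinal 4 0 isT.
Definition i1 : 'I_4 := @Ordinal 4 1 isT.
Definition i2 : 'I_4 := @Ordinal 4 2 isT.
Definition i3 : 'I_4 := @Ordinal 4 3 isT.

Lemma ord4P (P : 'I_4 -> Prop) : P i0 -> P i1 -> P i2 -> P i3 -> forall i, P i.
Proof.
move=> P0 P1 P2 P3 i.
have [<-|i0N] := eqVneq i0 i; first exact: P0.
have [<-|i1N] := eqVneq i1 i; first exact: P1.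
have [<-|i2N] := eqVneq i2 i; first exact: P2.
have [<-|i3N] := eqVneq i3 i; first exact: P3.
by case: i i0N i1N i2N i3N => [[|[|[|[|]]]]].
Qed.

(* The matrices of [l /\ n] and [x /\ y] in the basis [l, n, x, y]. *)
Definition boost : 'M[R]_4 := delta_mx i0 i0 - delta_mx i1 i1.
Definition rotation : 'M[R]_4 := delta_mx i2 i3 - delta_mx i3 i2.

(** Membership in the holonomy algebra, for the tetrad formed by the columns of [P]. *)
Definition in_R7 (P M : 'M[R]_4) : Prop :=
  exists a b : R, M = P *m (a *: boost + b *: rotation) *m invmx P.

(** The curvature operator R(u, v), when [Rm] holds its coordinate components. *)
Definition bil (Rm : 'I_4 -> 'I_4 -> 'M[R]_4) (u v : E) : 'M[R]_4 :=
  \sum_c \sum_d (u c 0 * v d 0) *: Rm c d.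

Lemma bilDl Rm u v w : bil Rm (u + v) w = bil Rm u w + bil Rm v w.
Proof.
rewrite /bil -big_split; apply: eq_bigr => c _; rewrite -big_split.
by apply: eq_bigr => d _; rewrite mxE mulrDl scalerDl.
Qed.

Lemma bilDr Rm u v w : bil Rm u (v + w) = bil Rm u v + bil Rm u w.
Proof.
rewrite /bil -big_split; apply: eq_bigr => c _; rewrite -big_split.
by apply: eq_bigr => d _; rewrite mxE mulrDr scalerDl.
Qed.

Lemma bilZl Rm a u v : bil Rm (a *: u) v = a *: bil Rm u v.
Proof.
rewrite /bil scaler_sumr; apply: eq_bigr => c _; rewrite scaler_sumr.
by apply: eq_bigr => d _; rewrite mxE scalerA mulrA.
Qed.

Lemma bilZr Rm a u v : bil Rm u (a *: v) = a *: bil Rm u v.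
Proof.
rewrite /bil scaler_sumr; apply: eq_bigr => c _; rewrite scaler_sumr.
by apply: eq_bigr => d _; rewrite mxE scalerA mulrCA.
Qed.

Lemma bil_deltal Rm c d : bil Rm (e_ c) (e_ d) = Rm c d.
Proof.
rewrite /bil (bigD1 c)//= [X in _ + X]big1 ?addr0 => [|i ic]; last first.
  by rewrite big1// => j _; rewrite mxE (negbTE ic) mul0r scale0r.
rewrite (bigD1 d)//= !mxE !eqxx mulr1 scale1r big1 ?addr0// => i id.
by rewrite !mxE (negbTE id) mulr0 scale0r.
Qed.

Lemma bil_suml Rm (I : Type) (r : seq I) (u : I -> E) v :
  bil Rm (\sum_(i <- r) u i) v = \sum_(i <- r) bil Rm (u i) v.
Proof.
elim: r => [|i r IH]; last by rewrite !big_cons bilDl IH.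
by rewrite !big_nil -(scale0r 0) bilZl scale0r.
Qed.

Lemma bil_sumr Rm (I : Type) (r : seq I) (u : I -> E) v :
  bil Rm v (\sum_(i <- r) u i) = \sum_(i <- r) bil Rm v (u i).
Proof.
elim: r => [|i r IH]; last by rewrite !big_cons bilDr IH.
by rewrite !big_nil -(scale0r 0) bilZr scale0r.
Qed.

Lemma in_R7_lin P M N (a : R) : in_R7 P M -> in_R7 P N -> in_R7 P (a *: M + N).
Proof.
move=> [b [c ->]] [b' [c' ->]]; exists (a * b + b'), (a * c + c').
rewrite scalemxAl scalemxAr -mulmxDl -mulmxDr; congr (_ *m _ *m _).
by apply/matrixP => i j; rewrite !mxE; ring.
Qed.

Lemma in_R7_0 P : in_R7 P 0.
Proof. by exists 0, 0; rewrite !scale0r addr0 mulmx0 mul0mx. Qed.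

Lemma in_R7_sum P (I : Type) (r : seq I) (M : I -> 'M[R]_4) :
  (forall i, in_R7 P (M i)) -> in_R7 P (\sum_(i <- r) M i).
Proof.
move=> HM; elim: r => [|i r IH]; first by rewrite big_nil; exact: in_R7_0.
by rewrite big_cons -[M i]scale1r; exact: in_R7_lin.
Qed.

Lemma in_R7_bil P Rm u v : (forall c d, in_R7 P (Rm c d)) -> in_R7 P (bil Rm u v).
Proof.
move=> HR; apply: in_R7_sum => c; apply: in_R7_sum => d.
by rewrite -[X in in_R7 P X]addr0; apply: in_R7_lin => //; exact: in_R7_0.
Qed.

Lemma sum_outer (I : finType) (u v : I -> R) (p q : I -> E) :
  \sum_c \sum_d (u c * v d) *: (p c *m (q d)^T) =
  (\sum_c u c *: p c) *m (\sum_d v d *: q d)^T.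
Proof.
rewrite mulmx_suml; apply: eq_bigr => c _.
rewrite [(\sum_d _)^T]linear_sum mulmx_sumr; apply: eq_bigr => d _ /=.
by rewrite [(_ *: _)^T]linearZ /= -scalemxAr -scalemxAl scalerA mulrC.
Qed.

Section Frame.
Variables (P : 'M[R]_4) (Rm : 'I_4 -> 'I_4 -> 'M[R]_4).
Hypothesis Pu : P \in unitmx.
Hypothesis Rspan : forall c d, in_R7 P (Rm c d).
Hypothesis Ranti : forall c d, Rm d c = - Rm c d.
Hypothesis Rbianchi : forall a b c d, Rm c d a b + Rm d b a c + Rm b c a d = 0.

Local Notation t i := (P *m e_ i).
Local Notation rho i j := (bil Rm (t i) (t j)).

Lemma frame_expand (u : E) : u = \sum_i (invmx P *m u) i 0 *: t i.
Proof.
rewrite -{1}(mulKVmx Pu u) {1}[invmx P *m u]col_delta_sum mulmx_sumr.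
by apply: eq_bigr => i _; rewrite scalemxAr.
Qed.

Lemma bil_anti u v : bil Rm v u = - bil Rm u v.
Proof.
rewrite /bil exchange_big /= -sumrN; apply: eq_bigr => c _.
by rewrite -sumrN; apply: eq_bigr => d _; rewrite mulrC Ranti scalerN.
Qed.

Lemma bil_bianchi u v w :
  bil Rm u v *m w + bil Rm v w *m u + bil Rm w u *m v = 0.
Proof.
have X (p q r : E) : bil Rm p q *m r =
    \col_a \sum_c \sum_d \sum_b (p c 0 * q d 0 * r b 0 * Rm c d a b).
  apply/matrixP => a j; rewrite ord1 !mxE /bil.
  transitivity (\sum_b \sum_c \sum_d (p c 0 * q d 0 * r b 0 * Rm c d a b)).
    apply: eq_bigr => b _; rewrite summxE mulr_suml; apply: eq_bigr => c _.
    rewrite summxE mulr_suml; apply: eq_bigr => d _; rewrite mxE; ring.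
  by rewrite exchange_big; apply: eq_bigr => c _; rewrite exchange_big.
rewrite !X; apply/matrixP => a j; rewrite !mxE.
have -> : \sum_c \sum_d \sum_b (v c 0 * w d 0 * u b 0 * Rm c d a b) =
          \sum_c \sum_d \sum_b (u c 0 * v d 0 * w b 0 * Rm d b a c).
  rewrite exchange_big /=; under eq_bigr do rewrite exchange_big.
  rewrite exchange_big /=; apply: eq_bigr => c _; rewrite exchange_big /=.
  apply: eq_bigr => d _; apply: eq_bigr => b _; ring.
have -> : \sum_c \sum_d \sum_b (w c 0 * u d 0 * v b 0 * Rm c d a b) =
          \sum_c \sum_d \sum_b (u c 0 * v d 0 * w b 0 * Rm b c a d).
  rewrite exchange_big /=; apply: eq_bigr => c _; rewrite exchange_big /=.
  apply: eq_bigr => d _; apply: eq_bigr => b _; ring.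
rewrite -!big_split big1//= => c _; rewrite -!big_split big1//= => d _.
rewrite -!big_split big1//= => b _.
by rewrite -!mulrDr Rbianchi mulr0.
Qed.

Lemma frame_curvature : exists al be : R,
  [/\ rho i0 i1 = P *m (al *: boost) *m invmx P,
      rho i2 i3 = P *m (be *: rotation) *m invmx P,
      [/\ rho i0 i2 = 0, rho i3 i0 = 0, rho i3 i1 = 0 & rho i1 i2 = 0] &
      al = 0 -> be = 0 -> forall c d, Rm c d = 0].
Proof.
have /choice[ab abE] : forall ij : 'I_4 * 'I_4, exists ab : R * R,
    rho ij.1 ij.2 = P *m (ab.1 *: boost + ab.2 *: rotation) *m invmx P.
  move=> [i j]; have [a [b E]] := in_R7_bil (t i) (t j) Rspan.
  by exists (a, b).
pose a i j := (ab (i, j)).1; pose b i j := (ab (i, j)).2.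
have rhoE i j : rho i j = P *m (a i j *: boost + b i j *: rotation) *m invmx P.
  exact: (abE (i, j)).
have B i j k m : (a i j *: boost + b i j *: rotation) m k +
   (a j k *: boost + b j k *: rotation) m i +
   (a k i *: boost + b k i *: rotation) m j = 0.
  have H i' j' k' : rho i' j' *m t k' =
      P *m ((a i' j' *: boost + b i' j' *: rotation) *m e_ k').
    by rewrite rhoE -!mulmxA mulKmx.
  have := bil_bianchi (t i) (t j) (t k).
  rewrite !H -!mulmxDr.
  move=> /(congr1 (mulmx (invmx P))); rewrite mulKmx// mulmx0.
  by rewrite -!colE => /matrixP/(_ m 0); rewrite !mxE.
(* In each instance exactly one term survives. The ten instances kill ten coefficients: [a] and [b]
   on the four mixed pairs, [b i0 i1] and [a i2 i3]. *)
have := B i0 i2 i1 i1; have := B i2 i3 i0 i2; have := B i3 i0 i1 i1.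
have := B i2 i3 i0 i3; have := B i0 i3 i1 i0; have := B i2 i3 i1 i3.
have := B i2 i3 i1 i2; have := B i1 i2 i0 i0; have := B i2 i3 i0 i0.
have := B i3 i0 i1 i2.
rewrite !mxE /= !(mulr0, mulr1, subr0, sub0r, addr0, add0r, mulrN) => *.
have H (c d : R) : c = 0 -> d = 0 ->
    P *m (c *: boost + d *: rotation) *m invmx P = 0.
  by move=> -> ->; rewrite !scale0r addr0 mulmx0 mul0mx.
have r02 : rho i0 i2 = 0 by rewrite rhoE; apply: H; lra.
have r30 : rho i3 i0 = 0 by rewrite rhoE; apply: H; lra.
have r31 : rho i3 i1 = 0 by rewrite rhoE; apply: H; lra.
have r12 : rho i1 i2 = 0 by rewrite rhoE; apply: H; lra.
have r01 : rho i0 i1 = P *m (a i0 i1 *: boost) *m invmx P.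
  by rewrite rhoE (_ : b i0 i1 = 0) ?scale0r ?addr0//; lra.
have r23 : rho i2 i3 = P *m (b i2 i3 *: rotation) *m invmx P.
  by rewrite rhoE (_ : a i2 i3 = 0) ?scale0r ?add0r//; lra.
exists (a i0 i1), (b i2 i3); split=> // a0 b0 c d.
rewrite -bil_deltal (frame_expand (e_ c)) (frame_expand (e_ d)) bil_suml.
have rho0 : forall i j, rho i j = 0.
  have opp i j : rho i j = 0 -> rho j i = 0.
    by move=> E; rewrite bil_anti E oppr0.
  have rii i : rho i i = 0.
    have := bil_anti (t i) (t i); move: (rho i i) => X XE.
    apply/matrixP => p q; have := congr1 (fun M : 'M[R]_4 => M p q) XE.
    by rewrite !mxE; lra.
  have r01' : rho i0 i1 = 0 by rewrite r01 a0 scale0r mulmx0 mul0mx.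
  have r23' : rho i2 i3 = 0 by rewrite r23 b0 scale0r mulmx0 mul0mx.
  by apply: ord4P; apply: ord4P => //; exact: opp.
rewrite big1// => i _; rewrite bil_sumr big1// => j _.
by rewrite bilZl bilZr rho0 !scaler0.
Qed.

Variables (A : 'M[R]_4) (L : 'I_4 -> E).
Hypothesis RA : forall c d, Rm c d *m A + A *m (Rm c d)^T =
  e_ c *m (L d)^T - e_ d *m (L c)^T + L d *m (e_ c)^T - L c *m (e_ d)^T.

Local Notation LL := (\matrix_(i, j) L j i 0 : 'M[R]_4).

Lemma bil_act u v : bil Rm u v *m A + A *m (bil Rm u v)^T =
  u *m (LL *m v)^T - v *m (LL *m u)^T + (LL *m v) *m u^T - (LL *m u) *m v^T.
Proof.
have LLE w : LL *m w = \sum_d w d 0 *: L d.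
  apply/matrixP => i j; rewrite ord1 mxE summxE; apply: eq_bigr => k _.
  by rewrite !mxE mulrC.
have uE (w : E) : \sum_c w c 0 *: e_ c = w by rewrite -col_delta_sum.
transitivity (\sum_c \sum_d (u c 0 * v d 0) *:
    (e_ c *m (L d)^T - e_ d *m (L c)^T + L d *m (e_ c)^T - L c *m (e_ d)^T)).
  rewrite [(bil _ _ _)^T]linear_sum mulmx_suml mulmx_sumr -big_split /=.
  apply: eq_bigr => c _; rewrite [(\sum_d _)^T]linear_sum mulmx_suml mulmx_sumr.
  rewrite -big_split /=; apply: eq_bigr => d _; rewrite -RA.
  by rewrite [(_ *: _)^T]linearZ /= -scalemxAl -scalemxAr -scalerDr.
have S1 : \sum_c \sum_d (u c 0 * v d 0) *: (e_ c *m (L d)^T) = u *m (LL *m v)^T.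
  by rewrite (sum_outer (fun c => u c 0) (fun d => v d 0)) uE LLE.
have S2 : \sum_c \sum_d (u c 0 * v d 0) *: (e_ d *m (L c)^T) = v *m (LL *m u)^T.
  rewrite exchange_big /=; under eq_bigr do under eq_bigr do rewrite mulrC.
  by rewrite (sum_outer (fun c => v c 0) (fun d => u d 0)) uE LLE.
have S3 : \sum_c \sum_d (u c 0 * v d 0) *: (L d *m (e_ c)^T) = (LL *m v) *m u^T.
  rewrite exchange_big /=; under eq_bigr do under eq_bigr do rewrite mulrC.
  by rewrite (sum_outer (fun c => v c 0) (fun d => u d 0)) uE LLE.
have S4 : \sum_c \sum_d (u c 0 * v d 0) *: (L c *m (e_ d)^T) = (LL *m u) *m v^T.
  by rewrite (sum_outer (fun c => u c 0) (fun d => v d 0)) uE LLE.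
rewrite -S1 -S2 -S3 -S4 -sumrB -big_split -sumrB; apply: eq_bigr => c _ /=.
rewrite -sumrB -big_split -sumrB; apply: eq_bigr => d _ /=.
by rewrite scalerBr scalerDr scalerBr.
Qed.

Lemma delta_mulmx_entry n (i j p q : 'I_n) (M : 'M[R]_n) :
  (delta_mx i j *m M) p q = (p == i)%:R * M j q.
Proof.
rewrite mxE (bigD1 j)//= mxE eqxx andbT big1 ?addr0// => k kj.
by rewrite mxE (negbTE kj) andbF mul0r.
Qed.

Lemma mulmx_delta_entry n (i j p q : 'I_n) (M : 'M[R]_n) :
  (M *m delta_mx i j) p q = M p i * (q == j)%:R.
Proof.
rewrite mxE (bigD1 i)//= mxE eqxx big1 ?addr0// => k ki.
by rewrite mxE (negbTE ki) mulr0.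
Qed.

(** In the frame the action on [A] becomes [J ell^T - ell J], where [J i j] is [E_ij - E_ji]. For a
    pair with vanishing curvature this is zero, which clears the off-diagonal entries of columns [i]
    and [j] of [ell] and equates their diagonal entries. The pairs 02, 30, 31 link all four indices,
    so [ell] is scalar, and then the expression vanishes for every pair. *)
Lemma frame_commute :
  rho i0 i2 = 0 -> rho i3 i0 = 0 -> rho i3 i1 = 0 ->
  rho i0 i1 *m A + A *m (rho i0 i1)^T = 0 /\
  rho i2 i3 *m A + A *m (rho i2 i3)^T = 0.
Proof.
move=> r02 r30 r31; pose ell := invmx P *m LL *m P.
have LLt i : LL *m t i = P *m (ell *m e_ i).
  by rewrite /ell !mulmxA mulmxV// mul1mx.
pose J i j : 'M[R]_4 := delta_mx i j - delta_mx j i.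
have H i j : rho i j *m A + A *m (rho i j)^T =
    P *m (J i j *m ell^T - ell *m J i j) *m P^T.
  rewrite bil_act !LLt !trmx_mul /J !mulmxBl !mulmxBr !mulmxBl !mulmxA.
  have D a b : (e_ a : E) *m (e_ b)^T = delta_mx a b.
    by rewrite trmx_delta mul_delta_mx.
  have D' (X : 'M[R]_4) a b : X *m e_ a *m (e_ b)^T = X *m delta_mx a b.
    by rewrite -mulmxA D.
  by rewrite !D' opprB addrA.
have HJ i j : rho i j = 0 -> J i j *m ell^T - ell *m J i j = 0.
  move=> r; have := H i j; rewrite r mul0mx trmx0 mulmx0 addr0 => /esym.
  move: (_ - _) => X XE; have Pt : P^T \in unitmx by rewrite unitmx_tr.
  by rewrite -[X](mulKmx Pu) -[P *m X](mulmxK Pt) XE mul0mx mulmx0.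
have ellE i j p q : rho i j = 0 ->
    (p == i)%:R * ell q j - (p == j)%:R * ell q i -
    (ell p i * (q == j)%:R - ell p j * (q == i)%:R) = 0.
  move=> /HJ/(congr1 (fun M : 'M[R]_4 => M p q)).
  have S (M1 M2 M3 M4 : 'M[R]_4) : (M1 - M2 - (M3 - M4)) p q =
    M1 p q - M2 p q - (M3 p q - M4 p q) by rewrite !mxE.
  rewrite /J mulmxBl mulmxBr S [(0 : 'M[R]_4) p q]mxE.
  by rewrite !delta_mulmx_entry !mulmx_delta_entry ![_^T _ _]mxE.
have [mu ellmu] : exists mu, ell = mu%:M.
  clear H HJ.
  have := ellE i0 i2 i0 i0 r02; have := ellE i0 i2 i2 i2 r02; have := ellE i0 i2 i0 i2 r02.
  have := ellE i0 i2 i0 i1 r02; have := ellE i0 i2 i0 i3 r02; have := ellE i0 i2 i2 i1 r02.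
  have := ellE i0 i2 i2 i3 r02; have := ellE i3 i0 i3 i3 r30; have := ellE i3 i0 i0 i0 r30.
  have := ellE i3 i0 i3 i0 r30; have := ellE i3 i0 i3 i1 r30; have := ellE i3 i0 i3 i2 r30.
  have := ellE i3 i0 i0 i1 r30; have := ellE i3 i0 i0 i2 r30; have := ellE i3 i1 i3 i3 r31.
  have := ellE i3 i1 i1 i1 r31; have := ellE i3 i1 i3 i1 r31; have := ellE i3 i1 i3 i0 r31.
  have := ellE i3 i1 i3 i2 r31; have := ellE i3 i1 i1 i0 r31; have := ellE i3 i1 i1 i2 r31.
  rewrite /= !(mulr0, mulr1, mul0r, mul1r, subr0, sub0r, addr0, add0r, opprK) => *.
  exists (ell i0 i0); apply/matrixP.
  by apply: ord4P; apply: ord4P; rewrite [RHS]mxE /= ?mulr1n ?mulr0n; lra.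
by rewrite !H ellmu tr_scalar_mx !mul_mx_scalar !mul_scalar_mx !subrr mulmx0 mul0mx.
Qed.

End Frame.
End FrameAlgebra.

(** * Curvature of projectively related metrics *)

Section ProjectiveDifference.
#[local] Opaque derive.
Context {R : realType}.
Notation E := 'cV[R]_4.
Notation e_ c := (delta_mx c 0 : E).

Lemma outer_sym0 n (w z : 'cV[R]_n) :
  z != 0 -> w *m z^T + z *m w^T = 0 -> w = 0.
Proof.
move=> z0 wz; have [k zk] : exists k, z k 0 != 0.
  apply: contra_neqP z0 => /forallNP H; apply/matrixP => i j; rewrite ord1 mxE.
  by have /negP := H i; rewrite negbK => /eqP.
have E1 i j : w i 0 * z j 0 + z i 0 * w j 0 = 0.
  by have /matrixP/(_ i j) := wz; rewrite !mxE !big_ord1 !mxE.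
have wk : w k 0 = 0.
  have := E1 k k; rewrite [z k 0 * _]mulrC -mulr2n => /eqP.
  by rewrite mulrn_eq0 /= mulf_eq0 (negbTE zk) orbF => /eqP.
apply/matrixP => i j; rewrite ord1 [RHS]mxE; have := E1 i k.
by rewrite wk mulr0 addr0 => /eqP; rewrite mulf_eq0 (negbTE zk) orbF => /eqP.
Qed.

Lemma trace_skew0 n (G M : 'M[R]_n) : G \in unitmx -> G^T = G ->
  G *m M + M^T *m G = 0 -> \tr M = 0.
Proof.
move=> Gu Gs /eqP; rewrite addr_eq0 => /eqP GM.
have : \tr M = - \tr M.
  rewrite -{1}(mulKmx Gu M) GM mulmxN linearN /= mulmxA mxtrace_mulC mulmxA.
  by rewrite mulmxV// mul1mx mxtrace_tr.
by move=> H; lra.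
Qed.

(** The classical projective change of curvature: [C], [D] are the Christoffel matrices in
    directions [c], [d], [X] and [Y] their cross derivatives, [dc] and [dd] the derivatives of
    [psi]. The hypothesis is torsion-freeness, by which [C e_d psi^T] and [D e_c psi^T] cancel. *)
Lemma projective_curvature (C D X Y : 'M[R]_4) (psi dc dd : E) (c d : 'I_4) :
  C *m e_ d = D *m e_ c ->
  (X + (e_ d *m dc^T + dc d 0 *: 1%:M)) - (Y + (e_ c *m dd^T + dd c 0 *: 1%:M)) +
    (C + (e_ c *m psi^T + psi c 0 *: 1%:M)) *m (D + (e_ d *m psi^T + psi d 0 *: 1%:M)) -
    (D + (e_ d *m psi^T + psi d 0 *: 1%:M)) *m (C + (e_ c *m psi^T + psi c 0 *: 1%:M)) =
  (X - Y + C *m D - D *m C) +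
  e_ d *m (dc^T - psi^T *m C - psi c 0 *: psi^T) -
  e_ c *m (dd^T - psi^T *m D - psi d 0 *: psi^T) +
  (dc d 0 - dd c 0) *: 1%:M.
Proof.
move=> CD.
have pe k : psi^T *m e_ k = (psi k 0)%:M.
  apply/matrixP => i j; rewrite !ord1 -colE !mxE eqxx mulr1n.
  by [].
have q1 : e_ c *m psi^T *m (e_ d *m psi^T) = psi d 0 *: (e_ c *m psi^T).
  by rewrite -mulmxA [psi^T *m _]mulmxA pe mul_scalar_mx scalemxAr.
have q2 : e_ d *m psi^T *m (e_ c *m psi^T) = psi c 0 *: (e_ d *m psi^T).
  by rewrite -mulmxA [psi^T *m _]mulmxA pe mul_scalar_mx scalemxAr.
have q3 : C *m (e_ d *m psi^T) = D *m (e_ c *m psi^T) by rewrite !mulmxA CD.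
rewrite !mulmxDl !mulmxDr !mulmxN -!scalemxAl -!scalemxAr !mulmx1 !mul1mx q1 q2 q3.
rewrite !mulmxA.
move: (C *m D) (D *m C) (D *m e_ c *m psi^T) (e_ c *m psi^T *m D) (e_ d *m psi^T *m C)
  (e_ c *m psi^T) (e_ d *m psi^T) (e_ d *m dc^T) (e_ c *m dd^T) => *.
by apply/matrixP => i j; rewrite !mxE; ring.
Qed.

Section TwoMetrics.
Variables (U : set E) (G G' : E -> 'M[R]_4).
Hypotheses (Uo : open U) (Gs : smooth U G) (Gs' : smooth U G').
Hypothesis Gsym : forall x, U x -> (G x)^T = G x.
Hypothesis Gunit : forall x, U x -> G x \in unitmx.
Hypothesis Gsym' : forall x, U x -> (G' x)^T = G' x.
Hypothesis Gunit' : forall x, U x -> G' x \in unitmx.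

(* The trace of [delta^a_b psi_c + delta^a_c psi_b] over [a] and [b] is [5 psi_c]. *)
Definition proj_form (x : E) : E :=
  \col_c (5^-1 * \tr (Gam G' x c - Gam G x c)).

Hypothesis GamD : forall x c, U x -> Gam G' x c =
  Gam G x c + (e_ c *m (proj_form x)^T + proj_form x c 0 *: 1%:M).

Lemma proj_form_smooth : smooth U proj_form.
Proof.
apply/smooth_mxP => // c j k.
rewrite (_ : (fun x => _) = (fun x => 5^-1 * \sum_i (Gam G' x c i i - Gam G x c i i))).
  apply: CkM => //; first exact: Ck_cst.
  apply: Ck_sum => // i; apply: CkD => //.
    have /(smooth_mxP _ Uo) := Gam_smooth Uo Gs' Gunit' c; exact.
  by apply: CkN => //; have /(smooth_mxP _ Uo) := Gam_smooth Uo Gs Gunit c; exact.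
by apply/funext => x; rewrite mxE; congr (_ * _); apply: eq_bigr => i _; rewrite !mxE.
Qed.

Lemma GamVD_proj x v : U x -> GamV G' x v =
  GamV G x v + (v *m (proj_form x)^T + ((proj_form x)^T *m v) 0 0 *: 1%:M).
Proof.
move=> Ux; rewrite /GamV; under eq_bigr do rewrite GamD// scalerDr scalerDr.
rewrite big_split big_split /=; congr (_ + (_ + _)).
  rewrite {2}[v]col_delta_sum mulmx_suml; apply: eq_bigr => c _.
  by rewrite scalemxAl.
under eq_bigr do rewrite scalerA; rewrite -scaler_suml; congr (_ *: _).
by rewrite mxE; apply: eq_bigr => c _; rewrite [_^T _ _]mxE mulrC.
Qed.

(** The new curvature differs from the old one by outer products with [Q] and by the curl [om] of
    [psi], which vanishes. Multiplying the skewness relation by [A] on both sides raises the index,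
    and the vectors [L] come out as [A Q^T]. *)
Lemma projective_skew x : U x -> exists L : 'I_4 -> E, forall c d,
  Riem G x c d *m invmx (G' x) + invmx (G' x) *m (Riem G x c d)^T =
  e_ c *m (L d)^T - e_ d *m (L c)^T + L d *m (e_ c)^T - L c *m (e_ d)^T.
Proof.
move=> Ux; set psi := proj_form x; set A := invmx (G' x).
pose dp c := 'D_(e_ c) proj_form x.
pose Q c : 'rV[R]_4 := (dp c)^T - psi^T *m Gam G x c - psi c 0 *: psi^T.
pose om c d : R := dp c d 0 - dp d c 0.
have dGam c d : 'D_(e_ c) (fun y => Gam G' y d) x =
   'D_(e_ c) (fun y => Gam G y d) x + (e_ d *m (dp c)^T + dp c d 0 *: 1%:M).
  rewrite (@near_eq_derive _ _ _ _ (fun y => Gam G y d +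
     (e_ d *m (proj_form y)^T + proj_form y d 0 *: 1%:M))); last first.
    by apply: filterS (open_near Uo Ux) => y; exact: GamD.
  have pd : is_derive x (e_ c) proj_form (dp c).
    by apply: derivableP; exact: smooth_derivable proj_form_smooth Ux.
  have gd : is_derive x (e_ c) (fun y => Gam G y d) ('D_(e_ c) (fun y => Gam G y d) x).
    by apply: derivableP; exact: smooth_derivable (Gam_smooth Uo Gs Gunit d) Ux.
  have sd : is_derive x (e_ c) (fun y => proj_form y d 0 *: (1%:M : 'M[R]_4))
      (dp c d 0 *: 1%:M).
    apply: (is_derive_eq (is_derive_scale ((is_derive_mxP _ _ _ _).1 pd d 0)
      (is_derive_cst _ _ _))).
    by rewrite scaler0 addr0.
  by have [_ ->] := is_deriveD gd (is_deriveD (is_derive_mulmxl (e_ d)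
    (is_derive_trmx pd)) sd).
have R' c d : Riem G' x c d =
    Riem G x c d + e_ d *m Q c - e_ c *m Q d + om c d *: 1%:M.
  rewrite (RiemE Uo Gs' Gunit' c d Ux) (RiemE Uo Gs Gunit c d Ux) !dGam !GamD//.
  by apply: projective_curvature; exact: (Gam_sym Uo Gsym).
have tr0 c d : \tr (Riem G x c d) = 0.
  exact: (trace_skew0 (Gunit Ux) (Gsym Ux) (metric_riem_skew Uo Gs Gsym Gunit c d Ux)).
have tr0' c d : \tr (Riem G' x c d) = 0.
  exact: (trace_skew0 (Gunit' Ux) (Gsym' Ux) (metric_riem_skew Uo Gs' Gsym' Gunit' c d Ux)).
(* Both curvatures are trace-free. By symmetry of the Christoffel symbols the outer products
   contribute a further [om c d], so the trace of the difference is [5 om c d]. *)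
have om0 c d : om c d = 0.
  have := tr0' c d; rewrite R' mxtraceD mxtraceZ mxtrace_scalar raddfB /= mxtraceD tr0.
  have trQ k l : \tr (e_ k *m Q l) = Q l 0 k.
    by rewrite mxtrace_mulC trace_mx11 -colE mxE.
  rewrite !trQ.
  have -> : Q c 0 d = dp c d 0 - (psi^T *m (Gam G x c *m e_ d)) 0 0 - psi c 0 * psi d 0.
    by rewrite mulmxA -colE !mxE.
  have -> : Q d 0 c = dp d c 0 - (psi^T *m (Gam G x c *m e_ d)) 0 0 - psi d 0 * psi c 0.
    by rewrite (Gam_sym Uo Gsym c d Ux) mulmxA -colE !mxE.
  by rewrite /om; lra.
have AS : A^T = A by rewrite /A trmx_inv Gsym'.
clearbody Q.
exists (fun c => A *m (Q c)^T) => c d.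
have : Riem G' x c d *m A + A *m (Riem G' x c d)^T = 0.
  have := metric_riem_skew Uo Gs' Gsym' Gunit' c d Ux.
  move=> /(congr1 (fun M => A *m M *m A)).
  rewrite mulmxDr mulmxDl mulmx0 mul0mx !mulmxA /A mulVmx ?Gunit'// mul1mx.
  by rewrite -!mulmxA mulmxV ?Gunit'// mulmx1.
rewrite R' om0 scale0r addr0.
have RT : (Riem G x c d + e_ d *m Q c - e_ c *m Q d)^T =
   (Riem G x c d)^T + (Q c)^T *m (e_ d)^T - (Q d)^T *m (e_ c)^T.
  by rewrite linearB linearD /= !trmx_mul.
rewrite RT mulmxBl mulmxDl mulmxBr mulmxDr !trmx_mul !trmxK AS !mulmxA.
move: (Riem G x c d *m A) (A *m (Riem G x c d)^T) (e_ d *m Q c *m A)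
  (e_ c *m Q d *m A) (A *m (Q c)^T *m (e_ d)^T) (A *m (Q d)^T *m (e_ c)^T).
move=> a1 a2 a3 a4 a5 a6 /matrixP H; apply/matrixP => i j; have := H i j.
by rewrite !mxE; lra.
Qed.

End TwoMetrics.
End ProjectiveDifference.

(** * Transformation law of the connection *)

Section ChartChange.
#[local] Opaque derive.
Context {R : realType}.
Notation E := 'cV[R]_4.
Notation e_ c := (delta_mx c 0 : E).

(** Koszul's argument: a trilinear form that is symmetric in its first two arguments and skew in its
    last two vanishes. *)
Lemma levi_civita_unique (G : 'M[R]_4) (D : E -> 'M[R]_4) :
  G \in unitmx -> G^T = G ->
  (forall u, G *m D u + (D u)^T *m G = 0) ->
  (forall u v, D u *m v = D v *m u) -> forall u, D u = 0.
Proof.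
move=> Gu Gs Dskew Dsym u.
pose f (u v w : E) : R := (w^T *m (G *m D u *m v)) 0 0.
have fs a b c : f a b c = f b a c by rewrite /f -!mulmxA Dsym.
have fa a b c : f a b c = - f a c b.
  have GD : G *m D a = - ((D a)^T *m G) by apply/eqP; rewrite -addr_eq0 Dskew.
  rewrite /f {1}GD mulNmx mulmxN [LHS]mxE; congr (- _).
  rewrite -[LHS]trace_mx11 -[RHS]trace_mx11 -mxtrace_tr.
  by rewrite !trmx_mul !trmxK Gs !mulmxA.
have f0 a b c : f a b c = 0.
  have : f a b c = - f a b c; last by lra.
  by rewrite {1}fs fa fs fa opprK fs fa.
suff GD : G *m D u = 0 by rewrite -(mulKmx Gu (D u)) GD mulmx0.
apply/matrixP => i j; have := f0 u (e_ j) (e_ i).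
by rewrite /f -colE trmx_delta -rowE !mxE.
Qed.

Definition jac (phi : E -> E) (x : E) : 'M[R]_4 :=
  \matrix_(i, j) ('D_(e_ j) phi x) i 0.

Lemma jacE (phi : E -> E) x v : differentiable phi x ->
  'D_v phi x = jac phi x *m v.
Proof.
move=> pd; rewrite differentiable_deriveE//; apply/matrixP => i j.
rewrite ord1 summxE mxE; apply: eq_bigr => k _.
by rewrite mxE [RHS]mulrC; congr (_ * _); rewrite mxE.
Qed.

Lemma inner_eqP (A B : 'M[R]_4) :
  (forall u v, inner A u v = inner B u v) -> A = B.
Proof.
move=> AB; apply/matrixP => i j; have := AB (e_ i) (e_ j).
by rewrite /inner !trmx_delta -!rowE -!colE !mxE.
Qed.

Lemma innerE (A J : 'M[R]_4) u v :
  inner A (J *m u) (J *m v) = inner (J^T *m A *m J) u v.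
Proof. by rewrite /inner trmx_mul !mulmxA. Qed.

Lemma GamV_sym (U : set E) G x u v : open U ->
  (forall x, U x -> (G x)^T = G x) -> U x ->
  GamV G x u *m v = GamV G x v *m u.
Proof.
move=> Uo Gsym Ux; rewrite -!christoffel_appE; apply/matrixP => a j.
rewrite !mxE exchange_big; apply: eq_bigr => b _; apply: eq_bigr => c _.
by rewrite (christoffel_sym Uo Gsym a c b Ux) mulrAC.
Qed.

Section Law.
Variables (U V U' : set E) (phi : E -> E) (G G' : E -> 'M[R]_4).
Hypotheses (Uo : open U) (Vo : open V) (Uo' : open U').
Hypotheses (VU : V `<=` U) (VU' : forall x, V x -> U' (phi x)).
Hypothesis phis : smooth V phi.
Hypotheses (Gs : smooth U G) (Gs' : smooth U' G').
Hypothesis Gsym : forall x, U x -> (G x)^T = G x.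
Hypothesis Gunit : forall x, U x -> G x \in unitmx.
Hypothesis Gsym' : forall x, U' x -> (G' x)^T = G' x.
Hypothesis Gunit' : forall x, U' x -> G' x \in unitmx.
Hypothesis GG' : forall x u v, V x ->
  inner (G x) u v = inner (G' (phi x)) ('D_u phi x) ('D_v phi x).

Local Notation J := (jac phi).

Lemma phi_differentiable x : V x -> differentiable phi x.
Proof. by move=> Vx; exact: C1_mx_differentiable (phis 1%N) Vx. Qed.

Lemma metric_pullback x : V x -> G x = (J x)^T *m G' (phi x) *m J x.
Proof.
move=> Vx; apply: inner_eqP => u v.
by rewrite GG'// !(jacE _ (phi_differentiable Vx)) innerE.
Qed.

Lemma jac_unit x : V x -> J x \in unitmx.
Proof.
move=> Vx; have := Gunit (VU Vx); rewrite metric_pullback// !unitmxE.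
by rewrite det_mulmx unitrM => /andP[].
Qed.

Lemma jac_smooth : smooth V J.
Proof.
apply/smooth_mxP => // i j.
rewrite (_ : (fun x => _) = (fun x => ('D_(e_ j) phi x) i 0)); last first.
  by apply/funext => x; rewrite mxE.
by have /(smooth_mxP _ Vo) := smooth_derive (e_ j) phis; exact.
Qed.

Lemma jac_hessian_sym x u v : V x -> 'D_u J x *m v = 'D_v J x *m u.
Proof.
move=> Vx.
have HJ a b : 'D_a J x *m b = 'D_a (fun y => 'D_b phi y) x.
  rewrite (@near_eq_derive _ _ _ _ (fun y => J y *m b)); last first.
    apply: filterS (open_near Vo Vx) => y Vy.
    by rewrite jacE//; exact: phi_differentiable.
  have Jd : is_derive x a J ('D_a J x).
    by apply: derivableP; exact: smooth_derivable jac_smooth Vx.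
  by have [_ ->] := is_derive_mulmxr b Jd.
have S := schwarz_mx v u Vo phis Vx.
exact: etrans (HJ u v) (etrans S (esym (HJ v u))).
Qed.

(** Up to the factor [J], the right-hand side is the pulled-back connection. Differentiating the
    pullback of the metric shows that it is compatible with [G], the symmetry of the second
    derivatives of [phi] that it is torsion-free, and [levi_civita_unique] identifies it. *)
Lemma christoffel_law x u : V x ->
  J x *m GamV G x u = 'D_u J x + GamV G' (phi x) (J x *m u) *m J x.
Proof.
move=> Vx; have Ju := jac_unit Vx.
pose D u := GamV G x u - invmx (J x) *m ('D_u J x + GamV G' (phi x) (J x *m u) *m J x).
suff D0 : D u = 0.
  move/eqP : D0; rewrite subr_eq0 => /eqP ->.
  by rewrite mulKVmx.
apply: (levi_civita_unique (Gunit (VU Vx)) (Gsym (VU Vx))) => {u} [u|u v]; last first.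
  rewrite /D !mulmxBl; congr (_ - _); first exact: GamV_sym Uo Gsym (VU Vx).
  rewrite -!mulmxA; congr (_ *m _); rewrite !mulmxDl; congr (_ + _).
    exact: jac_hessian_sym Vx.
  by rewrite -!mulmxA; exact: GamV_sym Uo' Gsym' (VU' Vx).
have DG : 'D_u G x = ('D_u J x)^T *m G' (phi x) *m J x +
    (J x)^T *m (G' (phi x) *m GamV G' (phi x) (J x *m u) +
      (GamV G' (phi x) (J x *m u))^T *m G' (phi x)) *m J x +
    (J x)^T *m G' (phi x) *m 'D_u J x.
  rewrite (@near_eq_derive _ _ _ _ (fun y => (J y)^T *m G' (phi y) *m J y)); last first.
    by apply: filterS (open_near Vo Vx) => y; exact: metric_pullback.
  have Jd : is_derive x u J ('D_u J x).
    by apply: derivableP; exact: smooth_derivable jac_smooth Vx.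
  have G'd : differentiable G' (phi x).
    exact: C1_mx_differentiable (Gs' 1%N) (VU' Vx).
  have cd : is_derive x u (G' \o phi) ('D_(J x *m u) G' (phi x)).
    split; last by rewrite derive_chain ?jacE//; exact: phi_differentiable.
    by apply: diff_derivable; apply: differentiable_comp => //; exact: phi_differentiable.
  have [_ ->] := is_derive_mulmx (is_derive_mulmx (is_derive_trmx Jd) cd) Jd.
  by rewrite (metric_compatV Uo' Gs' Gsym' Gunit' _ (VU' Vx)) /= mulmxDl.
have := metric_compatV Uo Gs Gsym Gunit u (VU Vx); rewrite DG => compat.
set B := GamV G' (phi x) _ in DG compat *; set H := 'D_u J x in DG compat *.
have E1 : G x *m (invmx (J x) *m (H + B *m J x)) =
   (J x)^T *m G' (phi x) *m H + (J x)^T *m G' (phi x) *m B *m J x.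
  by rewrite {1}metric_pullback// mulmxA mulmxK// mulmxDr !mulmxA.
have E2 : (invmx (J x) *m (H + B *m J x))^T *m G x =
   H^T *m G' (phi x) *m J x + (J x)^T *m B^T *m G' (phi x) *m J x.
  rewrite -{1}(Gsym (VU Vx)) -trmx_mul E1 linearD /= !trmx_mul !trmxK.
  by rewrite (Gsym' (VU' Vx)) !mulmxA.
rewrite /D [(_ - _)^T]linearB /= mulmxBr mulmxBl E1 E2.
rewrite addrACA -opprD -compat mulmxDr mulmxDl !mulmxA.
set a1 := H^T *m _ *m _; set a2 := _ *m H; set a3 := _ *m B *m J x.
set a4 := _ *m B^T *m _ *m _.
by apply/matrixP => i j; rewrite !mxE; ring.
Qed.

(** The second derivatives of [phi] in [christoffel_law] cancel against the derivative of [J] along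
    the curve. *)
Lemma transport_law (u Z : R -> E) t du :
  V (u t) -> is_derive t 1 u du ->
  is_derive t 1 Z (- (GamV G (u t) du *m Z t)) ->
  is_derive t 1 (fun s => J (u s) *m Z s)
    (- (GamV G' (phi (u t)) (J (u t) *m du) *m (J (u t) *m Z t))).
Proof.
move=> Vu ud Zd.
have Jd : is_derive t 1 (J \o u) ('D_du J (u t)).
  by apply: is_derive_chain ud; exact: C1_mx_differentiable (jac_smooth 1%N) Vu.
apply: (is_derive_eq (is_derive_mulmx Jd Zd)) => /=.
rewrite mulmxN [J (u t) *m (GamV G _ _ *m _)]mulmxA christoffel_law// mulmxDl opprD addrA subrr add0r.
by rewrite !mulmxA.
Qed.

End Law.
End ChartChange.

(** * Local existence of geodesics *)

Section BoundedLipschitz.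
Context {R : realType} {W : normedModType R}.

(** Boundedness is included because a product of merely Lipschitz functions need not be
    Lipschitz. *)
Definition BL (f : W -> R) : Prop := exists K : R,
  [/\ 0 <= K, forall y, `|f y| <= K & forall y z, `|f y - f z| <= K * `|y - z|].

Lemma BL_cst a : BL (fun=> a).
Proof. by exists `|a|; split=> // y z; rewrite subrr normr0 mulr_ge0. Qed.

Lemma BL_D f g : BL f -> BL g -> BL (fun y => f y + g y).
Proof.
move=> [K [K0 fK fL]] [K' [K0' gK gL]]; exists (K + K'); split.
- exact: addr_ge0.
- by move=> y; rewrite (le_trans (ler_normD _ _))// lerD.
- move=> y z; rewrite opprD addrACA (le_trans (ler_normD _ _))// mulrDl.
  by rewrite lerD.
Qed.

Lemma BL_M f g : BL f -> BL g -> BL (fun y => f y * g y).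
Proof.
move=> [K [K0 fK fL]] [K' [K0' gK gL]]; exists (2 * (K * K')); split.
- by rewrite !mulr_ge0.
- move=> y; rewrite normrM (@le_trans _ _ (K * K'))//; first exact: ler_pM.
  by have := mulr_ge0 K0 K0'; lra.
- move=> y z; have -> : f y * g y - f z * g z = f y * (g y - g z) + (f y - f z) * g z.
    by ring.
  rewrite (le_trans (ler_normD _ _))// !normrM.
  have -> : 2 * (K * K') * `|y - z| = K * (K' * `|y - z|) + K * `|y - z| * K' by ring.
  by rewrite lerD// ler_pM// mulr_ge0.
Qed.

Lemma BL_sum (I : Type) (r : seq I) (f : I -> W -> R) :
  (forall i, BL (f i)) -> BL (fun y => \sum_(i <- r) f i y).
Proof.
move=> fB; elim: r => [|i r IH].
  by under eq_fun do rewrite big_nil; exact: BL_cst.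
by under eq_fun do rewrite big_cons; exact: BL_D.
Qed.

Lemma BL_mx m n (H : W -> 'M[R]_(m, n)) : (forall i j, BL (fun y => H y i j)) ->
  exists K : R, [/\ 0 < K, forall y, `|H y| <= K &
                     forall y z, `|H y - H z| <= K * `|y - z|].
Proof.
move=> HB; have /choice[K KE] : forall ij : 'I_m * 'I_n, exists K : R,
    [/\ 0 <= K, forall y, `|H y ij.1 ij.2| <= K &
        forall y z, `|H y ij.1 ij.2 - H z ij.1 ij.2| <= K * `|y - z|].
  by move=> [i j]; exact: HB.
have S0 : 0 <= \sum_ij K ij by apply: sumr_ge0 => ij _; have [] := KE ij.
have Kle ij : K ij <= 1 + \sum_ij K ij.
  rewrite (bigD1 ij)//= addrCA lerDl addr_ge0//.
  by apply: sumr_ge0 => k _; have [] := KE k.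
exists (1 + \sum_ij K ij); split.
- by rewrite ltr_pwDl.
- move=> y; apply: mx_norm_le => [|i j]; first by rewrite addr_ge0.
  by have [_ H1 _] := KE (i, j); exact: le_trans (H1 y) (Kle (i, j)).
- move=> y z; apply: mx_norm_le => [|i j]; first by rewrite mulr_ge0// addr_ge0.
  have [_ _ H1] := KE (i, j); rewrite !mxE; apply: le_trans (H1 y z) _.
  by rewrite ler_wpM2r.
Qed.

End BoundedLipschitz.

Section LocalGeodesic.
#[local] Opaque derive.
Context {R : realType}.
Notation E := 'cV[R]_4.
Notation e_ c := (delta_mx c 0 : E).

Definition clampE (x : E) (r : R) (y : E) : E :=
  \col_i clamp (x i 0 - r) (x i 0 + r) (y i 0).

Lemma clampE_in x r y : 0 <= r -> `|clampE x r y - x| <= r.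
Proof.
move=> r0; apply: mx_norm_le => // i j; rewrite ord1 !mxE ler_norml.
have /andP[] : x i 0 - r <= clamp (x i 0 - r) (x i 0 + r) (y i 0) <= x i 0 + r.
  by apply: clamp_in; lra.
by move=> *; lra.
Qed.

Lemma clampE_id x r y : `|y - x| <= r -> clampE x r y = y.
Proof.
move=> yr; apply/matrixP => i j; rewrite ord1 mxE clamp_id//.
have := le_trans (mx_norm_entry (y - x) i 0) yr; rewrite !mxE ler_norml.
by move=> *; lra.
Qed.

Lemma clampE_lipschitz x r y z : `|clampE x r y - clampE x r z| <= `|y - z|.
Proof.
apply: mx_norm_le => // i j; rewrite ord1 !mxE.
apply: le_trans (clamp_lipschitz _ _ _ _) _.
by have := mx_norm_entry (y - z) i 0; rewrite !mxE.
Qed.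

(** Precomposing with the retraction [clampE] onto a small cube makes a smooth function globally
    Lipschitz, as the hypothesis of [picard] demands. *)
Lemma smooth_local_BL (U : set E) (f : E -> R) x : open U -> smooth U f -> U x ->
  \forall r \near 0^'+, BL (f \o clampE x r).
Proof.
move=> Uo fs Ux; pose K := `|f x| + \sum_i `|'D_(e_ i) f x| + 1.
have nx : \forall y \near x, [/\ U y, `|f y| <= K & forall i : 'I_4, `|'D_(e_ i) f y| <= K].
  have c1 (h : E -> R) : {for x, continuous h} -> \forall y \near x, `|h y| <= `|h x| + 1.
    move=> /cvgrPdist_le/(_ 1 ltr01); apply: filterS => y hy.
    rewrite -[h y](subKr (h x)) (le_trans (ler_normB _ _))// lerD2l//.
  have fn := c1 _ (smooth_continuous fs Ux).
  have dn : \forall y \near x, forall i : 'I_4, `|'D_(e_ i) f y| <= `|'D_(e_ i) f x| + 1.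
    apply: (filter_forall (nbhs_filter x)) => i.
    exact: (c1 (fun y => 'D_(e_ i) f y) (smooth_continuous (smooth_derive (e_ i) fs) Ux)).
  apply: filterS3 (open_near Uo Ux) fn dn => y Uy fy dy; split=> // [|i].
    by rewrite (le_trans fy)// lerD2r lerDl sumr_ge0.
  rewrite (le_trans (dy i))// lerD2r (bigD1 i)//= addrCA lerDl addr_ge0//.
  by rewrite sumr_ge0.
move/nbhs_ballP : nx => [r0 /= r00 xr].
near=> r.
have r_gt0 : 0 < r by near: r; exact: nbhs_right_gt.
have rr0 : r < r0 by near: r; exact: nbhs_right_lt.
have inb y : `|y - x| <= r -> ball x r0 y.
  by move=> yr; rewrite -ball_normE /= distrC (le_lt_trans yr).
have K0 : 0 <= K by rewrite !addr_ge0// sumr_ge0.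
(* The factor 4 counts the partial derivatives. *)
exists (4 * K); split; first by rewrite mulr_ge0.
  move=> y /=; have [_ fK _] := xr _ (inb _ (clampE_in x y (ltW r_gt0))).
  by rewrite (le_trans fK)//; lra.
move=> y z; set a := clampE x r y; set b := clampE x r z.
have aB : `|a - x| <= r by exact: clampE_in (ltW r_gt0).
have bB : `|b - x| <= r by exact: clampE_in (ltW r_gt0).
have seg s : 0 <= s <= 1 -> `|b + s *: (a - b) - x| <= r.
  move=> /andP[s0 s1].
  have -> : b + s *: (a - b) - x = s *: (a - x) + (1 - s) *: (b - x).
    by apply/matrixP => i j; rewrite !mxE; ring.
  rewrite (le_trans (ler_normD _ _))// !normrZ !ger0_norm ?subr_ge0//.
  have : s * `|a - x| <= s * r by rewrite ler_wpM2l.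
  have : (1 - s) * `|b - x| <= (1 - s) * r by rewrite ler_wpM2l ?subr_ge0.
  by move=> *; lra.
have [|s] := @MVT_between R (fun s => f (b + s *: (a - b)))
    (fun s => 'D_(a - b) f (b + s *: (a - b))) 0 1.
  rewrite min_l// max_r// => s s01; apply: is_derive_line.
  by have [Us _ _] := xr _ (inb _ (seg s s01)); exact: smooth_derivable fs Us.
rewrite min_l// max_r// => s01; rewrite scale1r scale0r addr0 subrKC subr0 mulr1 => /= ->.
have [Us _ dK] := xr _ (inb _ (seg s s01)).
rewrite differentiable_deriveE; last exact: C1_differentiable (fs 1%N) Us.
rewrite (le_trans (ler_norm_sum _ _ _))//.
apply: (@le_trans _ _ (\sum_(i < 4) K * `|y - z|)); last first.
  by rewrite sumr_const card_ord -[leLHS]mulr_natl mulrA.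
apply: ler_sum => i _; rewrite normrM mulrC ler_pM//.
by rewrite (le_trans (mx_norm_entry _ _ _))//; exact: clampE_lipschitz.
Unshelve. all: by end_near. Qed.

Variables (U : set E) (G : E -> 'M[R]_4).
Hypotheses (Uo : open U) (Gs : smooth U G).
Hypothesis Gunit : forall x, U x -> G x \in unitmx.

(** Position and velocity are the two columns of a 4 x 2 matrix. The field is clamped in both, and
    time is slowed down by [d] to meet the constant of [picard]. *)
Lemma geodesic_ode (x0 w0 : E) : U x0 -> exists (d : R) (u w : R -> E),
  [/\ 0 < d, u 0 = x0, w 0 = w0 &
      forall t : R, -2 <= t <= 2 -> [/\ U (u t), is_derive t 1 u (d *: w t) &
        is_derive t 1 w (- (d *: (GamV G (u t) (w t) *m w t)))]].
Proof.
move=> Ux0.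
have [r [r0 rU rB]] : exists r : R, [/\ 0 < r,
    forall y, `|y - x0| <= r -> U y &
    forall abc : 'I_4 * 'I_4 * 'I_4,
      BL ((fun y => christoffel G y abc.1.1 abc.1.2 abc.2) \o clampE x0 r)].
  have rB : \forall r \near 0^'+, forall abc : 'I_4 * 'I_4 * 'I_4,
      BL ((fun y => christoffel G y abc.1.1 abc.1.2 abc.2) \o clampE x0 r).
    apply: filter_forall => abc; apply: smooth_local_BL Uo _ Ux0.
    exact: christoffel_smooth.
  have /nbhs_ballP[e /= e0 eU] := open_near Uo Ux0.
  near (0 : R)^'+ => r.
  have re : r < e by near: r; exact: nbhs_right_lt.
  exists r; split; last by near: r.
    by near: r; exact: nbhs_right_gt.
  by move=> y yr; apply: eU; rewrite -ball_normE /= distrC (le_lt_trans yr).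
pose cu (y : 'M[R]_(4, 2)) : E := \col_i y i 0.
pose cw (y : 'M[R]_(4, 2)) : E := clampE w0 1 (\col_i y i 1).
pose H (y : 'M[R]_(4, 2)) : 'M[R]_(4, 2) := \matrix_(i, j)
  if j == 0 then cw y i 0 else
  - \sum_b \sum_c christoffel G (clampE x0 r (cu y)) i b c * cw y b 0 * cw y c 0.
have cuL y z : `|cu y - cu z| <= `|y - z|.
  apply: mx_norm_le => // i j; rewrite !mxE.
  by have := mx_norm_entry (y - z) i 0; rewrite !mxE.
have cwB i : BL (fun y => cw y i 0).
  exists (`|w0| + 1); split; first by rewrite addr_ge0.
    move=> y; apply: le_trans (mx_norm_entry _ _ _) _.
    rewrite -[cw y](subrK w0) addrC (le_trans (ler_normD _ _))// lerD2l.
    exact: clampE_in.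
  move=> y z; have -> : cw y i 0 - cw z i 0 = (cw y - cw z) i 0 by rewrite !mxE.
  apply: le_trans (mx_norm_entry _ _ _) _.
  apply: le_trans (clampE_lipschitz _ _ _ _) _.
  apply: (@le_trans _ _ (1 * `|y - z|)); last by rewrite ler_wpM2r// lerDr.
  rewrite mul1r; apply: mx_norm_le => // k j; rewrite !mxE.
  by have := mx_norm_entry (y - z) k 1; rewrite !mxE.
have [K [K0 HK HL]] : exists K : R, [/\ 0 < K, forall y, `|H y| <= K &
                     forall y z, `|H y - H z| <= K * `|y - z|].
  apply: BL_mx => i j; under eq_fun do rewrite mxE.
  case: (j == 0); first exact: cwB.
  under eq_fun do rewrite -mulN1r; apply: BL_M; first exact: BL_cst.
  apply: BL_sum => b; apply: BL_sum => c; apply: BL_M; last exact: cwB.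
  apply: BL_M; last exact: cwB.
  have [k [k0 kB kL]] := rB (i, b, c); exists k; split=> // [y|y z].
    exact: kB.
  by apply: le_trans (kL _ _) _; rewrite ler_wpM2l.
(* The first bound gives the Lipschitz constant 1/4; the second keeps the solution within
   [Num.min r 1] of its start on [-2, 2], where both clamps act as the identity. *)
pose d : R := Num.min (4^-1 / K) (Num.min r 1 / (2 * K)).
have m0 : 0 < Num.min r 1 by rewrite lt_min r0 ltr01.
have d0 : 0 < d by rewrite lt_min !divr_gt0// ?mulr_gt0// invr_gt0.
have dK4 : d * K <= 4^-1.
  by rewrite -ler_pdivlMr// /d ge_min lexx.
have dKm : 2 * (d * K) <= Num.min r 1.
  have : d <= Num.min r 1 / (2 * K) by rewrite /d ge_min lexx orbT.
  by rewrite ler_pdivlMr ?mulr_gt0//; lra.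
pose y0 : 'M[R]_(4, 2) := \matrix_(i, j) if j == 0 then x0 i 0 else w0 i 0.
have [||y [y00 yd]] := @picard R 4 2 (fun _ y => d *: H y) _ _ y0.
- move=> _ y z; rewrite -scalerBr normrZ gtr0_norm//.
  apply: (@le_trans _ _ (d * (K * `|y - z|))); first by rewrite ler_wpM2l// ltW.
  by rewrite mulrA ler_wpM2r.
- move=> z zc t; apply/cvgrPdist_le => e e0.
  have /cvgrPdist_le/(_ _ e0) := zc t; apply: filterS => s zs.
  rewrite -scalerBr normrZ gtr0_norm//; apply: le_trans zs.
  apply: (@le_trans _ _ (d * (K * `|z t - z s|))); first by rewrite ler_wpM2l// ltW.
  by rewrite mulrA ler_piMl//; lra.
have yB (t : R) : -2 <= t <= 2 -> `|y t - y0| <= Num.min r 1.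
  move=> t2; have := @mx_MVT_le R 4 2 y (fun t => d *: H (y t)) 0 t (d * K).
  rewrite y00 => HH; apply: le_trans (HH _ _) _.
  - by move=> s s2; apply: yd; move: s2; have [] := leP 0 t => ? ?; lra.
  - by move=> s _; rewrite normrZ gtr0_norm// ler_wpM2l// ltW.
  - rewrite subr0; have : `|t| <= 2 by rewrite ler_norml.
    move: dKm (normr_ge0 t) (mulr_gt0 d0 K0) => *; nra.
have uB (t : R) : -2 <= t <= 2 -> `|cu (y t) - x0| <= r.
  move=> t2; apply: le_trans (_ : Num.min r 1 <= r); last by rewrite ge_min lexx.
  apply: mx_norm_le; first exact: ltW.
  move=> i j; have := le_trans (mx_norm_entry (y t - y0) i 0) (yB t t2).
  by rewrite ord1 !mxE.
have wB (t : R) : -2 <= t <= 2 -> cw (y t) = \col_i y t i 1.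
  move=> t2; apply: clampE_id; apply: le_trans (_ : Num.min r 1 <= 1); last first.
    by rewrite ge_min lexx orbT.
  apply: mx_norm_le; first exact: ltW.
  move=> i j; have := le_trans (mx_norm_entry (y t - y0) i 1) (yB t t2).
  by rewrite ord1 !mxE.
exists d, (fun t => cu (y t)), (fun t => \col_i y t i 1); split=> //.
- by apply/matrixP => i j; rewrite y00 ord1 !mxE.
- by apply/matrixP => i j; rewrite y00 ord1 !mxE.
move=> t t2; have /is_derive_mxP yd' := yd t t2; split; first exact: rU (uB t t2).
  apply/is_derive_mxP => i j; under eq_fun do rewrite mxE.
  by apply: (is_derive_eq (yd' i 0)); rewrite -wB// !mxE.
apply/is_derive_mxP => i j; under eq_fun do rewrite mxE.
apply: (is_derive_eq (yd' i 1)); rewrite -wB// -christoffel_appE.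
by rewrite ord1 !mxE /= clampE_id ?mulrN// uB.
Unshelve. all: by end_near. Qed.

(** The geodesic equation is quadratic in the velocity, so the slowed time is absorbed by taking
    [d *: w] as velocity. Smoothness is bootstrapped from the equation. *)
Lemma local_geodesic (x0 w0 : E) : U x0 -> exists (d : R) (u du : R -> E),
  [/\ 0 < d, u 0 = x0, du 0 = d *: w0, smooth `](-2 : R), 2[ u &
      forall t : R, -2 <= t <= 2 -> [/\ U (u t), is_derive t 1 u (du t) &
        is_derive t 1 du (- (GamV G (u t) (du t) *m du t))]].
Proof.
move=> /(geodesic_ode w0)[d [u [w [d0 u0 w00 uw]]]].
exists d, u, (fun t => d *: w t).
have dw (t : R) : -2 <= t <= 2 -> is_derive t 1 (fun t => d *: w t)
    (- (GamV G (u t) (d *: w t) *m (d *: w t))).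
  move=> t2; have [_ _ wd] := uw t t2.
  apply: (is_derive_eq (is_deriveZ d wd)).
  by rewrite GamVZ scalerN -scalemxAr -scalemxAl.
split=> //; first by rewrite w00.
  have Jo : open [set` `](-2 : R), 2[] by exact: interval_open.
  have J2 (t : R) : [set` `](-2 : R), 2[] t -> -2 <= t <= 2.
    by rewrite /= in_itv /= => /andP[? ?]; rewrite !ltW.
  suff H k : Ck k `](-2 : R), 2[ u /\ Ck k `](-2 : R), 2[ (fun t => d *: w t).
    by move=> k; exact: (H k).1.
  elim: k => [|k [IHu IHw]].
    split; (split; last by []) => t /J2 t2; last exact: is_derive_continuous (dw t t2).
    by have [_ ud _] := uw t t2; exact: is_derive_continuous ud.
  split; apply/Ck_curveP => //; split.
  - by move=> t /J2 t2; have [_ [ud _] _] := uw t t2.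
  - apply: Ck_ext IHw => // t /J2 t2; have [_ [_ uE] _] := uw t t2.
    by rewrite derive1E uE.
  - by move=> t /J2 t2; have [wd _] := dw t t2.
  - apply: (@Ck_ext _ _ _ _ _ (fun t => - (GamV G (u t) (d *: w t) *m (d *: w t)))) => //.
      by move=> t /J2 t2; have [_ wE] := dw t t2; rewrite derive1E wE.
    apply/Ck_mxP => // i j.
    rewrite (_ : (fun t => _) = (fun t => - \sum_b \sum_c
        (christoffel G (u t) i b c * (d *: w t) b 0 * (d *: w t) c 0))); last first.
      by apply/funext => t; rewrite -christoffel_appE ord1 !mxE.
    move/(Ck_mxP _ _ Jo) : IHw => IHw.
    apply: CkN => //; apply: Ck_sum => // b; apply: Ck_sum => // c.
    apply: CkM => //; apply: CkM => //.
    apply: (Ck_comp_curve (f := fun y => christoffel G y i b c) Jo Uo) IHu.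
      exact: christoffel_smooth.
    by move=> t /J2 t2; have [] := uw t t2.
by move=> t t2; have [Ut ud _] := uw t t2; split=> //; exact: dw.
Qed.

End LocalGeodesic.

(** * Geodesics and parallel fields across charts *)

Section ManifoldCharts.
#[local] Opaque derive.
Context {R : realType} {M : topologicalType} {X : manifold4 R M}.
Notation E := 'cV[R]_4.
Notation e_ c := (delta_mx c 0 : E).
Implicit Types (g : lorentz_metric X) (c : chart R M) (p : M).

Lemma open_setI_preimage (S T : topologicalType) (A : set S) (B : set T) (f : S -> T) :
  open A -> (forall x, A x -> {for x, continuous f}) -> open B ->
  open (A `&` f @^-1` B).
Proof.
move=> Ao fc Bo; rewrite openE => x [Ax Bfx].
apply: filterI; first exact: open_nbhs_nbhs.
by apply: (fc x Ax); exact: open_nbhs_nbhs.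
Qed.

Lemma cimg_cinv c x : cimg c x -> cdom c (cinv c x) /\ cmap c (cinv c x) = x.
Proof. by move=> [p cp <-]; rewrite (cmapK cp). Qed.

Lemma cmap_cimg c p : cdom c p -> cimg c (cmap c p).
Proof. by move=> cp; exists p. Qed.

Lemma cimg_isopen c : open (cimg c).
Proof. exact: cimg_open. Qed.
Arguments cimg_isopen c : clear implicits.

Definition overlap c c' : set E := cmap c @` (cdom c `&` cdom c').

Lemma overlapP c c' x : overlap c c' x <-> cimg c x /\ cdom c' (cinv c x).
Proof.
split=> [[p [cp cp'] <-]|[cx cx']].
  by split; [exact: cmap_cimg|rewrite (cmapK cp)].
by have [cp <-] := cimg_cinv cx; exists (cinv c x).
Qed.

Lemma overlap_open c c' : open (overlap c c').
Proof.
rewrite (_ : overlap c c' = cimg c `&` cinv c @^-1` cdom c').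
  apply: open_setI_preimage; [exact: cimg_isopen| |exact: cdom_open].
  by move=> x; exact: cinv_continuous.
by apply/seteqP; split=> x /overlapP.
Qed.
Arguments overlap_open c c' : clear implicits.

Lemma overlap_sub c c' : overlap c c' `<=` cimg c.
Proof. by move=> x /overlapP[]. Qed.

Lemma transition_cimg c c' x : overlap c c' x -> cimg c' (transition c c' x).
Proof. by move=> /overlapP[_]; exact: cmap_cimg. Qed.

Lemma transition_cmap c c' p : cdom c p -> transition c c' (cmap c p) = cmap c' p.
Proof. by move=> cp; rewrite /transition /= (cmapK cp). Qed.

Lemma chart_overlap c c' p : chart_at X c p -> chart_at X c' p ->
  overlap c c' (cmap c p).
Proof. by move=> [_ cp] [_ cp']; exists p. Qed.

Lemma transition_smooth c c' : atlas X c -> atlas X c' ->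
  smooth (overlap c c') (transition c c').
Proof. exact: atlas_compatible. Qed.

Lemma lorentz_unit (G : 'M[R]_4) : lorentz_signature G -> G \in unitmx.
Proof.
move=> [P Pu PG]; have : Defs.minkowski (R := R) \in unitmx.
  rewrite unitmxE det_diag unitfE; apply/prodf_neq0 => i _; rewrite mxE.
  by case: (i == 0); rewrite ?oppr_eq0 oner_eq0.
by rewrite -PG !unitmxE !det_mulmx !unitrM => /andP[/andP[]].
Qed.

Section MetricFacts.
Variable g : lorentz_metric X.

Lemma g_unit c : atlas X c -> forall x, cimg c x -> gcomp g c x \in unitmx.
Proof. by move=> ca x cx; apply: lorentz_unit; exact: gcomp_signature. Qed.

Lemma g_sym c : atlas X c -> forall x, cimg c x -> (gcomp g c x)^T = gcomp g c x.
Proof. by move=> ca x cx; exact: gcomp_sym. Qed.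

Lemma g_smooth c : atlas X c -> smooth (cimg c) (gcomp g c).
Proof. exact: gcomp_smooth. Qed.

Lemma g_pullback c c' : atlas X c -> atlas X c' -> forall x u v, overlap c c' x ->
  inner (gcomp g c x) u v = inner (gcomp g c' (transition c c' x))
    ('D_u (transition c c') x) ('D_v (transition c c') x).
Proof.
move=> ca ca' x u v [p [cp cp'] <-]; rewrite transition_cmap//.
exact: gcomp_tensor.
Qed.

Lemma jac_transition_unit c c' x : atlas X c -> atlas X c' -> overlap c c' x ->
  jac (transition c c') x \in unitmx.
Proof.
move=> ca ca'; exact: (jac_unit (overlap_open c c') (@overlap_sub c c')
  (transition_smooth ca ca') (g_unit ca) (g_pullback ca ca')).
Qed.

Lemma christoffel_transition c c' x u : atlas X c -> atlas X c' -> overlap c c' x ->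
  jac (transition c c') x *m GamV (gcomp g c) x u =
  'D_u (jac (transition c c')) x +
  GamV (gcomp g c') (transition c c' x) (jac (transition c c') x *m u) *m
    jac (transition c c') x.
Proof.
move=> ca ca'; exact: (christoffel_law (cimg_isopen c) (overlap_open c c')
  (cimg_isopen c') (@overlap_sub c c') (@transition_cimg c c')
  (transition_smooth ca ca') (g_smooth ca) (g_smooth ca') (g_sym ca) (g_unit ca)
  (g_sym ca') (g_unit ca') (g_pullback ca ca')).
Qed.

Lemma transport_transition c c' (u Z : R -> E) t du :
  atlas X c -> atlas X c' ->
  overlap c c' (u t) -> is_derive t 1 u du ->
  is_derive t 1 Z (- (GamV (gcomp g c) (u t) du *m Z t)) ->
  is_derive t 1 (fun s => jac (transition c c') (u s) *m Z s)
    (- (GamV (gcomp g c') (transition c c' (u t)) (jac (transition c c') (u t) *m du)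
        *m (jac (transition c c') (u t) *m Z t))).
Proof.
move=> ca ca'; exact: (transport_law (cimg_isopen c) (overlap_open c c')
  (cimg_isopen c') (@overlap_sub c c') (@transition_cimg c c')
  (transition_smooth ca ca') (g_smooth ca) (g_smooth ca') (g_sym ca) (g_unit ca)
  (g_sym ca') (g_unit ca') (g_pullback ca ca')).
Qed.

End MetricFacts.

Lemma transition_differentiable c c' x : atlas X c -> atlas X c' -> overlap c c' x ->
  differentiable (transition c c') x.
Proof.
move=> ca ca'.
exact: (phi_differentiable (overlap_open c c') (transition_smooth ca ca')).
Qed.

Lemma jac_cocycle c c1 c2 p : chart_at X c p -> chart_at X c1 p -> chart_at X c2 p ->
  jac (transition c c2) (cmap c p) =
  jac (transition c1 c2) (cmap c1 p) *m jac (transition c c1) (cmap c p).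
Proof.
move=> cp c1p c2p; apply/matrixP => i j.
have O1 := chart_overlap cp c1p; have O2 := chart_overlap c1p c2p.
have d1 := transition_differentiable cp.1 c1p.1 O1.
have d2 := transition_differentiable c1p.1 c2p.1 O2.
rewrite -(transition_cmap c1 cp.2) in d2 *.
have E1 : 'D_(e_ j) (transition c c2) (cmap c p) =
    jac (transition c1 c2) (transition c c1 (cmap c p)) *m
    (jac (transition c c1) (cmap c p) *m e_ j).
  rewrite -(jacE (e_ j) d1) -(jacE _ d2) -derive_chain//.
  apply: near_eq_derive.
  apply: filterS (open_near (overlap_open c c1) O1) => y /overlapP[_ y1].
  by rewrite /transition /= (cmapK y1).
by rewrite mulmxA -colE in E1; rewrite [LHS]mxE E1 mxE.
Qed.

Lemma jac_self c p : chart_at X c p -> jac (transition c c) (cmap c p) = 1%:M.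
Proof.
move=> cp; apply/matrixP => i j; rewrite mxE.
have -> : 'D_(e_ j) (transition c c) (cmap c p) = e_ j; last first.
  by rewrite !mxE eqxx andbT.
rewrite (@near_eq_derive _ _ _ _ id) ?derive_id//.
apply: filterS (open_near (cimg_isopen c) (cmap_cimg cp.2)) => y cy.
by rewrite /transition /=; have [] := cimg_cinv cy.
Qed.

(** The inhomogeneous term of the transformation law does not involve the metric and cancels between
    [g] and [g']. *)
Lemma connection_eq_chart g g' c c' p : chart_at X c p -> chart_at X c' p ->
  (forall u, GamV (gcomp g c') (cmap c' p) u = GamV (gcomp g' c') (cmap c' p) u) ->
  forall u, GamV (gcomp g c) (cmap c p) u = GamV (gcomp g' c) (cmap c p) u.
Proof.
move=> cp cp' H u; have O := chart_overlap cp cp'.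
have := christoffel_transition g' u cp.1 cp'.1 O.
rewrite (transition_cmap c' cp.2) -H -(transition_cmap c' cp.2).
rewrite -(christoffel_transition g u cp.1 cp'.1 O) => E1.
have Ju := jac_transition_unit g cp.1 cp'.1 O.
by rewrite -(mulKmx Ju (GamV (gcomp g c) _ _)) -E1 mulKmx.
Qed.

Section Curve.
Variables (c : chart R M) (J : set R) (u du : R -> E).
Hypotheses (ca : atlas X c) (Jo : open J).
Hypothesis uc : forall t, J t -> cimg c (u t).
Hypothesis ud : forall t, J t -> is_derive t 1 u (du t).

Lemma curve_continuous t : J t -> {for t, continuous (cinv c \o u)}.
Proof.
move=> Jt; apply: continuous_comp; first exact: is_derive_continuous (ud Jt).
by apply: cinv_continuous; exact: uc.
Qed.

Lemma curve_overlap_near c' t : J t -> cdom c' (cinv c (u t)) ->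
  \forall s \near t, J s /\ overlap c c' (u s).
Proof.
move=> Jt ct; have Jn : \forall s \near t, J s by exact: open_nbhs_nbhs.
have cn : \forall s \near t, cdom c' (cinv c (u s)).
  by apply: (curve_continuous Jt); apply: open_nbhs_nbhs; split=> //; exact: cdom_open.
apply: filterS2 Jn cn => s Js cs; split=> //; apply/overlapP; split=> //.
exact: uc.
Qed.

Lemma curve_smooth : smooth J u -> smooth_curve (X := X) J (cinv c \o u).
Proof.
move=> us; split; first exact: curve_continuous.
move=> c' ca'; set J' := J `&` _.
have Jo' : open J' by apply: open_setI_preimage => //; [exact: curve_continuous|exact: cdom_open].
have J'J : J' `<=` J by move=> t [].
rewrite -[cmap c' \o _]/(transition c c' \o u).
apply: (smooth_comp_curve (f := transition c c') Jo' (overlap_open c c')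
          (transition_smooth ca ca')).
  by move=> t [Jt ct]; apply/overlapP; split=> //; exact: uc.
by move=> k; exact: Ck_subset J'J (us k).
Qed.

Lemma curve_velocity c' t : J t -> chart_at X c' (cinv c (u t)) ->
  is_derive t 1 (cmap c' \o (cinv c \o u)) (jac (transition c c') (u t) *m du t).
Proof.
move=> Jt [ca' ct]; have O : overlap c c' (u t) by apply/overlapP; split=> //; exact: uc.
have d1 := transition_differentiable ca ca' O.
by rewrite -jacE//; exact: is_derive_chain d1 (ud Jt).
Qed.

(** [geodesic] quantifies over all charts met by the curve; [transport_transition], applied to the
    velocity itself, carries the equation from [c] to each of them. *)
Lemma geodesic_chart g : is_interval J -> smooth J u ->
  (forall t, J t -> is_derive t 1 du (- (GamV (gcomp g c) (u t) (du t) *m du t))) ->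
  geodesic g J (cinv c \o u).
Proof.
move=> Ji us dud; split=> //; first exact: curve_smooth.
move=> t c' Jt ct; rewrite /= christoffel_appE.
have O : overlap c c' (u t) by apply/overlapP; split; [exact: uc|exact: ct.2].
have vel s : J s -> overlap c c' (u s) ->
    derive1 (cmap c' \o (cinv c \o u)) s = jac (transition c c') (u s) *m du s.
  move=> Js /overlapP[_ cs]; rewrite derive1E.
  by have [_ ->] := curve_velocity Js (conj ct.1 cs).
have -> : derive1 (derive1 (cmap c' \o (cinv c \o u))) t =
    'D_1 (fun s => jac (transition c c') (u s) *m du s) t.
  rewrite derive1E; apply: near_eq_derive.
  by apply: filterS (curve_overlap_near Jt ct.2) => s [Js Os]; exact: vel.
have [_ ->] := transport_transition ca ct.1 O (ud Jt) (dud t Jt).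
by rewrite (vel t Jt O) addrC -[cmap c' (cinv c (u t))]/(transition c c' (u t)) subrr.
Qed.

End Curve.

(* The tangent vector at [p] with components [x] in [c], normalised to [0] in the charts
   that do not contain [p]: transports along consecutive curves compare such families
   for equality in all charts. *)
Definition tv p c (x : E) : chart R M -> E := fun c' =>
  if `[< chart_at X c' p >] then jac (transition c c') (cmap c p) *m x else 0.

Lemma tvE p c x c' : chart_at X c' p ->
  tv p c x c' = jac (transition c c') (cmap c p) *m x.
Proof. by move=> cp; rewrite /tv; case: asboolP. Qed.

Lemma tv_self p c x : chart_at X c p -> tv p c x c = x.
Proof. by move=> cp; rewrite tvE// jac_self// mul1mx. Qed.

Lemma tv_tangent p c x : chart_at X c p -> tangent X p (tv p c x).
Proof.
move=> cp c1 c2 c1p c2p; rewrite !tvE//.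
rewrite (jac_cocycle cp c1p c2p) jacE ?mulmxA//.
exact: transition_differentiable c1p.1 c2p.1 (chart_overlap c1p c2p).
Qed.

Lemma tv_change p c c1 x : chart_at X c p -> chart_at X c1 p ->
  tv p c x = tv p c1 (jac (transition c c1) (cmap c p) *m x).
Proof.
move=> cp c1p; apply/funext => c2; rewrite /tv; case: asboolP => // c2p.
by rewrite (jac_cocycle cp c1p c2p) mulmxA.
Qed.

Lemma parallel_chart g c (u du Z : R -> E) : atlas X c ->
  (forall t, cimg c (u t)) -> (forall t : R, is_derive t 1 u (du t)) ->
  (forall t : R, is_derive t 1 Z (- (GamV (gcomp g c) (u t) (du t) *m Z t))) ->
  parallel_along g (cinv c \o u) (fun t => tv (cinv c (u t)) c (Z t)).
Proof.
move=> ca uc ud Zd t.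
have cu s : cmap c (cinv c (u s)) = u s := (cimg_cinv (uc s)).2.
have ct : chart_at X c (cinv c (u t)) by split=> //; exact: (cimg_cinv (uc t)).1.
split=> [|c' c't]; first exact: tv_tangent.
rewrite /= tvE// cu christoffel_appE derive1E.
have uc' s : setT s -> cimg c (u s) by [].
have ud' (s : R) : setT s -> is_derive s 1 u (du s) by [].
have [_ ->] := curve_velocity ca uc' ud' I c't.
have O : overlap c c' (u t) by apply/overlapP; split; [exact: uc|exact: c't.2].
have := transport_transition ca c't.1 O (ud t) (Zd t).
rewrite -[transition c c' (u t)]/(cmap c' (cinv c (u t))).
apply: near_eq_is_derive.
apply: filterS (curve_overlap_near openT uc' ud' I c't.2) => s [_ /overlapP[_ cs]].
by rewrite tvE ?cu//; split=> //; exact: c't.1.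
Qed.

End ManifoldCharts.

Arguments cimg_isopen {R M} c.
Arguments overlap_open {R M} c c'.

(** * From equal geodesic paths to the form [psi] *)

Section ProjectivelyRelated.
#[local] Opaque derive.
Context {R : realType}.
Notation E := 'cV[R]_4.
Notation e_ c := (delta_mx c 0 : E).

(** Polarisation: [D(w, w)] is parallel to [w] for the basis vectors and for [e_i + e_j] and
    [e_i - e_j]; comparing components leaves only the two terms with [psi]. *)
Lemma quadratic_parallel (D : 'I_4 -> 'M[R]_4) :
  (forall c b, D c *m e_ b = D b *m e_ c) ->
  (forall w : E, exists k : R, (\sum_c w c 0 *: D c) *m w = k *: w) ->
  let psi : E := \col_c (5^-1 * \tr (D c)) in
  forall c, D c = e_ c *m psi^T + psi c 0 *: 1%:M.
Proof.
move=> Dsym Dpar.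
have sym a b c : D c a b = D b a c.
  by have /matrixP/(_ a 0) := Dsym c b; rewrite -!colE !mxE.
have par1 i a : a != i -> D i a i = 0.
  move=> ai; have [k /matrixP/(_ a 0)] := Dpar (e_ i).
  have -> : \sum_c (e_ i) c 0 *: D c = D i.
    rewrite (bigD1 i)//= mxE !eqxx scale1r big1 ?addr0// => c ci.
    by rewrite mxE (negbTE ci) scale0r.
  by rewrite -colE !mxE (negbTE ai) /= mulr0.
have par2 i j (s : R) : i != j -> exists k : R, forall a,
    D i a i + s * D i a j * 2 + s * s * D j a j = k * ((a == i)%:R + s * (a == j)%:R).
  move=> ij; have [k kE] := Dpar (e_ i + s *: e_ j); exists k => a.
  have -> : k * ((a == i)%:R + s * (a == j)%:R) = (k *: (e_ i + s *: e_ j)) a 0.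
    by rewrite !mxE !eqxx !andbT.
  rewrite -kE; have -> : \sum_c (e_ i + s *: e_ j) c 0 *: D c = D i + s *: D j.
    rewrite (bigD1 i)//= (bigD1 j) 1?eq_sym//= !mxE !eqxx (negbTE ij).
    rewrite [j == i]eq_sym (negbTE ij) /= mulr0 mulr1 addr0 add0r scale1r.
    rewrite big1 ?addr0// => c /andP[ci cj].
    by rewrite !mxE (negbTE ci) (negbTE cj) /= mulr0 addr0 scale0r.
  rewrite mulmxDl !mulmxDr -!scalemxAl -!scalemxAr -!colE !mxE (sym a i j).
  by ring.
(* In the target form [D c c c] equals [2 psi_c]. *)
pose ps c := D c c c / 2.
have three i j : i != j ->
    (forall a, a != i -> a != j -> D i a j = 0) /\ D i j j = ps i.
  move=> ij; have [k1 H1] := par2 i j 1 ij; have [k2 H2] := par2 i j (-1) ij.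
  have ji : (j == i) = false by rewrite eq_sym (negbTE ij).
  have P1 : D i j i = 0 by apply: par1; rewrite eq_sym.
  have P2 : D j i j = 0 by apply: par1.
  split=> [a ai aj|].
    have := H1 a; rewrite (negbTE ai) (negbTE aj) (par1 i a ai) (par1 j a aj).
    by rewrite /= !(mulr0n, mulr1n, mulr0, mulr1, mul1r, addr0, add0r); lra.
  have := H1 i; have := H1 j; have := H2 i; have := H2 j.
  rewrite !eqxx ji (negbTE ij) /ps P1 P2 /=.
  by rewrite !(mulr0n, mulr1n, mulr0, mulr1, mul1r, addr0, add0r); lra.
have DE c a b : D c a b = (a == c)%:R * ps b + ps c * (a == b)%:R.
  have [<-{b}|cb] := eqVneq c b.
    have [->|ac] := eqVneq a c; last by rewrite par1// mul0r mulr0 addr0.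
    by rewrite mul1r mulr1 /ps; lra.
  have [-> |ac] := eqVneq a c.
    rewrite (negbTE cb) sym; have [|_ ->] := three b c; first by rewrite eq_sym.
    by rewrite mul1r mulr0 addr0.
  rewrite mul0r add0r; have [H1 H2] := three c b cb.
  have [->|ab] := eqVneq a b; first by rewrite H2 mulr1.
  by rewrite H1// mulr0.
have trD c : 5^-1 * \tr (D c) = ps c.
  rewrite /mxtrace; under eq_bigr do rewrite DE eqxx mulr1.
  rewrite big_split /= (bigD1 c)//= eqxx mul1r big1 => [|a ac]; last first.
    by rewrite (negbTE ac) mul0r.
  by rewrite sumr_const card_ord -[ps c *+ 4]mulr_natr; field.
move=> psi c; apply/matrixP => a b; rewrite DE !mxE big_ord1 !mxE !trD.
by rewrite eqxx andbT.
Qed.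

Context {M : topologicalType} {X : manifold4 R M}.
Variables (g g' : lorentz_metric X).
Hypothesis gg' : projectively_related g g'.

(** A geodesic of [g] through [x] in direction [w] becomes a geodesic of [g'] after a change of
    parameter. Comparing the two equations at [x] leaves the second derivative of that change, which
    multiplies [w]. *)
Lemma projective_quadratic c x (w : E) : atlas X c -> cimg c x ->
  exists k : R, (GamV (gcomp g' c) x w - GamV (gcomp g c) x w) *m w = k *: w.
Proof.
move=> ca cx.
have [d [u [du [d0 u0 du0 us uw]]]] :=
  local_geodesic (cimg_isopen c) (g_smooth g ca) (g_unit g ca) w cx.
pose J := [set` `](-2 : R), 2[].
have J2 (t : R) : J t -> -2 <= t <= 2.
  by rewrite /J /= in_itv /= => /andP[? ?]; rewrite !ltW.
have Jo : open J by exact: interval_open.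
have Ji : is_interval J by exact: interval_is_interval.
have uc t : J t -> cimg c (u t) by move=> /J2/uw[].
have ud t : J t -> is_derive t 1 u (du t) by move=> /J2/uw[].
have dud t : J t -> is_derive t 1 du (- (GamV (gcomp g c) (u t) (du t) *m du t)).
  by move=> /J2/uw[].
have geo := geodesic_chart ca Jo uc ud Ji us dud.
have path : geodesic_path g J (cinv c \o u).
  exists J, id; split; last exact: geo.
  split=> //; last by rewrite image_id.
    move=> k; elim: k => [|k _]; first by split=> // t _; exact: cvg_id.
    split=> [t _|v]; first exact: cvg_id.
    split=> [t _|]; first exact: derivable_id.
    by under eq_fun do rewrite derive_id; exact: Ck_cst.
  by move=> t _; rewrite derive1_id oner_eq0.
have [J' [h [[Jo' Ji' hs h0 hJ] [_ _ _ geo']]]] := (gg' J (cinv c \o u)).1 path.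
have J0 : J 0 by rewrite /J /= in_itv /=; apply/andP; split; lra.
have [t0 Jt0 ht0] : exists2 t, J' t & h t = 0 by rewrite -hJ in J0; case: J0 => t; exists t.
have hJ' t : J' t -> J (h t) by move=> Jt; rewrite -hJ; exists t.
have ct0 : chart_at X c (((cinv c \o u) \o h) t0).
  by split=> //=; rewrite ht0; exact: (cimg_cinv (uc 0 J0)).1.
have := geo' t0 c Jt0 ct0; rewrite /= christoffel_appE.
set v := cmap c \o _.
have vE t : J' t -> v t = u (h t).
  by move=> /hJ'/uc ct; rewrite /v /=; exact: (cimg_cinv ct).2.
have hd t : J' t -> is_derive t 1 h (derive1 h t).
  by move=> Jt; rewrite derive1E; apply: derivableP; exact: smooth_derivable hs Jt.
have J'n t : J' t -> \forall s \near t, J' s by move=> Jt; exact: open_nbhs_nbhs.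
have v'E t : J' t -> derive1 v t = derive1 h t *: du (h t).
  move=> Jt; rewrite derive1E (@near_eq_derive _ _ _ _ (u \o h)); last first.
    by apply: filterS (J'n t Jt) => s; exact: vE.
  by have [_ ->] := is_derive_comp1 (ud _ (hJ' _ Jt)) (hd t Jt).
have hd2 : is_derive t0 1 (derive1 h) ('D_1 (fun t => 'D_1 h t) t0).
  have -> : derive1 h = (fun t => 'D_1 h t) by apply/funext => t; rewrite derive1E.
  by apply: derivableP; exact: smooth_derivable (smooth_derive (1 : R) hs) Jt0.
have -> : derive1 (derive1 v) t0 = 'D_1 (fun t => derive1 h t *: du (h t)) t0.
  rewrite derive1E; apply: near_eq_derive.
  by apply: filterS (J'n t0 Jt0) => s; exact: v'E.
have [_ ->] := is_derive_scale hd2 (is_derive_comp1 (dud _ (hJ' _ Jt0)) (hd t0 Jt0)).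
rewrite (v'E t0 Jt0) (cimg_cinv (uc _ (hJ' _ Jt0))).2 /= ht0 u0 du0.
set a := derive1 h t0; set b := 'D_1 _ t0; have a0 : a != 0 := h0 t0 Jt0.
rewrite !GamVZ -!scalemxAl -!scalemxAr !scalemxAl !scalerN !scalerA => H.
(* Here [a] and [b] are the first two derivatives of the parameter change and [d] is the speed
   scale: the equation reads [(a d)^2 (Gamma' - Gamma)(w, w) = - b d w]. *)
exists (- (b * d) / (a * a * (d * d))).
have ad0 : a * a * (d * d) != 0 by rewrite !mulf_neq0// gt_eqF.
rewrite -!scalemxAl in H; rewrite mulmxBl.
move: H; move: (GamV _ _ _ *m w) (GamV _ _ _ *m w) => Y Z /matrixP H.
apply/matrixP => i j; have := H i j; rewrite !mxE => Hij; apply: (mulfI ad0).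
rewrite [RHS]mulrA [X in _ = X * _]mulrC divfK//.
apply/eqP; rewrite -subr_eq0; apply/eqP.
by rewrite -[RHS]Hij; ring.
Qed.

Lemma projective_Gam c x i : atlas X c -> cimg c x -> Gam (gcomp g' c) x i =
  Gam (gcomp g c) x i + (e_ i *m (proj_form (gcomp g c) (gcomp g' c) x)^T +
    proj_form (gcomp g c) (gcomp g' c) x i 0 *: 1%:M).
Proof.
move=> ca cx.
have := @quadratic_parallel (fun i => Gam (gcomp g' c) x i - Gam (gcomp g c) x i).
move=> /(_ _ _)/(_ _) H; rewrite -H ?subrKC// => {H} [a b|w].
  rewrite !mulmxBl (Gam_sym (cimg_isopen c) (g_sym g ca) a b cx).
  by rewrite (Gam_sym (cimg_isopen c) (g_sym g' ca) a b cx).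
have [k kE] := projective_quadratic w ca cx; exists k.
rewrite -kE /GamV -sumrB; congr (_ *m _).
by apply: eq_bigr => b _; rewrite scalerBr.
Qed.

End ProjectivelyRelated.

(** * Parallel transport along coordinate segments *)

Section Segments.
#[local] Opaque derive.
Context {R : realType}.
Notation E := 'cV[R]_4.
Notation e_ c := (delta_mx c 0 : E).

(* A segment is traversed as [x + ramp a t *: v], which is smooth for all [t] and stays
   in the chart, as the smooth curves on the whole line of a path must. *)
Definition ramp (a t : R) : R := a * sin (pi / 2 * t).
Definition coramp (a t : R) : R := a * cos (pi / 2 * t).

Lemma is_derive_ramp (a t : R) : is_derive t 1 (ramp a) (coramp (a * (pi / 2)) t).
Proof.
have H := is_derive_comp1 (is_derive_sin (pi / 2 * t)) (is_derive_mull (pi / 2) t).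
apply: (is_derive_eq (is_deriveM (is_derive_cst a t 1) H)).
by rewrite scaler0 addr0 /cst /GRing.scale /= /coramp; ring.
Qed.

Lemma is_derive_coramp (a t : R) : is_derive t 1 (coramp a) (ramp (- (a * (pi / 2))) t).
Proof.
have H := is_derive_comp1 (is_derive_cos (pi / 2 * t)) (is_derive_mull (pi / 2) t).
apply: (is_derive_eq (is_deriveM (is_derive_cst a t 1) H)).
by rewrite scaler0 addr0 /cst /GRing.scale /= /ramp; ring.
Qed.

Lemma ramp_smooth a : smooth setT (ramp a) /\ smooth setT (coramp a).
Proof.
suff H k : forall a, Ck k setT (ramp a) /\ Ck k setT (coramp a).
  by split=> k; have [] := H k a.
elim: k => [|k IH] {}a.
  split; split=> // t _.
    exact: is_derive_continuous (is_derive_ramp a t).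
  exact: is_derive_continuous (is_derive_coramp a t).
split; split=> [t _|v].
- exact: is_derive_continuous (is_derive_ramp a t).
- have D t : derivable (ramp a) t v /\ 'D_v (ramp a) t = v * coramp (a * (pi / 2)) t.
    have [rd rE] := is_derive_ramp a t; have [? ->] := derive1_derive v rd.
    by rewrite rE.
  split=> [t _|]; first exact: (D t).1.
  apply: (@Ck_ext _ _ _ _ _ (fun t => v * coramp (a * (pi / 2)) t)).
  - exact: openT.
  - by move=> t _; rewrite (D t).2.
  - by apply: CkM; [exact: openT|exact: Ck_cst|exact: (IH _).2].
- exact: is_derive_continuous (is_derive_coramp a t).
- have D t : derivable (coramp a) t v /\
      'D_v (coramp a) t = v * ramp (- (a * (pi / 2))) t.
    have [rd rE] := is_derive_coramp a t; have [? ->] := derive1_derive v rd.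
    by rewrite rE.
  split=> [t _|]; first exact: (D t).1.
  apply: (@Ck_ext _ _ _ _ _ (fun t => v * ramp (- (a * (pi / 2))) t)).
  - exact: openT.
  - by move=> t _; rewrite (D t).2.
  - by apply: CkM; [exact: openT|exact: Ck_cst|exact: (IH _).1].
Qed.

Lemma ramp0 a : ramp a 0 = 0.
Proof. by rewrite /ramp mulr0 sin0 mulr0. Qed.

Lemma ramp1 a : ramp a 1 = a.
Proof. by rewrite /ramp mulr1 sin_pihalf mulr1. Qed.

Lemma coramp0 a : coramp a 0 = a.
Proof. by rewrite /coramp mulr0 cos0 mulr1. Qed.

Lemma coramp1 a : coramp a 1 = 0.
Proof. by rewrite /coramp mulr1 cos_pihalf mulr0. Qed.

Lemma ramp_le a t : `|ramp a t| <= `|a|.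
Proof.
by rewrite /ramp normrM ler_piMr// ler_norml sin_geN1 sin_le1.
Qed.

Lemma coramp_le a t : `|coramp a t| <= `|a|.
Proof.
by rewrite /coramp normrM ler_piMr// ler_norml cos_geN1 cos_le1.
Qed.

(* The numerical bound is the contraction condition of [linear_ode]. *)
Definition good_segment (U : set E) (G : E -> 'M[R]_4) (x v : E) : Prop :=
  forall s : R, -2 <= s <= 2 ->
    U (x + s *: v) /\ 4 * `|GamV G (x + s *: v) v| <= 4^-1.

Lemma GamV_norm G x v (K : R) : (forall c, `|Gam G x c| <= K) ->
  `|GamV G x v| <= 4 * K * `|v|.
Proof.
move=> GK; rewrite /GamV (le_trans (ler_norm_sum _ _ _))//.
apply: (@le_trans _ _ (\sum_(c < 4) K * `|v|)).
  apply: ler_sum => c _; rewrite normrZ mulrC ler_pM//.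
  exact: mx_norm_entry.
by rewrite sumr_const card_ord -[leLHS]mulr_natl mulrA.
Qed.

Section OnDomain.
Variables (U : set E) (G : E -> 'M[R]_4).
Hypotheses (Uo : open U) (Gs : smooth U G).
Hypothesis Gunit : forall x, U x -> G x \in unitmx.

Lemma continuous_near_le m n (f : E -> 'M[R]_(m, n)) x : {for x, continuous f} ->
  \forall y \near x, `|f y| <= `|f x| + 1.
Proof.
move=> /cvgrPdist_le/(_ 1 ltr01); apply: filterS => y hy.
by rewrite -[f y](subKr (f x)) (le_trans (ler_normB _ _))// lerD2l.
Qed.

Lemma Gam_locally_bounded x : U x -> exists r K : R, [/\ 0 < r, 0 <= K &
  forall y, `|y - x| < r -> U y /\ forall c, `|Gam G y c| <= K].
Proof.
move=> Ux; pose K := \sum_c (`|Gam G x c| + 1).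
have n1 : \forall y \near x, forall c : 'I_4, `|Gam G y c| <= `|Gam G x c| + 1.
  apply: (filter_forall (nbhs_filter x)) => c; apply: continuous_near_le.
  exact: smooth_continuous (Gam_smooth Uo Gs Gunit c) Ux.
have : \forall y \near x, U y /\ forall c : 'I_4, `|Gam G y c| <= `|Gam G x c| + 1.
  by apply: filterS2 (open_near Uo Ux) n1 => y; split.
move=> /nbhs_ballP[r /= r0 rP].
have K0 : 0 <= K by apply: sumr_ge0 => c _; rewrite addr_ge0.
exists r, K; split=> // y yr; have [|Uy H] := rP y; first by rewrite -ball_normE/= distrC.
split=> // c; rewrite (le_trans (H c))// /K (bigD1 c)//= lerDl.
by apply: sumr_ge0 => d _; rewrite addr_ge0.
Qed.

Lemma good_segment_near x : U x -> exists2 r : R, 0 < r &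
  forall v, `|v| <= r -> good_segment U G x v.
Proof.
move=> /Gam_locally_bounded[r [K [r0 K0 rP]]].
(* As [|s|] reaches 2, the length [r / 3] keeps the segment inside the ball; 64 combines the factors
   4 of [GamV_norm] and of [good_segment] with the bound 1/4. *)
pose e := Num.min (r / 3) (1 / (64 * (K + 1))).
have e0 : 0 < e by rewrite lt_min !divr_gt0// mulr_gt0// ltr_wpDl.
exists e => // v; rewrite le_min => /andP[v1 v2] s s2.
have [|Us sK] := rP (x + s *: v).
  rewrite addrC addKr normrZ; have : `|s| <= 2 by rewrite ler_norml.
  by move: (normr_ge0 s) (normr_ge0 v) => *; nra.
split=> //; have := GamV_norm v sK.
move: v2; rewrite ler_pdivlMr ?mulr_gt0 ?ltr_wpDl// => v2.
by move: (normr_ge0 v) => *; nra.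
Qed.

(** The inverse [Q] has its own equation, solved in transposed form because [linear_ode] multiplies
    from the left; the product [Q T] is then constant. *)
Lemma line_transport x v : good_segment U G x v ->
  exists T Q : R -> 'M[R]_4, [/\ T 0 = 1%:M, Q 0 = 1%:M &
    forall s : R, -2 <= s <= 2 ->
    [/\ is_derive s 1 T (- GamV G (x + s *: v) v *m T s),
        is_derive s 1 Q (Q s *m GamV G (x + s *: v) v),
        Q s *m T s = 1%:M & T s *m Q s = 1%:M]].
Proof.
move=> xv; pose B s := GamV G (x + s *: v) v.
have Bc (s : R) : -2 <= s <= 2 -> {for s, continuous B}.
  move=> /xv[Us _].
  apply: (@continuous_comp _ _ _ (fun s : R => x + s *: v) (fun y => GamV G y v)).
    by apply: cvgD; [exact: cvg_cst|exact: scalel_continuous].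
  exact: smooth_continuous (GamV_smooth Uo Gs Gunit v) Us.
have [|||T [T0 Td]] := @linear_ode R 4 4 (fun s => - B s) (fun=> 0) _ _ _ 1%:M.
- by move=> t t2; apply: cvgN; exact: Bc.
- by move=> t _; exact: cst_continuous.
- by move=> t /xv[_]; rewrite normrN.
have [|||Q [Q0 Qd]] := @linear_ode R 4 4 (fun s => (B s)^T) (fun=> 0) _ _ _ 1%:M.
- move=> t t2; apply/continuous_mxP => i j.
  have -> : (fun y => (B y)^T i j) = (fun y => B y j i) by apply/funext => y; rewrite mxE.
  by have /continuous_mxP := Bc t t2; exact.
- by move=> t _; exact: cst_continuous.
- by move=> t /xv[_]; apply: le_trans; rewrite ler_wpM2l// trmx_norm.
have Td' (s : R) : -2 <= s <= 2 -> is_derive s 1 T (- B s *m T s).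
  by move=> s2; have := Td s s2; rewrite addr0.
have Qd' (s : R) : -2 <= s <= 2 -> is_derive s 1 (fun s => (Q s)^T) ((Q s)^T *m B s).
  move=> s2; apply: (is_derive_eq (is_derive_trmx (Qd s s2))).
  by rewrite addr0 trmx_mul trmxK.
have QT (s : R) : -2 <= s <= 2 -> (Q s)^T *m T s = 1%:M.
  move=> s2.
  have <- : (Q 0)^T *m T 0 = 1%:M by rewrite T0 Q0 trmx1 mulmx1.
  apply: (mx_is_derive0_cst (f := fun s => (Q s)^T *m T s)) => t ts.
  have t2 : -2 <= t <= 2 by move: ts; have [] := leP 0 s => ? ?; lra.
  apply: (is_derive_eq (is_derive_mulmx (Qd' t t2) (Td' t t2))).
  by rewrite mulNmx mulmxN mulmxA subrr.
exists T, (fun s => (Q s)^T); split=> //; first by rewrite Q0 trmx1.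
by move=> s s2; split; [exact: Td'|exact: Qd'|exact: QT|exact: mulmx1C (QT s s2)].
Qed.

End OnDomain.
End Segments.

(** * Transport between points and connectedness *)

Section Transport.
#[local] Opaque derive.
Context {R : realType} {M : topologicalType} {X : manifold4 R M}.
Notation E := 'cV[R]_4.
Variable g : lorentz_metric X.
Implicit Types (c : chart R M) (p q : M) (T : 'M[R]_4).
Local Notation tv := (tv (X := X)).

Definition transp (s : seq (R -> M)) p c q c' T : Prop :=
  piecewise_smooth_path (X := X) p s q /\
  forall z, parallel_transport g s (tv p c z) (tv q c' (T *m z)).

Lemma path_cat s1 s2 p q r : piecewise_smooth_path (X := X) p s1 q ->
  piecewise_smooth_path (X := X) q s2 r -> piecewise_smooth_path (X := X) p (s1 ++ s2) r.
Proof.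
elim: s1 p => [|gam s1 IH] p /=; first by move=> ->.
by move=> [gs g0 H] H2; split=> //; exact: IH.
Qed.

Lemma transport_cat s1 s2 u v w : parallel_transport g s1 u v ->
  parallel_transport g s2 v w -> parallel_transport g (s1 ++ s2) u w.
Proof.
elim: s1 u => [|gam s1 IH] u /=; first by move=> ->.
by move=> [Y [Yp Y0 H]] H2; exists Y; split=> //; exact: IH.
Qed.

Lemma transp_cat s1 s2 p c q c' r c'' T1 T2 :
  transp s1 p c q c' T1 -> transp s2 q c' r c'' T2 ->
  transp (s1 ++ s2) p c r c'' (T2 *m T1).
Proof.
move=> [P1 H1] [P2 H2]; split; first exact: path_cat P1 P2.
by move=> z; rewrite -mulmxA; exact: transport_cat (H1 z) (H2 _).
Qed.

Lemma transp_nil p c : transp [::] p c p c 1%:M.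
Proof. by split=> // z; rewrite mul1mx. Qed.

(** A way back is part of the data, so that no path ever has to be reversed. *)
Definition linked p c q c' T : Prop := [/\ T \in unitmx,
  exists s, transp s p c q c' T & exists s, transp s q c' p c (invmx T)].

Lemma linked_refl p c : linked p c p c 1%:M.
Proof.
split; [exact: unitmx1|exists [::]; exact: transp_nil|].
by exists [::]; rewrite invmx1; exact: transp_nil.
Qed.

Lemma linked_sym p c q c' T : linked p c q c' T -> linked q c' p c (invmx T).
Proof. by case=> Tu s1 s2; split=> //; rewrite ?unitmx_inv// invmxK. Qed.

Lemma linked_trans p c q c' r c'' T1 T2 : linked p c q c' T1 ->
  linked q c' r c'' T2 -> linked p c r c'' (T2 *m T1).
Proof.
move=> [u1 [s1 H1] [s1' H1']] [u2 [s2 H2] [s2' H2']].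
split; first by rewrite unitmx_mul u2.
  by exists (s1 ++ s2); exact: transp_cat H1 H2.
by exists (s2' ++ s1'); rewrite invmx_mulmx//; exact: transp_cat H2' H1'.
Qed.

(** A change of chart is transport along the empty path, since [tv_change] makes the two component
    families equal. *)
Lemma linked_chart p c q c' c'' T : chart_at X c' q -> chart_at X c'' q ->
  linked p c q c' T -> linked p c q c'' (jac (transition c' c'') (cmap c' q) *m T).
Proof.
move=> cq cq'' L; apply: linked_trans L _; set J := jac _ _.
have Ju : J \in unitmx.
  exact: (jac_transition_unit g cq.1 cq''.1 (chart_overlap cq cq'')).
split=> //; exists [::]; split=> // z /=.
  by rewrite (tv_change _ cq cq'').
by rewrite [RHS](tv_change _ cq cq'') mulmxA mulmxV// mul1mx.
Qed.

(** The way out and the way back close a loop at [q] up to a loop at [p]. *)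
Lemma loop_holonomy p c q c' T s H : chart_at X c p -> linked p c q c' T ->
  transp s q c' q c' H -> holonomy_group g p c (invmx T *m H *m T).
Proof.
move=> cp [Tu [s1 H1] [s2 H2]] Hs.
have [P1 Q1] := transp_cat (transp_cat H1 Hs) H2.
exists ((s1 ++ s) ++ s2) => // z; exists (tv p c z), (tv p c (invmx T *m H *m T *m z)).
split; [exact: tv_tangent| |exact: tv_self|exact: tv_self].
by have := Q1 z; rewrite !mulmxA.
Qed.

Section Segment.
Variables (c : chart R M) (x v : E) (T Q : R -> 'M[R]_4).
Hypothesis ca : atlas X c.
Hypothesis xv : good_segment (cimg c) (gcomp g c) x v.
Hypotheses (T0 : T 0 = 1%:M).
Hypothesis TQ : forall s : R, -2 <= s <= 2 ->
    [/\ is_derive s 1 T (- GamV (gcomp g c) (x + s *: v) v *m T s),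
        is_derive s 1 Q (Q s *m GamV (gcomp g c) (x + s *: v) v),
        Q s *m T s = 1%:M & T s *m Q s = 1%:M].

(** The parameter change is arbitrary, so that [ramp] can serve the way out and [coramp] the way
    back. *)
Lemma segment_curve (phi dphi : R -> R) (z : E) : smooth setT phi ->
  (forall t : R, is_derive t 1 phi (dphi t)) -> (forall t, `|phi t| <= 1) ->
  smooth_curve (X := X) setT (fun t => cinv c (x + phi t *: v)) /\
  parallel_along g (fun t => cinv c (x + phi t *: v))
    (fun t => tv (cinv c (x + phi t *: v)) c (T (phi t) *m z)).
Proof.
move=> phis phid phi1.
have phi2 t : -2 <= phi t <= 2.
  by have := phi1 t; rewrite ler_norml => /andP[? ?]; apply/andP; split; lra.
pose u t : E := x + phi t *: v.
have uc t : cimg c (u t) := (xv (phi2 t)).1.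
have ud (t : R) : is_derive t 1 u (dphi t *: v).
  apply: (is_derive_eq (is_deriveD (is_derive_cst x t 1)
    (is_derive_scale (phid t) (is_derive_cst v t 1)))).
  by rewrite scaler0 addr0 add0r.
split.
  apply: (curve_smooth ca openT (fun t _ => uc t) (fun t _ => ud t)).
  apply/smooth_mxP => [|i j k]; first exact: openT.
  rewrite (_ : (fun t => _) = (fun t => x i j + phi t * v i j)); last first.
    by apply/funext => t; rewrite !mxE.
  apply: CkD; [exact: openT|exact: Ck_cst|].
  by apply: CkM; [exact: openT|exact: phis|exact: Ck_cst].
apply: (parallel_chart ca uc ud) => t.
have [Td _ _ _] := TQ (phi2 t).
apply: (is_derive_eq (is_derive_mulmxr z (is_derive_comp1 Td (phid t)))).
by rewrite -scalemxAl mulNmx mulNmx scalerN GamVZ -!scalemxAl mulmxA.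
Qed.

Lemma segment_forward a : `|a| <= 1 -> exists s,
  transp s (cinv c x) c (cinv c (x + a *: v)) c (T a).
Proof.
move=> a1; exists [:: (fun t => cinv c (x + ramp a t *: v))].
have H z := segment_curve z (ramp_smooth a).1 (is_derive_ramp a)
  (fun t => le_trans (ramp_le a t) a1).
split=> [|z] /=.
  by split; [exact: (H 0).1|rewrite ramp0 scale0r addr0|rewrite ramp1].
exists (fun t => tv (cinv c (x + ramp a t *: v)) c (T (ramp a t) *m z)).
split; first exact: (H z).2.
  by rewrite ramp0 scale0r addr0 T0 mul1mx.
by rewrite ramp1.
Qed.

Lemma segment_backward a : `|a| <= 1 -> exists s,
  transp s (cinv c (x + a *: v)) c (cinv c x) c (Q a).
Proof.
move=> a1; exists [:: (fun t => cinv c (x + coramp a t *: v))].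
have H z := segment_curve z (ramp_smooth a).2 (is_derive_coramp a)
  (fun t => le_trans (coramp_le a t) a1).
have a2 : -2 <= a <= 2.
  by move: a1; rewrite ler_norml => /andP[? ?]; apply/andP; split; lra.
split=> [|z] /=.
  by split; [exact: (H 0).1|rewrite coramp0|rewrite coramp1 scale0r addr0].
exists (fun t => tv (cinv c (x + coramp a t *: v)) c (T (coramp a t) *m (Q a *m z))).
split; first exact: (H (Q a *m z)).2.
  by have [_ _ _ TQ1] := TQ a2; rewrite coramp0 mulmxA TQ1 mul1mx.
by rewrite coramp1 scale0r addr0 T0 mul1mx.
Qed.

Lemma segment_linked a : `|a| <= 1 ->
  linked (cinv c x) c (cinv c (x + a *: v)) c (T a).
Proof.
move=> a1; have a2 : -2 <= a <= 2.
  by move: a1; rewrite ler_norml => /andP[? ?]; apply/andP; split; lra.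
have [_ _ QT1 TQ1] := TQ a2.
have [Tu _] := mulmx1_unit TQ1; split=> //; first exact: segment_forward.
have -> : invmx (T a) = Q a by rewrite -[LHS]mulmx1 -TQ1 mulKmx.
exact: segment_backward.
Qed.

End Segment.

Lemma linked_near p c : chart_at X c p ->
  \forall q \near p, cdom c q /\ exists T, linked p c q c T.
Proof.
move=> [ca cp]; have cx := cmap_cimg cp.
have [r r0 rP] := good_segment_near (cimg_isopen c) (g_smooth g ca) (g_unit g ca) cx.
have n1 : \forall q \near p, cdom c q by apply: open_nbhs_nbhs; split=> //; exact: cdom_open.
have n2 : \forall q \near p, `|cmap c p - cmap c q| <= r.
  by have /cvgrPdist_le/(_ _ r0) := cmap_continuous cp.
apply: filterS2 n1 n2 => q cq qr; split=> //.
have qr' : `|cmap c q - cmap c p| <= r by rewrite distrC.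
have [T [Q [T0 _ TQ]]] := line_transport (cimg_isopen c) (g_smooth g ca) (g_unit g ca)
  (rP _ qr').
exists (T 1); have := segment_linked ca (rP _ qr') T0 TQ (a := 1).
by rewrite normr1 lexx scale1r subrKC !cmapK//; exact.
Qed.

Lemma all_linked p0 c0 : chart_at X c0 p0 ->
  forall q c, chart_at X c q -> exists T, linked p0 c0 q c T.
Proof.
move=> cp0.
pose B := [set q | exists c T, chart_at X c q /\ linked p0 c0 q c T].
have BT : B = setT.
  (* Membership in [B] is constant near every point; this yields both openness and closedness. *)
  have Bnear q : exists2 N, nbhs q N & forall q', N q' -> (B q <-> B q').
    have [c ca cq] := atlas_cover X q.
    have cq' : chart_at X c q by split.
    eexists; first exact: (linked_near cq').
    move=> q' /= [cq1 [T L]]; have cq1' : chart_at X c q' by split.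
    split=> [[c1 [T1 [c1q L1]]]|[c1 [T1 [c1q L1]]]].
      exists c, (T *m (jac (transition c1 c) (cmap c1 q) *m T1)); split=> //.
      by apply: linked_trans L; exact: linked_chart.
    exists c, (invmx T *m (jac (transition c1 c) (cmap c1 q') *m T1)); split=> //.
    by apply: linked_trans (linked_sym L); exact: linked_chart.
  apply: (manifold_connected X).
  - by exists p0; exists c0, 1%:M; split=> //; exact: linked_refl.
  - exists B; last by rewrite setTI.
    rewrite openE => q Bq; have [N qN NB] := Bnear q.
    have NB' : N `<=` B by move=> q' /NB[H _]; exact: H.
    exact: filterS NB' qN.
  - exists B; last by rewrite setTI.
    move=> q clq; have [N qN NB] := Bnear q.
    by have [q' [Bq' /NB[_ H]]] := clq N qN; exact: H.
move=> q c cq; have [c1 [T1 [c1q L1]]] : B q by rewrite BT.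
by exists (jac (transition c1 c) (cmap c1 q) *m T1); exact: linked_chart.
Qed.

End Transport.

(** * The pencil of segments as a parametrised family *)

Section LineFamily.
Context {R : realType}.
Notation E := 'cV[R]_4.

(** Mean value inequalities: bounds on two derivatives in [b] provide all the Lipschitz and
    remainder bounds. *)
Lemma C2_family_derive n (A DA D2A : R -> R -> 'M[R]_n) (K : R) :
  (forall s b : R, -2 <= s <= 2 -> -1 <= b <= 1 ->
    [/\ {for s, continuous (A ^~ b)}, {for s, continuous (DA ^~ b)},
        n%:R * `|A s b| <= 4^-1, `|DA s b| <= K & `|D2A s b| <= K]) ->
  (forall s b : R, -2 <= s <= 2 -> -1 <= b <= 1 ->
    is_derive b 1 (A s) (DA s b) /\ is_derive b 1 (DA s) (D2A s b)) ->
  C2_family A DA K.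
Proof.
move=> HA HD s b s2 b1; have [Ac DAc A4 DK D2K] := HA s b s2 b1.
have K0 : 0 <= K := le_trans (normr_ge0 _) DK.
have btw (b' t : R) : -1 <= b' <= 1 -> Num.min b b' <= t <= Num.max b b' ->
    -1 <= t <= 1 /\ `|t - b| <= `|b' - b|.
  move=> b1'; have [bb|bb] := leP b b' => t1; split; try lra.
    by rewrite !ger0_norm; lra.
  by rewrite !ler0_norm; lra.
have DL (b' : R) : -1 <= b' <= 1 -> `|DA s b' - DA s b| <= K * `|b' - b|.
  move=> b1'; apply: (@mx_MVT_le _ _ _ _ (D2A s)) => t /(btw _ _ b1')[t1 _].
    by have [] := HD s t s2 t1.
  by have [] := HA s t s2 t1.
split=> // b' b1'; split; last first; [|exact: DL|].
  have -> : A s b' - A s b - (b' - b) *: DA s b =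
      (A s b' - b' *: DA s b) - (A s b - b *: DA s b).
    by apply/matrixP => i j; rewrite !mxE; ring.
  rewrite mulrA; apply: (@mx_MVT_le _ _ _ (fun t => A s t - t *: DA s b)
    (fun t => DA s t - DA s b)) => t /(btw _ _ b1')[t1 tb].
    have [Ad _] := HD s t s2 t1.
    apply: (is_derive_eq (is_deriveB Ad (is_derive_scale (is_derive_id t 1)
      (is_derive_cst (DA s b) t 1)))).
    by rewrite scale1r scaler0 addr0.
  by rewrite (le_trans (DL t t1))// ler_wpM2l.
apply: (@mx_MVT_le _ _ _ _ (DA s)) => t /(btw _ _ b1')[t1 _].
  by have [] := HD s t s2 t1.
by have [] := HA s t s2 t1.
Qed.

Lemma is_derive_pencil (W : normedModType R) (f : E -> W) df x v w (s b : R) :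
  is_derive (x + s *: (v + b *: w)) w f df ->
  is_derive b 1 (fun b => f (x + s *: (v + b *: w))) (s *: df).
Proof.
have E1 (b' : R) : x + s *: (v + b' *: w) = (x + s *: v) + (s * b') *: w.
  by rewrite scalerDr addrA scalerA.
rewrite E1 => -[fd fE].
have := is_derive_comp1 (is_derive_line fd) (is_derive_mull s b); rewrite fE.
by apply: near_eq_is_derive; near=> b'; rewrite /= E1.
Unshelve. all: by end_near. Qed.

Section Pencil.
Variables (F F1 F2 H H1 H2 : E -> 'M[R]_4) (x v w : E) (k r K : R).
Hypotheses (k0 : 0 < k) (k1 : k <= 1) (kr : k * (4 * (`|v| + `|w| + 1)) <= r).
Hypothesis kK : 32 * (k * K) <= 1.
Hypothesis Fd : forall y, `|y - x| < r ->
  [/\ is_derive y w F (F1 y), is_derive y w F1 (F2 y),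
      is_derive y w H (H1 y) & is_derive y w H1 (H2 y)].
Hypothesis Fc : forall y, `|y - x| < r ->
  [/\ {for y, continuous F}, {for y, continuous F1},
      {for y, continuous H} & {for y, continuous H1}].
Hypothesis FK : forall y, `|y - x| < r ->
  [/\ `|F y| <= K, `|F1 y| <= K & `|F2 y| <= K] /\
  [/\ `|H y| <= K, `|H1 y| <= K & `|H2 y| <= K].

Local Notation pt := (fun s b : R => x + (k * s) *: (v + b *: w)).

Lemma pencil_near (s b : R) : -2 <= s <= 2 -> -1 <= b <= 1 -> `|pt s b - x| < r.
Proof.
move=> s2 b1; apply: lt_le_trans kr.
rewrite addrC addKr normrZ normrM (gtr0_norm k0) -mulrA ltr_pM2l//.
have s2' : `|s| <= 2 by rewrite ler_norml.
have b1' : `|b| <= 1 by rewrite ler_norml.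
have := ler_normD v (b *: w); rewrite normrZ.
move: (normr_ge0 s) (normr_ge0 b) (normr_ge0 v) (normr_ge0 w) (normr_ge0 (v + b *: w)).
move: s2' b1'; set a1 := `|s|; set a2 := `|b|; set a3 := `|v|; set a4 := `|w|.
set a5 := `|v + _| => *; have : a2 * a4 <= a4 by nra.
by move=> *; nra.
Qed.

(** [F] and [H] stand for the Christoffel matrices in directions [v] and [w], the other four for
    their derivatives along [w]. The first and second derivatives in [b] are at most 5 K and 12 K,
    so 16 K serves for both. *)
Lemma pencil_C2_family :
  C2_family (fun s b => - (k *: (F (pt s b) + b *: H (pt s b))))
    (fun s b => - (k *: (H (pt s b) +
       (k * s) *: (F1 (pt s b) + b *: H1 (pt s b))))) (16 * K).
Proof.
have ptc (b s : R) : {for s, continuous (pt ^~ b)}.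
  apply: cvgD; first exact: cvg_cst.
  by apply: cvgZr_tmp; apply: cvgMl_tmp; exact: cvg_id.
have ptf (f : E -> 'M[R]_4) (s b : R) : {for pt s b, continuous f} ->
    {for s, continuous (fun s => f (pt s b))}.
  by move=> fc; apply: (@continuous_comp _ _ _ (pt ^~ b) f); [exact: ptc|exact: fc].
apply: (C2_family_derive (D2A := fun s b => - (k *: ((k * s) *: H1 (pt s b) +
   (k * s) *: ((k * s) *: F2 (pt s b) + (H1 (pt s b) +
     b *: ((k * s) *: H2 (pt s b)))))))) => s b s2 b1.
  have pr := pencil_near s2 b1.
  have [Fc0 F1c Hc H1c] := Fc pr; have [[F0 F10 F20] [H0 H10 H20]] := FK pr.
  have s2' : `|s| <= 2 by rewrite ler_norml.
  have b1' : `|b| <= 1 by rewrite ler_norml.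
  have K0 : 0 <= K := le_trans (normr_ge0 _) F0.
  have ks : `|k * s| <= 2.
    by rewrite normrM (gtr0_norm k0) -[2]mul1r ler_pM// ltW.
  have bZ (X : 'M[R]_4) (a : R) : `|X| <= a -> `|b *: X| <= a.
    by move=> Xa; rewrite normrZ -[a]mul1r ler_pM.
  have ksZ (X : 'M[R]_4) (a : R) : `|X| <= a -> `|(k * s) *: X| <= 2 * a.
    by move=> Xa; rewrite normrZ ler_pM.
  have kZ (X : 'M[R]_4) (a : R) : `|X| <= a -> `|- (k *: X)| <= k * a.
    by move=> Xa; rewrite normrN normrZ (gtr0_norm k0) ler_pM2l.
  have nD (X Y : 'M[R]_4) (a a' : R) : `|X| <= a -> `|Y| <= a' -> `|X + Y| <= a + a'.
    by move=> Xa Ya; rewrite (le_trans (ler_normD _ _))// lerD.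
  split.
  - apply: cvgN; apply: cvgZl_tmp; apply: cvgD; first exact: ptf.
    by apply: cvgZl_tmp; exact: ptf.
  - apply: cvgN; apply: cvgZl_tmp; apply: cvgD; first exact: ptf.
    apply: cvgZ; first by apply: cvgMl_tmp; exact: cvg_id.
    by apply: cvgD; [exact: ptf|apply: cvgZl_tmp; exact: ptf].
  - apply: (@le_trans _ _ (4 * (k * (K + K)))); last first.
      by move: kK; rewrite mulrDr; move: (k * K) => u; lra.
    by rewrite ler_pM2l//; exact: kZ _ _ (nD _ _ _ _ F0 (bZ _ _ H0)).
  - have := kZ _ _ (nD _ _ _ _ H0 (ksZ _ _ (nD _ _ _ _ F10 (bZ _ _ H10)))).
    by move=> h; apply: le_trans h _; apply: le_trans (ler_piMl _ k1) _; lra.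
  - have := kZ _ _ (nD _ _ _ _ (ksZ _ _ H10) (ksZ _ _ (nD _ _ _ _ (ksZ _ _ F20)
      (nD _ _ _ _ H10 (bZ _ _ (ksZ _ _ H20)))))).
    by move=> h; apply: le_trans h _; apply: le_trans (ler_piMl _ k1) _; lra.
have [Fd0 F1d Hd H1d] := Fd (pencil_near s2 b1).
have bD (f : E -> 'M[R]_4) df : is_derive (pt s b) w f df ->
    is_derive b 1 (fun b => b *: f (pt s b)) (f (pt s b) + b *: ((k * s) *: df)).
  move=> fd; apply: (is_derive_eq (is_derive_scale (is_derive_id b 1)
    (is_derive_pencil fd))).
  by rewrite scale1r.
have kD (f : R -> 'M[R]_4) (df : 'M[R]_4) (a : R) : is_derive b 1 f df ->
    is_derive b 1 (fun b => a *: f b) (a *: df).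
  by move=> fd; exact: is_deriveZ.
have ND (f : R -> 'M[R]_4) (df : 'M[R]_4) : is_derive b 1 f df ->
    is_derive b 1 (fun b => - f b) (- df).
  by move=> fd; exact: is_deriveN.
have DD (f h : R -> 'M[R]_4) (df dh : 'M[R]_4) : is_derive b 1 f df ->
    is_derive b 1 h dh -> is_derive b 1 (fun b => f b + h b) (df + dh).
  by move=> fd hd; exact: is_deriveD.
split.
  apply: (is_derive_eq (ND _ _ (kD _ _ k (DD _ _ _ _ (is_derive_pencil Fd0)
    (bD _ _ Hd))))).
  move: (F1 _) (H _) (H1 _) => f1 h h1.
  by apply/matrixP => i j; rewrite !mxE; ring.
exact: (ND _ _ (kD _ _ k (DD _ _ _ _ (is_derive_pencil Hd)
  (kD _ _ (k * s) (DD _ _ _ _ (is_derive_pencil F1d) (bD _ _ H1d)))))).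
Qed.

End Pencil.

End LineFamily.

(** * Derivatives and limits within the holonomy algebra *)

Section LoopTools.
#[local] Opaque derive.
Context {R : realType}.
Notation E := 'cV[R]_4.

Lemma C1_curve J m n (f df : R -> 'M[R]_(m, n)) : open J ->
  (forall t : R, J t -> is_derive t 1 f (df t)) ->
  (forall t, J t -> {for t, continuous df}) -> Ck 1 J f.
Proof.
move=> Jo fd dfc; apply/Ck_curveP => //; split=> [t /fd[]//|].
apply: (@Ck_ext _ _ _ 0 _ df) => //.
by move=> t /fd[_ <-]; rewrite derive1E.
Qed.

Lemma is_derive_invmx J n (f df : R -> 'M[R]_n) (t : R) : open J ->
  (forall t : R, J t -> is_derive t 1 f (df t)) ->
  (forall t, J t -> {for t, continuous df}) ->
  (forall t, J t -> f t \in unitmx) -> J t ->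
  is_derive t 1 (fun t => invmx (f t)) (- (invmx (f t) *m df t *m invmx (f t))).
Proof.
move=> Jo fd dfc fu Jt.
have fC : Ck 1 J (fun t => invmx (f t)).
  apply/Ck_mxP => // i j; apply: Ck_invmx => // a b.
  by have /Ck_mxP := C1_curve Jo fd dfc; exact.
have Nd : is_derive t 1 (fun t => invmx (f t)) ('D_1 (fun t => invmx (f t)) t).
  by apply: derivableP; exact: Ck_derivable fC Jt.
have [_ H] := is_derive_mulmx (fd t Jt) Nd.
have : 'D_1 (fun y => f y *m invmx (f y)) t = 0.
  rewrite (@near_eq_derive _ _ _ _ (fun=> 1%:M)) ?derive_cst//.
  by apply: filterS (open_near Jo Jt) => y Jy; rewrite mulmxV// fu.
rewrite H => /eqP; rewrite addrC addr_eq0 => /eqP E1.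
apply: (is_derive_eq Nd).
move: E1; set D := 'D_1 _ t => E1.
by rewrite -[D](mulKmx (fu t Jt)) E1 mulmxN mulmxA.
Qed.

(* The derivative in [s] of [Q (S + k s H T)] along the equations of [T], [S] and
   [Q = T^-1]. *)
Lemma loop_identity n (Q F S H T F1 DH : 'M[R]_n) (k s : R) :
  Q *m (k *: F) *m (S + (k * s) *: (H *m T)) +
  Q *m (- (k *: F) *m S + (- (k *: (H + (k * s) *: F1))) *m T +
    (k *: (H *m T) + (k * s) *: ((k *: DH) *m T + H *m (- (k *: F) *m T)))) =
  (k * k * s) *: (Q *m (DH - F1 + F *m H - H *m F) *m T).
Proof.
rewrite !(mulNmx, mulmxN, mulmxDr, mulmxDl, scalerDr, =^~ scalemxAl, =^~ scalemxAr, mulmxA).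
move: (Q *m F *m S) (Q *m F *m H *m T) (Q *m H *m T) (Q *m F1 *m T) (Q *m DH *m T).
move: (Q *m H *m F *m T) => *.
by apply/matrixP => i j; rewrite !mxE; ring.
Qed.

Section InR7.
Variable P : 'M[R]_4.
Hypothesis Pu : P \in unitmx.

Let N (M : 'M[R]_4) := invmx P *m M *m P.

(** The deviation of [M], read in the frame, from the combination whose coefficients are its entries
    00 and 23. It is linear in [M], so its vanishing passes to derivatives and limits. *)
Definition R7_defect (M : 'M[R]_4) : 'M[R]_4 :=
  N M - ((N M) i0 i0 *: boost + (N M) i2 i3 *: rotation).

Lemma in_R7P M : in_R7 P M <-> R7_defect M = 0.
Proof.
split=> [[a [b ->]]|/eqP]; last first.
  rewrite subr_eq0 => /eqP NE; exists (N M i0 i0), (N M i2 i3).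
  by rewrite -NE /N !mulmxA mulmxV// mul1mx mulmxK.
rewrite /R7_defect; have -> : N (P *m (a *: boost + b *: rotation) *m invmx P) =
    a *: boost + b *: rotation by rewrite /N !mulmxA mulVmx// mul1mx mulmxKV.
by rewrite !mxE /= !(mulr0, mulr1, subr0, addr0, add0r, mulr0n, mulr1n, sub0r) subrr.
Qed.

Lemma R7_defect_entry M i j : R7_defect M i j =
  \sum_a \sum_b (invmx P i a * P b j - boost i j * (invmx P i0 a * P b i0)
    - rotation i j * (invmx P i2 a * P b i3)) * M a b.
Proof.
have NE u v : N M u v = \sum_a \sum_b invmx P u a * P b v * M a b.
  rewrite mxE exchange_big /=; apply: eq_bigr => b _; rewrite mxE mulr_suml.
  by apply: eq_bigr => a _; rewrite mulrAC.
have -> : R7_defect M i j = N M i j - N M i0 i0 * boost i j - N M i2 i3 * rotation i j.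
  rewrite /R7_defect; move: (N M) boost rotation => N1 B1 R1.
  by rewrite !mxE; ring.
rewrite !NE.
rewrite !mulr_suml -!sumrB; apply: eq_bigr => a _.
rewrite !mulr_suml -!sumrB; apply: eq_bigr => b _; ring.
Qed.

Lemma in_R7_derive (f : R -> 'M[R]_4) (t : R) df :
  (\forall s \near t, in_R7 P (f s)) -> is_derive t 1 f df -> in_R7 P df.
Proof.
move=> fR /is_derive_mxP fd; apply/in_R7P/matrixP => i j.
have H : is_derive t 1 (fun s => R7_defect (f s) i j) (R7_defect df i j).
  rewrite R7_defect_entry.
  rewrite (_ : (fun s => _) = \sum_a (fun s => \sum_b (invmx P i a * P b j -
    boost i j * (invmx P i0 a * P b i0) - rotation i j * (invmx P i2 a * P b i3)) *
    f s a b)); last by apply/funext => s; rewrite R7_defect_entry fct_sumE.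
  apply: is_derive_sum => a.
  rewrite (_ : (fun s => _) = \sum_b (fun s => (invmx P i a * P b j -
    boost i j * (invmx P i0 a * P b i0) - rotation i j * (invmx P i2 a * P b i3)) *
    f s a b)); last by apply/funext => s; rewrite fct_sumE.
  by apply: is_derive_sum => b; apply: is_deriveZ; exact: fd.
have [_ <-] := H; rewrite [RHS]mxE (@near_eq_derive _ _ _ _ (fun=> 0)) ?derive_cst//.
by apply: filterS fR => s /in_R7P ->; rewrite mxE.
Qed.

Lemma in_R7_right_limit (f : R -> 'M[R]_4) : {for 0, continuous f} ->
  (forall s : R, 0 < s < 1 -> in_R7 P (f s)) -> in_R7 P (f 0).
Proof.
move=> /continuous_mxP fc fR; apply/in_R7P/matrixP => i j; rewrite [RHS]mxE.
have H : {for 0, continuous (fun s => R7_defect (f s) i j)}.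
  rewrite (_ : (fun s => _) = (fun s => \sum_a \sum_b (invmx P i a * P b j -
    boost i j * (invmx P i0 a * P b i0) - rotation i j * (invmx P i2 a * P b i3)) *
    f s a b)); last by apply/funext => s; rewrite R7_defect_entry.
  apply: continuous_sumr => a; apply: continuous_sumr => b.
  by apply: cvgMl_tmp; exact: fc.
apply/eqP/negPn/negP => n0.
have /cvgrPdist_lt/(_ `|R7_defect (f 0) i j|) := H.
rewrite normr_gt0 => /(_ n0) /nbhs_ballP[e /= e0 eP].
pose s := Num.min (e / 2) (1 / 2).
have s0 : 0 < s by rewrite lt_min !divr_gt0.
have s1 : s <= 1 / 2 by rewrite ge_min lexx orbT.
have se : s <= e / 2 by rewrite ge_min lexx.
have := eP s; rewrite -ball_normE /= sub0r normrN gtr0_norm//.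
have -> : R7_defect (f s) i j = 0.
  have /in_R7P -> : in_R7 P (f s) by apply: fR; lra.
  by rewrite mxE.
rewrite subr0 ltxx => H1.
by suff : false by []; apply: H1; lra.
Qed.

End InR7.

Lemma in_R7Z P (M : 'M[R]_4) (a : R) : a != 0 -> in_R7 P (a *: M) -> in_R7 P M.
Proof.
move=> a0 H; have := in_R7_lin a^-1 H (in_R7_0 P).
by rewrite addr0 scalerA mulVf// scale1r.
Qed.

(** For a [T] that comes from the parametrised family: the inverse built by [line_transport] serves
    it as well, having the same equation and initial value. *)
Lemma line_transport_inverse (U : set E) (G : E -> 'M[R]_4) x v (T : R -> 'M[R]_4) :
  open U -> smooth U G -> (forall y, U y -> G y \in unitmx) ->
  good_segment U G x v -> T 0 = 1%:M ->
  (forall s : R, -2 <= s <= 2 ->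
     is_derive s 1 T (- GamV G (x + s *: v) v *m T s)) ->
  exists Q : R -> 'M[R]_4, forall s : R, -2 <= s <= 2 ->
    [/\ is_derive s 1 T (- GamV G (x + s *: v) v *m T s),
        is_derive s 1 Q (Q s *m GamV G (x + s *: v) v),
        Q s *m T s = 1%:M & T s *m Q s = 1%:M].
Proof.
move=> Uo Gs Gu xv T0 Td.
have [T' [Q [_ Q0 TQ]]] := line_transport Uo Gs Gu xv; exists Q => s s2.
have QT : Q s *m T s = 1%:M.
  have <- : Q 0 *m T 0 = 1%:M by rewrite T0 Q0 mulmx1.
  apply: (mx_is_derive0_cst (f := fun s => Q s *m T s)) => t ts.
  have t2 : -2 <= t <= 2 by move: ts; have [] := leP 0 s => ? ?; lra.
  have [_ Qd _ _] := TQ t t2.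
  apply: (is_derive_eq (is_derive_mulmx Qd (Td t t2))).
  by rewrite mulNmx mulmxN mulmxA subrr.
have [_ Qd _ _] := TQ s s2.
by split=> //; [exact: Td|exact: mulmx1C QT].
Qed.

End LoopTools.

(** * Curvature from the holonomy of thin triangles *)

Section Loops.
#[local] Opaque derive.
Context {R : realType} {M : topologicalType} {X : manifold4 R M}.
Notation E := 'cV[R]_4.
Variables (g : lorentz_metric X) (c : chart R M) (x : E) (P : 'M[R]_4).
Hypotheses (ca : atlas X c) (Pu : P \in unitmx).
Local Notation G := (gcomp g c).

Hypothesis loop_velocity : forall C : R -> 'M[R]_4, Ck 1 setT C -> C 0 = 1%:M ->
  (forall t, exists s, transp g s (cinv c x) c (cinv c x) c (C t)) ->
  in_R7 P (derive1 C 0).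

Section Triangle.
Variables (v w : E) (k r : R) (T S : R -> R -> 'M[R]_4).
Local Notation F := (fun y => GamV G y v).
Local Notation H := (fun y => GamV G y w).
Local Notation pt s b := (x + (k * s) *: (v + b *: w)).
Hypotheses (k0 : 0 < k) (kr : k * (4 * (`|v| + `|w| + 1)) <= r).
Hypothesis FH : forall y, `|y - x| < r ->
  [/\ cimg c y, 32 * (k * `|F y|) <= 1 & 32 * (k * `|H y|) <= 1].
Hypothesis TS0 : forall b, T 0 b = 1%:M /\ S 0 b = 0.
Hypothesis Td : forall s b : R, -2 <= s <= 2 -> -1 <= b <= 1 ->
  is_derive s 1 (T ^~ b) (- (k *: (F (pt s b) + b *: H (pt s b))) *m T s b).
Hypothesis Sd : forall s b : R, -2 <= s <= 2 -> -1 <= b <= 1 ->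
  is_derive s 1 (S ^~ b) (- (k *: (F (pt s b) + b *: H (pt s b))) *m S s b +
   - (k *: (H (pt s b) + (k * s) *: ('D_w F (pt s b) + b *: 'D_w H (pt s b)))) *m T s b).
Hypothesis Tb : forall s b : R, -2 <= s <= 2 -> -1 < b < 1 ->
  is_derive b 1 (T s) (S s b).
Hypothesis Sb : forall s b : R, -2 <= s <= 2 -> -1 < b < 1 ->
  {for b, continuous (S s)}.

Lemma triangle_side b s : x + s *: (k *: (v + b *: w)) = pt s b.
Proof. by rewrite scalerA mulrC. Qed.

Lemma triangle_base b s : pt s 0 + b *: ((k * s) *: w) = pt s b.
Proof. rewrite scale0r addr0 scalerDr addrA; congr (_ + _).
by rewrite !scalerA mulrC. Qed.

Lemma GamV_side y b : GamV G y (k *: (v + b *: w)) = k *: (F y + b *: H y).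
Proof. by rewrite GamVZ GamVD GamVZ. Qed.

Lemma pencil_point (s b : R) : -2 <= s <= 2 -> -1 <= b <= 1 -> `|pt s b - x| < r.
Proof. exact: pencil_near. Qed.

Lemma side_good b : -1 <= b <= 1 -> good_segment (cimg c) G x (k *: (v + b *: w)).
Proof.
move=> b1 s s2; rewrite triangle_side; have [cy F32 H32] := FH (pencil_point s2 b1).
split=> //; rewrite GamV_side normrZ (gtr0_norm k0).
have b1' : `|b| <= 1 by rewrite ler_norml.
have : k * `|F (pt s b) + b *: H (pt s b)| <= k * `|F (pt s b)| + k * `|H (pt s b)|.
  rewrite -mulrDr ler_pM2l// (le_trans (ler_normD _ _))// lerD2l normrZ.
  by rewrite ler_piMl.
move: F32 H32; set a1 := k * `|F _|; set a2 := k * `|H _|; set a3 := k * _.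
by move=> *; lra.
Qed.

Lemma base_good s : -1 <= s <= 1 -> good_segment (cimg c) G (pt s 0) ((k * s) *: w).
Proof.
move=> s1 b b2; rewrite triangle_base.
have s1' : `|s| <= 1 by rewrite ler_norml.
have [|cy F32 H32] := FH (y := pt s b).
  apply: lt_le_trans kr; rewrite addrC addKr normrZ normrM (gtr0_norm k0) -mulrA ltr_pM2l//.
  have b2' : `|b| <= 2 by rewrite ler_norml.
  have : `|s| * `|v + b *: w| <= `|v + b *: w| by rewrite ler_piMl.
  have : `|b| * `|w| <= 2 * `|w| by rewrite ler_wpM2r.
  have := ler_normD v (b *: w); rewrite normrZ.
  move: (normr_ge0 v) (normr_ge0 w).
  set a1 := `|s| * _; set a2 := `|v|; set a3 := `|b| * _; set a4 := `|w|.
  by set a5 := `|v + _| => *; lra.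
split=> //; rewrite GamVZ normrZ normrM (gtr0_norm k0).
move: H32; set h := `|GamV _ _ _| => H32.
have : `|s| * (k * h) <= k * h.
  by apply: ler_piMl s1'; apply: mulr_ge0; [exact: ltW|exact: normr_ge0].
have -> : k * `|s| * h = `|s| * (k * h) by ring.
by move: H32; move: (k * h) (`|s| * _) => a1 a2 *; lra.
Qed.

Lemma side_inverse b : -1 <= b <= 1 -> exists Q : R -> 'M[R]_4,
  forall s : R, -2 <= s <= 2 ->
    [/\ is_derive s 1 (T ^~ b) (- GamV G (x + s *: (k *: (v + b *: w)))
          (k *: (v + b *: w)) *m T s b),
        is_derive s 1 Q (Q s *m GamV G (x + s *: (k *: (v + b *: w)))
          (k *: (v + b *: w))),
        Q s *m T s b = 1%:M & T s b *m Q s = 1%:M].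
Proof.
move=> b1; apply: (line_transport_inverse (cimg_isopen c) (g_smooth g ca)
  (g_unit g ca) (side_good b1) (TS0 b).1) => s s2.
by rewrite GamV_side triangle_side; exact: Td.
Qed.

Lemma T_unit s b : -2 <= s <= 2 -> -1 <= b <= 1 -> T s b \in unitmx.
Proof.
by move=> s2 /side_inverse[Q /(_ s s2)[_ _ _ TQ]]; have [] := mulmx1_unit TQ.
Qed.

(** Read from right to left, the product goes out along the side with parameter 0, across the base,
    and back along the side with parameter [b]. *)
Lemma triangle_loop s b (U : R -> 'M[R]_4) : -1 <= s <= 1 -> -1 <= b <= 1 ->
  U 0 = 1%:M -> (forall t : R, -2 <= t <= 2 ->
    is_derive t 1 U (- GamV G (pt s 0 + t *: ((k * s) *: w)) ((k * s) *: w) *m U t)) ->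
  exists p, transp g p (cinv c x) c (cinv c x) c (invmx (T s b) *m U b *m T s 0).
Proof.
move=> s1 b1 U0 Ud.
have s1' : `|s| <= 1 by rewrite ler_norml.
have b1' : `|b| <= 1 by rewrite ler_norml.
have s2 : -2 <= s <= 2 by lra.
have z1 : -1 <= (0 : R) <= 1 by lra.
have [Q0 TQ0] := side_inverse z1; have [Q TQ] := side_inverse b1.
have [QU UQ] := line_transport_inverse (cimg_isopen c) (g_smooth g ca)
  (g_unit g ca) (base_good s1) U0 Ud.
have [p1] := segment_forward ca (side_good z1) (TS0 0).1 TQ0 s1'.
have [p2] := segment_forward ca (base_good s1) U0 UQ b1'.
have [p3] := segment_backward ca (side_good b1) (TS0 b).1 TQ s1'.
rewrite triangle_base !triangle_side => H3 H2 H1.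
have [_ _ _ TQ1] := TQ s s2.
have QE : Q s = invmx (T s b) by rewrite -(mulKmx (T_unit s2 b1) (Q s)) TQ1 mulmx1.
exists ((p1 ++ p2) ++ p3); rewrite -QE -mulmxA.
exact: transp_cat (transp_cat H1 H2) H3.
Qed.

(* Up to sign, the velocity at [b = 0] of the holonomy of the triangle with vertices
   [x], [pt s 0] and [pt s b]. *)
Definition side_defect s : 'M[R]_4 :=
  invmx (T s 0) *m (S s 0 + (k * s) *: (H (pt s 0) *m T s 0)).

(** At [b = 0] the triangle retraces its first side and has trivial holonomy, so [loop_velocity]
    applies to the curve in [b]. *)
Lemma in_R7_side_defect s : -1 <= s <= 1 -> in_R7 P (side_defect s).
Proof.
move=> s1; have s2 : -2 <= s <= 2 by lra.
have z1 : -1 <= (0 : R) <= 1 by lra.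
have [U [QU [U0 _ UQ]]] := line_transport (cimg_isopen c) (g_smooth g ca)
  (g_unit g ca) (base_good s1).
have Ud (t : R) : -2 <= t <= 2 -> is_derive t 1 U
    (- GamV G (pt s 0 + t *: ((k * s) *: w)) ((k * s) *: w) *m U t).
  by move=> /UQ[].
pose J : set R := [set b | -1 < b < 1].
have Jo : open J.
  rewrite (_ : J = `](-1 : R), 1[%classic); first exact: interval_open.
  by apply/seteqP; split=> b; rewrite /= in_itv.
pose N b := invmx (T s b).
have Nd (b : R) : J b -> is_derive b 1 N (- (N b *m S s b *m N b)).
  move=> Jb; apply: (is_derive_invmx (J := J)) => //.
  - by move=> t Jt; exact: Tb.
  - by move=> t Jt; exact: Sb.
  - by move=> t /andP[? ?]; apply: T_unit => //; lra.
pose K t := - GamV G (pt s 0 + t *: ((k * s) *: w)) ((k * s) *: w).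
pose C b := N b *m U b *m T s 0.
pose DC b := (- (N b *m S s b *m N b) *m U b + N b *m (K b *m U b)) *m T s 0.
have J2 (b : R) : J b -> -2 <= b <= 2 by move=> /andP[? ?]; lra.
have Cd (b : R) : J b -> is_derive b 1 C (DC b).
  move=> Jb; exact: is_derive_mulmxr (is_derive_mulmx (Nd b Jb) (Ud b (J2 b Jb))).
have Kc (b : R) : J b -> {for b, continuous K}.
  move=> /J2 b2; apply: cvgN.
  apply: (@continuous_comp _ _ _ (fun t : R => pt s 0 + t *: ((k * s) *: w))
    (fun y => GamV G y ((k * s) *: w))).
    by apply: cvgD; [exact: cvg_cst|exact: scalel_continuous].
  apply: smooth_continuous (GamV_smooth (cimg_isopen c) (g_smooth g ca) (g_unit g ca) _) _.
  by have [] := base_good s1 b2.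
have DCc (b : R) : J b -> {for b, continuous DC}.
  move=> Jb; have Nc := is_derive_continuous (Nd b Jb).
  have Uc := is_derive_continuous (Ud b (J2 b Jb)).
  have Sc : {for b, continuous (S s)} by apply: Sb.
  have NSN : {for b, continuous (fun b => - (N b *m S s b *m N b))}.
    by apply: cvgN; exact: continuous_mulmx (continuous_mulmx Nc Sc) Nc.
  have NKU := continuous_mulmx Nc (continuous_mulmx (Kc b Jb) Uc).
  have D2 : {for b, continuous (fun b => - (N b *m S s b *m N b) *m U b +
      N b *m (K b *m U b))}.
    by apply: cvgD; [exact: continuous_mulmx NSN Uc|exact: NKU].
  have Tc : {for b, continuous (fun _ : R => T s 0)} by exact: cst_continuous.
  by have := continuous_mulmx D2 Tc; exact.
(* [loop_velocity] wants a curve on the whole line, while the family is differentiable only for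
   [|b| < 1]. [ramp 2^-1] stays within 1/2 and merely multiplies the velocity at 0 by a nonzero
   constant. *)
pose Ct t := C (ramp 2^-1 t).
have rJ t : J (ramp 2^-1 t).
  have := ramp_le 2^-1 t; rewrite (gtr0_norm (x := 2^-1)) ?invr_gt0// ler_norml /J /=.
  by lra.
have Ctd (t : R) : is_derive t 1 Ct (coramp (2^-1 * (pi / 2)) t *: DC (ramp 2^-1 t)).
  exact: is_derive_comp1 (Cd _ (rJ t)) (is_derive_ramp _ _).
have J0 : J 0 by rewrite /J /=; lra.
have := loop_velocity (C := Ct); rewrite derive1E.
have [_ ->] := Ctd 0; rewrite coramp0 ramp0 => H1.
have {}H1 : in_R7 P ((2^-1 * (pi / 2)) *: DC 0).
  apply: H1.
  - apply: (C1_curve openT (fun t _ => Ctd t)) => t _.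
    apply: cvgZ.
      exact: is_derive_continuous (is_derive_coramp _ _).
    apply: (@continuous_comp _ _ _ (ramp 2^-1) DC).
      exact: is_derive_continuous (is_derive_ramp _ _).
    exact: DCc.
  - by rewrite /Ct ramp0 /C U0 mulmx1 mulVmx// T_unit.
  - move=> t; have /andP[? ?] := rJ t; apply: (triangle_loop s1 _ U0 Ud).
    by apply/andP; split; exact: ltW.
have : in_R7 P ((- (2^-1 * (pi / 2))) *: side_defect s).
  rewrite scaleNr -scalerN; suff <- : DC 0 = - side_defect s by [].
  rewrite /DC /side_defect U0 !mulmx1 -/(N 0) /K !scale0r !addr0 GamVZ mulmxDl.
  rewrite mulNmx -[N 0 *m _ *m _ *m _]mulmxA mulVmx ?T_unit// mulmx1 mulmxDr opprD.
  by move: (GamV _ _ _) (N 0) => h n; rewrite mulmxN mulNmx -!scalemxAr -scalemxAl mulmxA.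
by apply: in_R7Z; rewrite oppr_eq0 mulf_neq0// ?invr_eq0// gt_eqF// divr_gt0// pi_gt0.
Qed.

(* The [s]-derivative of [side_defect s] is [k^2 s] times the curvature at [pt s 0],
   transported back to [x]. *)
Lemma in_R7_side_curvature : in_R7 P ('D_v H x - 'D_w F x + F x *m H x - H x *m F x).
Proof.
have z1 : -1 <= (0 : R) <= 1 by lra.
have [Q TQ] := side_inverse z1.
pose ln s : E := x + (k * s) *: v.
have lnE s : pt s 0 = ln s by rewrite scale0r addr0.
pose Z y := 'D_v H y - 'D_w F y + F y *m H y - H y *m F y.
have lnU s : -2 <= s <= 2 -> cimg c (ln s).
  by move=> s2; have := pencil_point s2 z1; rewrite lnE => /FH[].
have smo u := GamV_smooth (cimg_isopen c) (g_smooth g ca) (g_unit g ca) u.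
have QE s : -2 <= s <= 2 -> Q s = invmx (T s 0).
  move=> s2; have [_ _ _ TQ1] := TQ s s2.
  by rewrite -(mulKmx (T_unit s2 z1) (Q s)) TQ1 mulmx1.
have Hd (s : R) : -2 <= s <= 2 ->
    is_derive s 1 (fun s => H (pt s 0)) (k *: 'D_v H (ln s)).
  move=> s2; rewrite (_ : (fun s => _) = (fun t => H (x + t *: v)) \o (fun s => k * s)).
    apply: is_derive_comp1 (is_derive_mull k s); apply: is_derive_line.
    exact: smooth_derivable (smo w) (lnU s s2).
  by apply/funext => t; rewrite /= scale0r addr0.
have Md (s : R) : -2 < s < 2 -> is_derive s 1 side_defect
    ((k * k * s) *: (Q s *m Z (ln s) *m T s 0)).
  move=> /andP[s2a s2b]; have s2 : -2 <= s <= 2 by lra.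
  have [T1d Qd _ _] := TQ s s2; have S1d := Sd s2 z1; have T2d := Td s2 z1.
  have DD (f h : R -> 'M[R]_4) (df dh : 'M[R]_4) : is_derive s 1 f df ->
      is_derive s 1 h dh -> is_derive s 1 (fun s => f s + h s) (df + dh).
    by move=> fd hd; exact: is_deriveD.
  have D := is_derive_mulmx Qd (DD _ _ _ _ S1d
    (is_derive_scale (is_derive_mull k s) (is_derive_mulmx (Hd s s2) T2d))).
  rewrite GamV_side triangle_side lnE !scale0r !addr0 loop_identity in D.
  apply: near_eq_is_derive D; near=> t.
  have t2 : -2 <= t <= 2.
    by apply/andP; split; apply: ltW; near: t; [exact: lt_nbhsr|exact: lt_nbhsl].
  rewrite /side_defect -(QE t t2) lnE; reflexivity.
(* Dividing by [k * k * s] excludes [s = 0]; the curvature at [x] itself is then recovered as a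
   limit from the right. *)
have ZR (s : R) : 0 < s < 1 -> in_R7 P (Q s *m Z (ln s) *m T s 0).
  move=> /andP[s0 s1].
  have H1 : in_R7 P ((k * k * s) *: (Q s *m Z (ln s) *m T s 0)).
    apply: in_R7_derive (Md s _) => //; last by lra.
    near=> t; apply: in_R7_side_defect.
    apply/andP; split; apply: ltW; near: t; [apply: lt_nbhsr|apply: lt_nbhsl] => //; lra.
  by apply: in_R7Z H1; rewrite !mulf_neq0// gt_eqF.
have z2 : -2 <= (0 : R) <= 2 by lra.
have [T1d Qd QT _] := TQ 0 z2.
suff : in_R7 P (Q 0 *m Z (ln 0) *m T 0 0).
  have T01 := (TS0 0).1; have Q01 : Q 0 = 1%:M by rewrite QE// T01 invmx1.
  by rewrite T01 Q01 mulmx1 mul1mx /Z /ln mulr0 scale0r addr0.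
apply: (in_R7_right_limit Pu (f := fun s => Q s *m Z (ln s) *m T s 0)) ZR.
have Zc : {for 0, continuous (fun s => Z (ln s))}.
  apply: (@continuous_comp _ _ _ ln Z).
    apply: cvgD; first exact: cvg_cst.
    by apply: cvgZr_tmp; apply: cvgMl_tmp; exact: cvg_id.
  have U0 := lnU 0 z2.
  have Fc := smooth_continuous (smo v) U0; have Hc := smooth_continuous (smo w) U0.
  have DHc := smooth_continuous (smooth_derive v (smo w)) U0.
  have DFc := smooth_continuous (smooth_derive w (smo v)) U0.
  have FHc := continuous_mulmx Fc Hc; have HFc := continuous_mulmx Hc Fc.
  exact: (continuousB (continuousD (continuousB DHc DFc) FHc) HFc).
apply: continuous_mulmx; last exact: is_derive_continuous T1d.
by apply: continuous_mulmx; [exact: is_derive_continuous Qd|exact: Zc].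
Unshelve. all: by end_near. Qed.

End Triangle.

Lemma riem_in_R7 i j : cimg c x -> in_R7 P (Riem G x i j).
Proof.
move=> cx; pose v : E := delta_mx i 0; pose w : E := delta_mx j 0.
have smo u : smooth (cimg c) (fun y => GamV G y u).
  exact: GamV_smooth (cimg_isopen c) (g_smooth g ca) (g_unit g ca) u.
have smo1 u : smooth (cimg c) (fun y => 'D_w (fun y => GamV G y u) y).
  exact: smooth_derive w (smo u).
have smo2 u : smooth (cimg c) (fun y => 'D_w (fun y => 'D_w (fun y => GamV G y u) y) y).
  exact: smooth_derive w (smo1 u).
have bd (f : E -> 'M[R]_4) : smooth (cimg c) f -> exists r K : R, [/\ 0 < r, 0 <= K &
    forall y, `|y - x| < r -> cimg c y /\ `|f y| <= K].
  move=> fs; have fx := continuous_near_le (smooth_continuous fs cx).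
  have : \forall y \near x, cimg c y /\ `|f y| <= `|f x| + 1.
    by apply: filterS2 (open_near (cimg_isopen c) cx) fx => y; split.
  move=> /nbhs_ballP[r /= r0 rP]; exists r, (`|f x| + 1); split=> //.
  by move=> y yr; apply: rP; rewrite -ball_normE /= distrC.
have [r1 [K1 [r10 K10 b1]]] := bd _ (smo v); have [r2 [K2 [r20 K20 b2]]] := bd _ (smo1 v).
have [r3 [K3 [r30 K30 b3]]] := bd _ (smo2 v); have [r4 [K4 [r40 K40 b4]]] := bd _ (smo w).
have [r5 [K5 [r50 K50 b5]]] := bd _ (smo1 w); have [r6 [K6 [r60 K60 b6]]] := bd _ (smo2 w).
pose r := Num.min (Num.min (Num.min r1 r2) (Num.min r3 r4)) (Num.min r5 r6).
pose K := K1 + K2 + K3 + K4 + K5 + K6 + 1.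
have r0 : 0 < r by rewrite !lt_min r10 r20 r30 r40 r50 r60.
have K0 : 0 < K by rewrite /K; lra.
have [l1 l2 l3] : [/\ K1 <= K, K2 <= K & K3 <= K] by rewrite /K; split; lra.
have [l4 l5 l6] : [/\ K4 <= K, K5 <= K & K6 <= K] by rewrite /K; split; lra.
pose n := 4 * (`|v| + `|w| + 1).
have n0 : 0 < n by rewrite /n mulr_gt0// ltr_wpDl// addr_ge0.
(* The three bounds serve the constants of [pencil_C2_family], keep the pencil within radius [r],
   and ensure the contraction condition. *)
pose k := Num.min 1 (Num.min (r / n) (1 / (32 * K))).
have k0 : 0 < k by rewrite !lt_min ltr01 !divr_gt0// mulr_gt0.
have k1 : k <= 1 by rewrite ge_min lexx.
have kr : k * n <= r by rewrite -ler_pdivlMr// !ge_min lexx orbT.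
have kK : 32 * (k * K) <= 1.
  by rewrite mulrCA -ler_pdivlMr ?mulr_gt0// !ge_min lexx !orbT.
have near6 y : `|y - x| < r -> [/\ cimg c y,
    [/\ `|GamV G y v| <= K, `|'D_w (fun y => GamV G y v) y| <= K &
        `|'D_w (fun y => 'D_w (fun y => GamV G y v) y) y| <= K] &
    [/\ `|GamV G y w| <= K, `|'D_w (fun y => GamV G y w) y| <= K &
        `|'D_w (fun y => 'D_w (fun y => GamV G y w) y) y| <= K]].
  rewrite !lt_min => /andP[/andP[/andP[y1 y2] /andP[y3 y4]] /andP[y5 y6]].
  move: (b1 y y1) (b2 y y2) (b3 y y3) (b4 y y4) (b5 y y5) (b6 y y6).
  move=> [cy n1] [_ n2] [_ n3] [_ n4] [_ n5] [_ n6].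
  split; first exact: cy.
    by split; [exact: le_trans n1 l1|exact: le_trans n2 l2|exact: le_trans n3 l3].
  by split; [exact: le_trans n4 l4|exact: le_trans n5 l5|exact: le_trans n6 l6].
have fam := @pencil_C2_family R (fun y => GamV G y v)
  (fun y => 'D_w (fun y => GamV G y v) y)
  (fun y => 'D_w (fun y => 'D_w (fun y => GamV G y v) y) y)
  (fun y => GamV G y w) (fun y => 'D_w (fun y => GamV G y w) y)
  (fun y => 'D_w (fun y => 'D_w (fun y => GamV G y w) y) y) x v w k r K k0 k1 kr kK.
have dsm (f : E -> 'M[R]_4) y : smooth (cimg c) f -> cimg c y ->
    is_derive y w f ('D_w f y).
  by move=> fs cy; apply: derivableP; exact: smooth_derivable fs cy.
have [||| T [S [TS0 Td Sd Tb Sb]]] := linear_ode_family (fam _ _ _).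
- move=> y /near6[cy _ _]; split.
  + exact: dsm (smo v) cy.
  + exact: dsm (smo1 v) cy.
  + exact: dsm (smo w) cy.
  + exact: dsm (smo1 w) cy.
- move=> y /near6[cy _ _]; split.
  + exact: smooth_continuous (smo v) cy.
  + exact: smooth_continuous (smo1 v) cy.
  + exact: smooth_continuous (smo w) cy.
  + exact: smooth_continuous (smo1 w) cy.
- by move=> y /near6[_ H1 H2]; exact: (conj H1 H2).
have := @in_R7_side_curvature v w k r T S k0 kr _ TS0 Td Sd Tb Sb.
rewrite (RiemE (cimg_isopen c) (g_smooth g ca) (g_unit g ca))//.
have fE u : (fun y => GamV G y (delta_mx u 0)) = (fun y => Gam G y u).
  by apply/funext => y; rewrite GamV_delta.
rewrite /v /w !fE !GamV_delta; apply=> y /near6[cy [F1 _ _] [H1 _ _]]; split=> //.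
- by apply: le_trans kK; rewrite !ler_pM2l.
- by apply: le_trans kK; rewrite !ler_pM2l.
Qed.

End Loops.

(** * Curvature of type R7 at every point *)

Section Tetrad.
Context {R : realType}.
Notation E := 'cV[R]_4.
Notation e_ c := (delta_mx c 0 : E).

Lemma eq_mulmx_delta m n (A B : 'M[R]_(m, n)) :
  (forall j, A *m (delta_mx j 0 : 'cV_n) = B *m delta_mx j 0) -> A = B.
Proof.
by move=> AB; apply/matrixP => i j; have := AB j; rewrite -!colE => /colP/(_ i); rewrite !mxE.
Qed.

Lemma wedge_app (G : 'M[R]_4) p q u :
  wedge G p q *m u = inner G q u *: p - inner G p u *: q.
Proof.
have outer p' q' : p' *m q'^T *m G *m u = inner G q' u *: p'.
  rewrite -!mulmxA [q'^T *m _]mulmxA [q'^T *m G *m u]mx11_scalar.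
  by rewrite mul_mx_scalar.
by rewrite /wedge !mulmxBl !outer.
Qed.

Definition tetrad_mx (l n x y : E) : 'M[R]_4 :=
  \matrix_(i < 4, j < 4) [:: l; n; x; y]`_j i 0.

(** Both sides are compared on the four tetrad vectors, where [wedge_app] reduces everything to
    inner products. *)
Lemma tetrad_wedge (G : 'M[R]_4) l n x y : G^T = G -> null_tetrad G l n x y ->
  wedge G l n = tetrad_mx l n x y *m boost *m invmx (tetrad_mx l n x y) /\
  wedge G x y = tetrad_mx l n x y *m rotation *m invmx (tetrad_mx l n x y).
Proof.
move=> Gs [Pu [ln xx yy] [ll nn] [lx ly nx ny xy]]; set P := tetrad_mx l n x y.
have innerC u v : inner G u v = inner G v u.
  by rewrite /inner -[in RHS](trmxK G) Gs -{1}[u^T *m G *m v]trmxK [LHS]mxE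
    !trmx_mul trmxK Gs mulmxA.
have PE (j : 'I_4) : P *m e_ j = [:: l; n; x; y]`_j.
  by rewrite -colE; apply/colP => i; rewrite !mxE.
have [P0 P1] : P *m e_ i0 = l /\ P *m e_ i1 = n by rewrite !PE.
have [P2 P3] : P *m e_ i2 = x /\ P *m e_ i3 = y by rewrite !PE.
have toP (A B : 'M[R]_4) : A *m P = P *m B -> A = P *m B *m invmx P.
  by move=> <-; rewrite mulmxK.
split; apply: toP; apply: eq_mulmx_delta; apply: ord4P;
  rewrite -[_ *m P *m _]mulmxA -[P *m _ *m _]mulmxA ?(P0, P1, P2, P3);
  rewrite wedge_app /boost /rotation mulmxBl !mul_delta_mx_cond /= ?(mulr0n, mulr1n)
    ?subrr ?sub0r ?subr0 ?mulmxN ?mulmx0 ?(P0, P1, P2, P3)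
    ?(ln, xx, yy, ll, nn, lx, ly, nx, ny, xy) ?(innerC n l, innerC x l, innerC y l,
     innerC x n, innerC y n, innerC y x) ?(ln, lx, ly, nx, ny, xy)
    ?scale1r ?scale0r ?subrr ?sub0r ?subr0 //.
Qed.

End Tetrad.

Section Holonomy.
#[local] Opaque derive.
Context {R : realType} {M : topologicalType} {X : manifold4 R M}.
Variable g : lorentz_metric X.

Lemma R7_holonomy_velocity : holonomy_type_R7 g -> exists p c (P : 'M[R]_4),
  [/\ chart_at X c p, P \in unitmx & forall C : R -> 'M[R]_4, Ck 1 setT C ->
    C 0 = 1%:M -> (forall t, holonomy_group g p c (C t)) -> in_R7 P (derive1 C 0)].
Proof.
move=> [p [c [cp [l [n [x [y [tet hol]]]]]]]].
have Gs := g_sym g cp.1 (cmap_cimg cp.2).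
have [w1 w2] := tetrad_wedge Gs tet.
exists p, c, (tetrad_mx l n x y); split=> //; first by case: tet.
move=> C C1 C0 Ch.
have : lie_algebra (holonomy_group g p c) (derive1 C 0) by exists C.
rewrite hol => -[a [b ->]]; exists a, b.
by rewrite w1 w2 (mulmxDr _ (a *: boost)) mulmxDl -!scalemxAr -!scalemxAl.
Qed.

(** Loops at [q], conjugated by the transport [T], are loops at [p0]; hence their velocities lie in
    the algebra of the transported tetrad [T *m P0], and [riem_in_R7] applies at [q]. *)
Lemma R7_curvature : holonomy_type_R7 g -> exists p0 c0 (P0 : 'M[R]_4),
  [/\ chart_at X c0 p0, P0 \in unitmx & forall q c T, chart_at X c q ->
    linked g p0 c0 q c T -> forall i j,
    in_R7 (T *m P0) (Riem (gcomp g c) (cmap c q) i j)].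
Proof.
move=> /R7_holonomy_velocity[p0 [c0 [P0 [cp0 P0u vel]]]].
exists p0, c0, P0; split=> // q c T cq L i j.
have [Tu _ _] := L.
have TPu : T *m P0 \in unitmx by rewrite unitmx_mul Tu.
apply: (riem_in_R7 cq.1 TPu) (cmap_cimg cq.2) => C C1 C0.
rewrite (cmapK cq.2) => Ct.
have Cd (t : R) : is_derive t 1 C (derive1 C t).
  by rewrite derive1E; apply: derivableP; exact: Ck_derivable C1 _.
pose D t := invmx T *m C t *m T.
have Dd (t : R) : is_derive t 1 D (invmx T *m derive1 C t *m T).
  exact: is_derive_mulmxr (is_derive_mulmxl (invmx T) (Cd t)).
have C1c t : {for t, continuous (derive1 C)}.
  have /(Ck_curveP _ _ openT)[_ C0'] := C1.
  exact: Ck_continuous C0' _.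
have [] := vel D.
- apply: (C1_curve openT (fun t _ => Dd t)) => t _.
  apply: continuous_mulmx; last exact: cst_continuous.
  by apply: continuous_mulmx; [exact: cst_continuous|exact: C1c].
- by rewrite /D C0 mulmx1 mulVmx.
- by move=> t; have [s Hs] := Ct t; exact: loop_holonomy cp0 L Hs.
move=> a [b]; rewrite [LHS]derive1E; have [_ ->] := Dd 0 => E1.
exists a, b.
rewrite invmx_mulmx// -[LHS](mulKVmx Tu) -[invmx T *m _](mulmxK Tu) E1.
by rewrite !mulmxA.
Qed.

End Holonomy.

(** * Tensors annihilated by a mode *)

Section Rigidity.
#[local] Opaque derive.
Context {R : realType}.
Notation E := 'cV[R]_4.
Notation e_ c := (delta_mx c 0 : E).

Lemma conj_mxK n (P B : 'M[R]_n) : P \in unitmx ->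
  invmx P *m (P *m B *m invmx P) *m P = B.
Proof. by move=> Pu; rewrite !mulmxA mulVmx// mul1mx mulmxKV. Qed.

(** The infinitesimal action of an endomorphism on a tensor with two upper indices. *)
Definition annihilates n (Phi A : 'M[R]_n) : Prop := Phi *m A + A *m Phi^T = 0.

Lemma annihilates_conj n (P Phi A : 'M[R]_n) : P \in unitmx ->
  annihilates (P *m Phi *m invmx P) A ->
  annihilates Phi (invmx P *m A *m (invmx P)^T).
Proof.
move=> Pu /(congr1 (fun B => invmx P *m B *m (invmx P)^T)).
rewrite mulmxDr mulmxDl mulmx0 mul0mx !trmx_mul !mulmxA mulVmx// mul1mx.
rewrite -[X in _ + X]mulmxA -[P^T *m _]trmx_mul mulVmx// trmx1 mulmx1.
by rewrite /annihilates !mulmxA.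
Qed.

Lemma annihilates_lin n (Phi A B : 'M[R]_n) (a : R) : annihilates Phi A ->
  annihilates Phi B -> annihilates Phi (a *: A + B).
Proof.
rewrite /annihilates => HA HB.
rewrite mulmxDr mulmxDl -scalemxAr -scalemxAl addrACA -scalerDr HA HB.
by rewrite scaler0 addr0.
Qed.

Lemma annihilates_derive n (Phi : 'M[R]_n) (f : R -> 'M[R]_n) (t : R) df :
  (\forall s \near t, annihilates Phi (f s)) -> is_derive t 1 f df ->
  annihilates Phi df.
Proof.
move=> fP fd; rewrite /annihilates.
have [_ <-] := is_deriveD (is_derive_mulmxl Phi fd) (is_derive_mulmxr Phi^T fd).
rewrite (@near_eq_derive _ _ _ _ (fun=> 0)) ?derive_cst//.
Qed.

(** For [v = z] in the kernel, the condition makes the symmetric product of [Phi L] and [z] vanish,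
    so [Phi L = 0]; then [v = u] makes that of [Phi u] and [L] vanish. *)
Lemma annihilates_outer0 n (Phi : 'M[R]_n) (L z u : 'cV[R]_n) :
  (forall v : 'cV[R]_n, annihilates Phi (v *m L^T + L *m v^T)) ->
  z != 0 -> Phi *m z = 0 -> Phi *m u != 0 -> L = 0.
Proof.
move=> H z0 Pz Pu.
have HE v : (Phi *m v) *m L^T + (Phi *m L) *m v^T +
    (v *m (Phi *m L)^T + L *m (Phi *m v)^T) = 0.
  by rewrite -[RHS](H v) mulmxDr mulmxDl !trmx_mul !mulmxA.
have PL : Phi *m L = 0.
  apply: (outer_sym0 z0); have := HE z.
  by rewrite Pz trmx0 mul0mx mulmx0 add0r addr0.
apply: (outer_sym0 Pu); have := HE u.
by rewrite PL trmx0 mul0mx mulmx0 addr0 add0r addrC.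
Qed.

Lemma Riem_continuous (U : set E) (G : E -> 'M[R]_4) x i j : open U -> smooth U G ->
  (forall y, U y -> G y \in unitmx) -> U x ->
  {for x, continuous (fun y => Riem G y i j)}.
Proof.
move=> Uo Gs Gu Ux; have smo := Gam_smooth Uo Gs Gu.
have : Ck 0 U (fun y => 'D_(e_ i) (fun y => Gam G y j) y -
    'D_(e_ j) (fun y => Gam G y i) y + Gam G y i *m Gam G y j - Gam G y j *m Gam G y i).
  split=> // y Uy.
  have Fc := smooth_continuous (smo i) Uy; have Hc := smooth_continuous (smo j) Uy.
  have DHc := smooth_continuous (smooth_derive (e_ i) (smo j)) Uy.
  have DFc := smooth_continuous (smooth_derive (e_ j) (smo i)) Uy.
  have FHc := continuous_mulmx Fc Hc; have HFc := continuous_mulmx Hc Fc.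
  exact: (continuousB (continuousD (continuousB DHc DFc) FHc) HFc).
move=> /(Ck_ext Uo (g := fun y => Riem G y i j)) C0.
have {}C0 : Ck 0 U (fun y => Riem G y i j).
  by apply: C0 => y Uy; rewrite (RiemE Uo Gs Gu i j Uy).
exact: Ck_continuous C0 Ux.
Qed.

Lemma continuous_bil (T : topologicalType) (Rm : T -> 'I_4 -> 'I_4 -> 'M[R]_4)
    (u v : T -> E) x : (forall i j, {for x, continuous (fun y => Rm y i j)}) ->
  {for x, continuous u} -> {for x, continuous v} ->
  {for x, continuous (fun y => bil (Rm y) (u y) (v y))}.
Proof.
move=> Rc /continuous_mxP uc /continuous_mxP vc; apply/continuous_mxP => a b.
rewrite (_ : (fun y => _) = (fun y => \sum_i \sum_j (u y i 0 * v y j 0 * Rm y i j a b))).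
  apply: continuous_sumr => i; apply: continuous_sumr => j.
  apply: continuousM; first by apply: continuousM; [exact: uc|exact: vc].
  by have /continuous_mxP := Rc i j; exact.
apply/funext => y; rewrite /bil summxE; apply: eq_bigr => i _.
by rewrite summxE; apply: eq_bigr => j _; rewrite mxE.
Qed.

Section Line.
Variables (U : set E) (G G' : E -> 'M[R]_4).
Hypotheses (Uo : open U) (Gs : smooth U G) (Gs' : smooth U G').
Hypothesis Gunit : forall x, U x -> G x \in unitmx.
Hypothesis Gsym' : forall x, U x -> (G' x)^T = G' x.
Hypothesis Gunit' : forall x, U x -> G' x \in unitmx.
Hypothesis GamD : forall x c, U x -> Gam G' x c =
  Gam G x c + (e_ c *m (proj_form G G' x)^T + proj_form G G' x c 0 *: 1%:M).
Variables (x v : E) (Q : R -> 'M[R]_4).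
Hypotheses (Ux : U x) (Q0 : Q 0 = 1%:M).
Hypothesis Qd : is_derive (0 : R) 1 Q (Q 0 *m GamV G x v).

(** At 0 this is the covariant derivative along [v], for the connection of [G], of the inverse of
    [G']. That inverse is parallel for the connection of [G'], so only the terms with [psi]
    remain. *)
Lemma is_derive_pulled_metric :
  is_derive (0 : R) 1 (fun s => Q s *m invmx (G' (x + s *: v)) *m (Q s)^T)
   (- (v *m (invmx (G' x) *m proj_form G G' x)^T +
       (invmx (G' x) *m proj_form G G' x) *m v^T +
       (2 * ((proj_form G G' x)^T *m v) 0 0) *: invmx (G' x))).
Proof.
set psi := proj_form G G' x.
have Ad : derivable (fun y => invmx (G' y)) (x + 0 *: v) v.
  rewrite scale0r addr0.
  exact: smooth_derivable (invmx_metric_smooth Uo Gs' Gunit') Ux.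
have Ald := is_derive_line Ad.
have := is_derive_mulmx (is_derive_mulmx Qd Ald) (is_derive_trmx Qd).
rewrite !scale0r !addr0 Q0 !mul1mx trmx1 mulmx1.
rewrite (derive_inv_metric Uo Gs' Gsym' Gunit' v Ux).
move=> D; apply: (is_derive_eq D); rewrite (GamVD_proj GamD v Ux) -/psi.
have AS : (invmx (G' x))^T = invmx (G' x) by rewrite trmx_inv Gsym'.
move: (invmx (G' x)) AS (GamV G x v) ((psi^T *m v) 0 0) => A AS C a.
have -> : (C + (v *m psi^T + a *: 1%:M))^T = C^T + (psi *m v^T + a *: 1%:M).
  by rewrite !linearD /= trmx_mul trmxK linearZ /= trmx1.
rewrite !mulmxDl !mulmxDr trmx_mul AS.
rewrite -!scalemxAl -!scalemxAr mul1mx !mulmx1 !mulmxA.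
move: (C *m A) (A *m C^T) (v *m psi^T *m A) (A *m psi *m v^T) => *.
by apply/matrixP => i j; rewrite !mxE; ring.
Qed.

End Line.

End Rigidity.

(** * Vanishing of [psi] where the curvature does not vanish *)

Section Conclusion.
#[local] Opaque derive.
Context {R : realType} {M : topologicalType} {X : manifold4 R M}.
Notation E := 'cV[R]_4.
Notation e_ c := (delta_mx c 0 : E).
Variables (g g' : lorentz_metric X).
Hypothesis gg' : projectively_related g g'.
Variables (p0 : M) (c0 : chart R M) (P0 : 'M[R]_4).
Hypotheses (cp0 : chart_at X c0 p0) (P0u : P0 \in unitmx).
Hypothesis curv : forall q c T, chart_at X c q -> linked g p0 c0 q c T ->
  forall i j, in_R7 (T *m P0) (Riem (gcomp g c) (cmap c q) i j).

Local Notation psi c q := (proj_form (gcomp g c) (gcomp g' c) (cmap c q)).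
Local Notation rho c q P i j :=
  (bil (Riem (gcomp g c) (cmap c q)) (P *m e_ i) (P *m e_ j)).

(* [Phi] is the boost or the rotation, i.e. [l /\ n] or [x /\ y] in the transported
   tetrad. *)
Definition curvature_mode (Phi : 'M[R]_4) (i j : 'I_4) : Prop :=
  forall q c T, chart_at X c q -> linked g p0 c0 q c T -> exists a : R,
    rho c q (T *m P0) i j = (T *m P0) *m (a *: Phi) *m invmx (T *m P0) /\
    annihilates (rho c q (T *m P0) i j) (invmx (gcomp g' c (cmap c q))).

Lemma linked_frame_unit q c T : linked g p0 c0 q c T -> T *m P0 \in unitmx.
Proof. by case=> Tu _ _; rewrite unitmx_mul Tu. Qed.

Lemma curvature_modes : [/\ curvature_mode boost i0 i1, curvature_mode rotation i2 i3 &
  forall q c T, chart_at X c q -> linked g p0 c0 q c T ->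
    rho c q (T *m P0) i0 i1 = 0 -> rho c q (T *m P0) i2 i3 = 0 ->
    forall i j, Riem (gcomp g c) (cmap c q) i j = 0].
Proof.
have H q c T : chart_at X c q -> linked g p0 c0 q c T -> exists al be : R,
  [/\ rho c q (T *m P0) i0 i1 = (T *m P0) *m (al *: boost) *m invmx (T *m P0),
      rho c q (T *m P0) i2 i3 = (T *m P0) *m (be *: rotation) *m invmx (T *m P0),
      annihilates (rho c q (T *m P0) i0 i1) (invmx (gcomp g' c (cmap c q))),
      annihilates (rho c q (T *m P0) i2 i3) (invmx (gcomp g' c (cmap c q))) &
      al = 0 -> be = 0 -> forall i j, Riem (gcomp g c) (cmap c q) i j = 0].
  move=> cq L; have Pu := linked_frame_unit L; have cx := cmap_cimg cq.2.
  have Uo := cimg_isopen c; have Gs := g_smooth g cq.1; have Gs' := g_smooth g' cq.1.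
  have Gu := g_unit g cq.1; have Gu' := g_unit g' cq.1.
  have sy := g_sym g cq.1; have sy' := g_sym g' cq.1.
  have anti i j := Riem_antisym Uo Gs Gu i j cx.
  have bian a b i j := bianchi Uo sy a b i j cx.
  have [al [be [r01 r23 [r02 r30 r31 r12] r0]]] :=
    frame_curvature Pu (curv cq L) anti bian.
  have [LL RA] := projective_skew Uo Gs Gs' sy Gu sy' Gu'
    (fun y i => projective_Gam gg' i cq.1 (x := y)) cx.
  have [s01 s23] := frame_commute Pu RA r02 r30 r31.
  by exists al, be.
split=> q c T cq L; have [al [be [r01 r23 s01 s23 r0]]] := H q c T cq L.
- by exists al.
- by exists be.
have Pu := linked_frame_unit L.
have inj (a : R) (B : 'M[R]_4) : (T *m P0) *m (a *: B) *m invmx (T *m P0) = 0 ->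
    a *: B = 0.
  move=> /(congr1 (fun N => invmx (T *m P0) *m N *m (T *m P0))).
  by rewrite conj_mxK// mulmx0 mul0mx.
rewrite r01 r23 => /inj/matrixP/(_ i0 i0) + /inj/matrixP/(_ i2 i3).
rewrite !mxE /= !(mulr0n, mulr1n, subr0, mulr1) => al0 be0.
exact: r0.
Qed.

Section Mode.
Variables (Phi : 'M[R]_4) (i j a b : 'I_4) (z u : E).
Hypotheses (mode : curvature_mode Phi i j) (Phi1 : Phi a b = 1).
Hypotheses (z0 : z != 0) (Phiz : Phi *m z = 0) (Phiu : Phi *m u != 0).

Lemma mode_proj_form q c T : chart_at X c q -> linked g p0 c0 q c T ->
  rho c q (T *m P0) i j != 0 -> psi c q = 0.
Proof.
move=> cq L r0; have Pu := linked_frame_unit L; have cx := cmap_cimg cq.2.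
set P := T *m P0 in r0 Pu; set x := cmap c q in r0 cx *.
have ca := cq.1.
have Uo := cimg_isopen c; have Gs := g_smooth g ca; have Gs' := g_smooth g' ca.
have Gu := g_unit g ca; have Gu' := g_unit g' ca; have sy' := g_sym g' ca.
have GD y k (cy : cimg c y) := projective_Gam gg' k ca cy.
pose A := invmx (gcomp g' c x); pose ps := proj_form (gcomp g c) (gcomp g' c) x.
have AP : annihilates Phi (invmx P *m A *m (invmx P)^T).
  have [a1 [rE rA]] := mode cq L; apply: annihilates_conj Pu _.
  have a0 : a1 != 0.
    apply: contra r0 => /eqP a10.
    by rewrite rE a10 scale0r mulmx0 mul0mx.
  move: rA; rewrite rE -/P -scalemxAr -scalemxAl /annihilates [(_ *: _)^T]linearZ /=.
  rewrite -scalemxAl -scalemxAr -scalerDr => /eqP.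
  by rewrite scaler_eq0 (negbTE a0) => /eqP.
have small v : good_segment (cimg c) (gcomp g c) x v -> annihilates Phi
    ((invmx P *m v) *m (invmx P *m (A *m ps))^T +
     (invmx P *m (A *m ps)) *m (invmx P *m v)^T).
  move=> xv; have [W [Q [W0 Q0 WQ]]] := line_transport Uo Gs Gu xv.
  have z2 : -2 <= (0 : R) <= 2 by lra.
  have [Wd Qd _ _] := WQ 0 z2; rewrite scale0r addr0 in Wd Qd.
  (* Since [Phi a b = 1], this is the coefficient of the mode at [x + s *: v] in the transported
     tetrad. By continuity it stays nonzero near 0, where it can be divided out. *)
  pose f s := (invmx P *m Q s *m bil (Riem (gcomp g c) (x + s *: v))
    (W s *m P *m e_ i) (W s *m P *m e_ j) *m (W s *m P)) a b.
  have fc : {for 0, continuous f}.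
    have Wc := is_derive_continuous Wd; have Qc := is_derive_continuous Qd.
    have cc (N : 'M[R]_4) : {for 0, continuous (fun _ : R => N)} by exact: cst_continuous.
    have ce (N : E) : {for 0, continuous (fun _ : R => N)} by exact: cst_continuous.
    have Bc : {for 0, continuous (fun s : R => bil (Riem (gcomp g c) (x + s *: v))
        (W s *m P *m e_ i) (W s *m P *m e_ j))}.
      apply: continuous_bil => [i' j'||].
      - apply: (@continuous_comp _ _ _ (fun s : R => x + s *: v)
          (fun y => Riem (gcomp g c) y i' j')).
          by apply: cvgD; [exact: cvg_cst|exact: scalel_continuous].
        by rewrite scale0r addr0; exact: Riem_continuous Uo Gs Gu cx.
      - exact: continuous_mulmx (continuous_mulmx Wc (cc P)) (ce _).
      - exact: continuous_mulmx (continuous_mulmx Wc (cc P)) (ce _).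
    have := continuous_mulmx (continuous_mulmx (continuous_mulmx (cc (invmx P)) Qc) Bc)
      (continuous_mulmx Wc (cc P)).
    by move=> /continuous_mxP; exact.
  have at_s (s : R) : -1 <= s <= 1 -> f s != 0 ->
      annihilates Phi (invmx P *m (Q s *m invmx (gcomp g' c (x + s *: v)) *m (Q s)^T)
        *m (invmx P)^T).
    move=> s1 fs; have s2 : -2 <= s <= 2 by lra.
    have s1' : `|s| <= 1 by rewrite ler_norml.
    have [_ _ QW WQ1] := WQ s s2; have [cs _] := xv s s2.
    have [cdy cmy] := cimg_cinv cs.
    have cqs : chart_at X c (cinv c (x + s *: v)) by split.
    have Ls : linked g p0 c0 (cinv c (x + s *: v)) c (W s *m T).
      apply: linked_trans L _; have := segment_linked ca xv W0 WQ s1'.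
      by rewrite /x (cmapK cq.2).
    have Psu := linked_frame_unit Ls.
    have [a1 [rE rA]] := mode cqs Ls; rewrite cmy in rE rA.
    have PE : W s *m T *m P0 = W s *m P by rewrite mulmxA.
    rewrite PE in rE rA Psu.
    have iE : invmx (W s *m P) = invmx P *m Q s.
      have [Wu Qu] := mulmx1_unit WQ1.
      by rewrite invmx_mulmx// -[invmx (W s)]mulmx1 -WQ1 mulKmx.
    have a0 : a1 != 0.
      apply: contra fs => /eqP a10.
      by rewrite /f rE a10 scale0r mulmx0 !mul0mx mulmx0 mul0mx mxE.
    have : annihilates (W s *m P *m Phi *m invmx (W s *m P))
        (invmx (gcomp g' c (x + s *: v))).
      move: rA; rewrite rE -scalemxAr -scalemxAl /annihilates [(_ *: _)^T]linearZ /=.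
      rewrite -scalemxAl -scalemxAr -scalerDr => /eqP.
      by rewrite scaler_eq0 (negbTE a0) => /eqP.
    by move=> /(annihilates_conj Psu); rewrite iE trmx_mul !mulmxA.
  have f0 : f 0 != 0.
    have [a1 [rE _]] := mode cq L; rewrite -/P -/x in rE.
    have -> : f 0 = a1.
      rewrite /f Q0 W0 !mul1mx mulmx1 scale0r addr0 rE conj_mxK//.
      by rewrite mxE Phi1 mulr1.
    by apply: contra r0 => /eqP a10; rewrite rE a10 scale0r mulmx0 mul0mx.
  have near1 : \forall s \near (0 : R), -1 <= s <= 1.
    near=> s; apply/andP; split; apply: ltW; near: s;
      [apply: lt_nbhsr|apply: lt_nbhsl]; lra.
  have near2 : \forall s \near (0 : R), f s != 0.
    have /cvgrPdist_lt/(_ `|f 0|) := fc; rewrite normr_gt0 => /(_ f0).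
    apply: filterS => s; apply: contraTN => /eqP ->.
    by rewrite subr0 ltxx.
  have near3 : \forall s \near (0 : R), annihilates Phi (invmx P *m
      (Q s *m invmx (gcomp g' c (x + s *: v)) *m (Q s)^T) *m (invmx P)^T).
    by apply: filterS2 near1 near2; exact: at_s.
  have D := is_derive_pulled_metric Uo Gs' sy' Gu' GD cx Q0 Qd.
  have := annihilates_derive near3 (is_derive_mulmxr (invmx P)^T
    (is_derive_mulmxl (invmx P) D)).
  rewrite -/A -/ps => AD.
  (* [AP] removes the term [2 psi(v) A] from the derivative. *)
  have := annihilates_lin (- 1) AD (annihilates_lin (- (2 * (ps^T *m v) 0 0)) AP
    (_ : annihilates Phi 0)).
  move=> /(_ _); rewrite addr0 scaleN1r => AA.
  have {}AA : annihilates Phi (- (invmx P *m (- (v *m (A *m ps)^T + A *m ps *m v^T +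
      (2 * (ps^T *m v) 0 0) *: A)) *m (invmx P)^T) +
      (- (2 * (ps^T *m v) 0 0)) *: (invmx P *m A *m (invmx P)^T)).
    by apply: AA; rewrite /annihilates mulmx0 mul0mx addr0.
  move: AA; congr (annihilates Phi _).
  rewrite mulmxN mulNmx opprK !mulmxDr !mulmxDl -!scalemxAr -!scalemxAl scaleNr addrK.
  by rewrite !trmx_mul !mulmxA.
have [r r1 rP] := good_segment_near Uo Gs Gu cx.
have all_v v : annihilates Phi (v *m (invmx P *m (A *m ps))^T +
    (invmx P *m (A *m ps)) *m v^T).
  (* The condition is linear in [v], so any vector may be shortened until its segment is good. *)
  pose k := r / (`|P *m v| + 1).
  have k0 : 0 < k by rewrite divr_gt0// ltr_wpDl.
  have := small (k *: (P *m v)) (rP _ _).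
  have kn : `|k *: (P *m v)| <= r.
    rewrite normrZ gtr0_norm// /k mulrAC ler_pdivrMr ?ltr_wpDl//.
    by rewrite ler_pM2l// lerDl.
  move=> /(_ kn); rewrite -scalemxAr mulKmx// [(k *: v)^T]linearZ /=.
  rewrite -scalemxAl -scalemxAr -scalerDr /annihilates -scalemxAr -scalemxAl -scalerDr.
  by move=> /eqP; rewrite scaler_eq0 (gt_eqF k0) => /eqP.
have L0 := annihilates_outer0 all_v z0 Phiz Phiu.
have Au : A \in unitmx by rewrite unitmx_inv Gu'.
have iPu : invmx P \in unitmx by rewrite unitmx_inv.
by rewrite -/ps -(mulKmx Au ps) -(mulKmx iPu (A *m ps)) L0 !mulmx0.
Unshelve. all: by end_near. Qed.

End Mode.

Lemma connection_eq_nonflat q c : chart_at X c q ->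
  (exists i j, Riem (gcomp g c) (cmap c q) i j != 0) ->
  forall u, GamV (gcomp g c) (cmap c q) u = GamV (gcomp g' c) (cmap c q) u.
Proof.
move=> cq [i [j Rij]] u; have [T L] := all_linked g cp0 cq.
have [mb mr Rz] := curvature_modes.
suff ps0 : psi c q = 0.
  have GD y k (cy : cimg c y) := projective_Gam gg' k cq.1 cy.
  rewrite [RHS](GamVD_proj GD u (cmap_cimg cq.2)).
  by rewrite ps0 trmx0 mulmx0 mul0mx mxE scale0r !addr0.
have dn (k : 'I_4) : e_ k != 0.
  apply/eqP => /matrixP/(_ k 0); rewrite !mxE !eqxx /= => /eqP.
  by rewrite oner_eq0.
(* [boost] kills [e_ i2] and fixes [e_ i0]; [rotation] kills [e_ i0] and sends [e_ i3] to
   [e_ i2]. *)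
have [r01|r01] := eqVneq (rho c q (T *m P0) i0 i1) 0; last first.
  apply: (mode_proj_form (a := i0) (b := i0) (z := e_ i2) (u := e_ i0) mb) L r01 => //.
  - by rewrite !mxE /= subr0.
  - by rewrite /boost mulmxBl !mul_delta_mx_cond /= !mulr0n subr0.
  - by rewrite /boost mulmxBl !mul_delta_mx_cond /= mulr0n subr0 mulr1n.
have [r23|r23] := eqVneq (rho c q (T *m P0) i2 i3) 0; last first.
  apply: (mode_proj_form (a := i2) (b := i3) (z := e_ i0) (u := e_ i3) mr) L r23 => //.
  - by rewrite !mxE /= subr0.
  - by rewrite /rotation mulmxBl !mul_delta_mx_cond /= !mulr0n subr0.
  - by rewrite /rotation mulmxBl !mul_delta_mx_cond /= mulr0n subr0 mulr1n.
by rewrite (Rz q c T cq L r01 r23) eqxx in Rij.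
Qed.

End Conclusion.

Theorem theorem6p2 (R : realType) (M : topologicalType) (X : manifold4 R M)
    (g g' : lorentz_metric X) :
  nonflat g -> holonomy_type_R7 g -> projectively_related g g' ->
  same_connection g g'.
Proof.
move=> nf /R7_curvature[p0 [c0 [P0 [cp0 P0u curv]]]] gg' c x ca cx i j k.
pose D y := christoffel (gcomp g c) y i j k - christoffel (gcomp g' c) y i j k.
suff : D x = 0 by move=> /eqP; rewrite subr_eq0 => /eqP.
apply/eqP/negPn/negP => Dx.
have Dc y : cimg c y -> {for y, continuous D}.
  move=> cy.
  have sm h := smooth_continuous (christoffel_smooth (cimg_isopen c) (g_smooth h ca)
    (g_unit h ca) i j k) cy.
  exact: (continuousB (sm g) (sm g')).
(* If a Christoffel component differs at one point, it differs on an open set, and nonflatness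
   provides a point of nonzero curvature there. That curvature may be read in another chart [c'],
   whence the passage through [connection_eq_chart]. *)
pose V := [set p | cdom c p /\ D (cmap c p) != 0].
have Vo : open V.
  rewrite openE => p [cp Dp]; rewrite /interior.
  have n1 : \forall q \near p, cdom c q.
    by apply: open_nbhs_nbhs; split=> //; exact: cdom_open.
  have Dpc : {for p, continuous (D \o cmap c)}.
    apply: continuous_comp; first exact: cmap_continuous.
    by apply: Dc; exact: cmap_cimg.
  have n2 : \forall q \near p, D (cmap c q) != 0.
    have /cvgrPdist_lt/(_ `|D (cmap c p)|) := Dpc; rewrite normr_gt0 => /(_ Dp).
    apply: filterS => q; apply: contraTN => /eqP /= ->.
    by rewrite subr0 ltxx.
  by apply: filterS2 n1 n2 => q; split.
have [cd cm] := cimg_cinv cx.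
have [|p [c' [Vp c'p [a [b [l [m Rp]]]]]]] := nf V Vo.
  by exists (cinv c x); split=> //; rewrite cm.
have [cp Dp] := Vp.
have Eq : forall u, GamV (gcomp g c') (cmap c' p) u = GamV (gcomp g' c') (cmap c' p) u.
  apply: (connection_eq_nonflat gg' cp0 P0u curv c'p); exists l, m.
  by apply: contra Rp => /eqP/matrixP/(_ a b); rewrite !mxE => ->.
have := connection_eq_chart (conj ca cp) c'p Eq (delta_mx j 0).
rewrite !GamV_delta => /matrixP/(_ i k); rewrite !mxE => E1.
by move: Dp; rewrite /D E1 subrr eqxx.
Qed.
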